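(* Let $M$ be a closed Riemannian manifold, let $r\ge 1$, and let $\mu$ be a Borel probability measure on $\mathrm{Diff}^r_{\mathrm{vol}}(M)$. Suppose that the associated two-point motion enjoys annealed exponential mixing on $\mathcal{H}^p_0(M\times M)$ for some $p\ge 0$, i.e. there exist $C\ge 0$ and $\alpha>0$ such that for all $A,B\in\mathcal{H}^p_0(M\times M)$ and all $N\in\mathbb{N}$, $$\left|\mathbb{E}\left(\iint A(x,y)\,B(F^N_\omega x,F^N_\omega y)\,dx\,dy\right)\right|\le C\,\|A\|_{\mathcal{H}^p_0}\|B\|_{\mathcal{H}^p_0}\,e^{-\alpha N}.$$ Then for every $s>0$ there exists $\beta>0$ such that for $\mu^{\mathbb{N}}$-almost every $\omega$ there exists a finite constant $C(\omega)$ such that for all $A,B\in\mathcal{H}^s_0(M)$, all integers $N\ge 1$ and all integers $k\ge 0$, $$\left|\int_M A(F^N_\omega x)\,B(F^{N+k}_\omega x)\,dx\right|\le C(\omega)\,N\,\|A\|_{\mathcal{H}^s_0}\|B\|_{\mathcal{H}^s_0}\,e^{-\beta k}.$$ Moreover, $C(\omega)$ can be taken to have a polynomial tail: there exists $C'$ such that $\mathbb{P}(C(\omega)>D)\le C'D^{-2}$ for all $D>0$.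
   Context: $\mathrm{Diff}^r_{\mathrm{vol}}(M)$ is the group of $C^r$ diffeomorphisms of $M$ preserving the Riemannian volume; $dx$ denotes integration against volume, normalized to total mass $1$. A word $\omega=(\omega_0,\omega_1,\dots)$ is distributed according to $\mu^{\mathbb{N}}$; $\mathbb{P}$ and $\mathbb{E}$ denote probability and expectation over $\omega$ only. $F^N_\omega=\omega_{N-1}\circ\cdots\circ\omega_0$ is the composition of the first $N$ (independent, $\mu$-distributed) maps, $F^0_\omega=\mathrm{id}$. The two-point motion is the induced random dynamics $(x,y)\mapsto(F^N_\omega x,F^N_\omega y)$ on $M\times M$. For $X=M$ or $M\times M$, $\mathcal{H}^s_0(X)$ is the space of zero-mean functions in the $L^2$-Sobolev space of order $s$ on $X$, with its usual norm, e.g. $\|A\|^2=\sum_i|a_i|^2(1+\mu_i)^{s}$ where $A=\sum_i a_i\varphi_i$ in an $L^2$-orthonormal basis of eigenfunctions $-\Delta\varphi_i=\mu_i\varphi_i$ (the choice among equivalent norms is immaterial). *)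

(* Defs.v *)
From HB Require Import structures.
From mathcomp Require Import all_boot all_order all_algebra.
From mathcomp Require Import all_classical all_reals all_analysis.
Set Implicit Arguments.
Unset Strict Implicit.
Unset Printing Implicit Defensive.
Import Order.TTheory GRing.Theory Num.Theory.
Import numFieldNormedType.Exports.
Local Open Scope classical_set_scope.
Local Open Scope ring_scope.

(* For [l = [:: i1; ...; ik]] this is d_i1 (d_i2 (... (d_ik f))). *)
Definition partials (R : realType) (d : nat) (l : seq 'I_d)
    (f : 'rV[R]_d -> R) : 'rV[R]_d -> R :=
  foldr (fun i g x => 'D_(delta_mx ord0 i) g x) f l.

(* [U] is meant to be open: [f] is total, and its values outside [U] are
   irrelevant. *)
Definition class_C (R : realType) (d k : nat) (U : set 'rV[R]_d)
    (f : 'rV[R]_d -> R) : Prop :=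
  forall l : seq 'I_d,
    ((size l <= k)%N -> {in U, continuous (partials l f)}) /\
    ((size l < k)%N -> forall (i : 'I_d) (x : 'rV[R]_d), U x ->
       derivable (partials l f) x (delta_mx ord0 i)).

Definition smooth_on (R : realType) (d : nat) (U : set 'rV[R]_d)
    (f : 'rV[R]_d -> R) : Prop := forall k, class_C k U f.

(* Lebesgue integral over R^d of a nonnegative Borel function, as an iterated
   one-dimensional integral (Tonelli); for d = 0 it is evaluation at the only
   point. *)
Fixpoint integral_rV (R : realType) (d : nat) :
    ('rV[R]_d -> \bar R) -> \bar R :=
  match d with
  | 0 => fun f => f 0
  | d'.+1 => fun f =>
      (\int[lebesgue_measure]_(t in [set: R])
         integral_rV (fun v : 'rV[R]_d' =>
           f (row_mx (const_mx t : 'rV[R]_1) v)))%E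
  end.

(* Closed means compact without boundary; connectedness is not required.
   Second countability is not listed: a compact space covered by Euclidean
   charts has it.  [cmet i u] is the Gram matrix of the metric, at the point of
   coordinates [u], in the coordinate frame of the chart [i]; tangent vectors
   are row vectors, so the Jacobian matrix of a transition map acts on the
   right. *)
Record closedRiemannian (R : realType) (d : nat) := ClosedRiemannian {
  carrier :> ptopologicalType ;
  chart_index : Type ;
  cdom : chart_index -> set carrier ;
  chart : chart_index -> carrier -> 'rV[R]_d ;
  cinv : chart_index -> 'rV[R]_d -> carrier ;
  cmet : chart_index -> 'rV[R]_d -> 'M[R]_d ;
  carrier_hausdorff : hausdorff_space carrier ;
  carrier_compact : compact [set: carrier] ;
  cdom_open : forall i, open (cdom i) ;
  cdom_cover : forall x : carrier, exists i, cdom i x ;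
  cimg_open : forall i, open (chart i @` cdom i) ;
  chartK : forall i x, cdom i x -> cinv i (chart i x) = x ;
  chart_continuous : forall i, {in cdom i, continuous (chart i)} ;
  cinv_continuous : forall i, {in chart i @` cdom i, continuous (cinv i)} ;
  transition_smooth : forall i j (a : 'I_d),
    smooth_on (chart i @` (cdom i `&` cdom j))
      (fun u => chart j (cinv i u) ord0 a) ;
  cmet_smooth : forall i (a b : 'I_d),
    smooth_on (chart i @` cdom i) (fun u => cmet i u a b) ;
  cmet_sym : forall i u, (chart i @` cdom i) u -> (cmet i u)^T = cmet i u ;
  cmet_pos : forall i u, (chart i @` cdom i) u ->
    forall v : 'rV[R]_d, v != 0 -> 0 < (v *m cmet i u *m v^T) ord0 ord0 ;
  cmet_transition : forall i j u, (chart i @` (cdom i `&` cdom j)) u ->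
    let J : 'M[R]_d := \matrix_(a, b)
      partials [:: a] (fun w => chart j (cinv i w) ord0 b) u in
    cmet i u = J *m cmet j (chart j (cinv i u)) *m J^T
}.

Section Manifold.
Variables (R : realType) (d : nat) (M : closedRiemannian R d).

Definition borel : Type := g_sigma_algebraType (@open M).
HB.instance Definition _ := Measurable.on borel.

Definition smooth_fun (f : M -> R) : Prop :=
  forall i, smooth_on (chart i @` cdom i) (f \o @cinv _ _ M i).

Definition vol_density (i : chart_index M) (u : 'rV[R]_d) : R :=
  Num.sqrt (\det (cmet i u)).

(* The Laplace-Beltrami operator in the coordinates of the chart [i]:
   |g|^(-1/2) d_a (|g|^(1/2) g^(ab) d_b f). *)
Definition laplacian (i : chart_index M) (f : M -> R) (u : 'rV[R]_d) : R :=
  (vol_density i u)^-1 *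
  \sum_(a < d) partials [:: a]
    (fun w => vol_density i w *
       \sum_(b < d) invmx (cmet i w) a b *
                    partials [:: b] (f \o @cinv _ _ M i) w) u.

(* [m] is the Riemannian volume divided by the total volume. *)
Definition is_normalized_volume (m : probability borel R) : Prop :=
  exists2 c : R, 0 < c & forall i (E : set borel),
    measurable E -> E `<=` cdom i ->
    m E = (c%:E * integral_rV (fun u =>
             (\1_(chart i @` E) u * vol_density i u)%:E))%E.

End Manifold.

Section Sobolev.
Variables (R : realType) (dX : measure_display) (X : measurableType dX).
Variable m : {measure set X -> \bar R}.

Definition coef (A e : X -> R) : R := (\int[m]_x (A x * e x))%R.

(* Completeness is Parseval's identity, i.e. A = \sum_j (coef A (e j)) e j in
   L^2 for all A in L^2. *)
Definition orthonormal_basis (J : choiceType) (e : J -> X -> R) : Prop :=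
  [/\ forall j, e j \in Lfun m 2%:E,
      forall j k, coef (e j) (e k) = (j == k)%:R
    & forall A : X -> R, A \in Lfun m 2%:E ->
        (\esum_(j in [set: J]) (coef A (e j) ^+ 2)%:E
         = \int[m]_x (A x ^+ 2)%:E)%E].

Variables (J : choiceType) (e : J -> X -> R) (lam : J -> R).

Definition sobolev_sqnorm (s : R) (A : X -> R) : \bar R :=
  \esum_(j in [set: J]) (coef A (e j) ^+ 2 * (1 + lam j) `^ s)%:E.

(* For s >= 0, when [e] is an orthonormal basis of eigenfunctions of minus the
   Laplacian, with eigenvalues [lam], this is the space H^s_0. *)
Definition sobolev0 (s : R) : set (X -> R) :=
  [set A | [/\ A \in Lfun m 2%:E, (\int[m]_x A x)%R = 0
             & (sobolev_sqnorm s A < +oo)%E]].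

Definition sobolev_norm (s : R) (A : X -> R) : R :=
  Num.sqrt (fine (sobolev_sqnorm s A)).

End Sobolev.

Definition laplace_eigenbasis (R : realType) (d : nat)
    (M : closedRiemannian R d) (vol : probability (borel M) R) (I : countType)
    (phi : I -> borel M -> R) (lam : I -> R) : Prop :=
  [/\ orthonormal_basis vol phi,
      forall j, smooth_fun (phi j : M -> R)
    & forall j (i : chart_index M) x, cdom i x ->
        - laplacian i (phi j) (chart i x) = lam j * phi j x].

(* As the Laplacian of the product metric on M x M is the sum of the Laplacians
   in each variable, the functions phi_i(x) phi_j(y) form an orthonormal basis
   of eigenfunctions on M x M, with eigenvalues lam_i + lam_j. *)
Definition tensor_basis (R : realType) (X I : Type) (phi : I -> X -> R)
    (ij : I * I) (z : X * X) : R := phi ij.1 z.1 * phi ij.2 z.2.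

Definition tensor_eigenvalue (R : realType) (I : Type) (lam : I -> R)
    (ij : I * I) : R := lam ij.1 + lam ij.2.

(* [Some r] stands for the class C^r, [None] for C^infinity. *)
Definition le_reg (k : nat) (r : option nat) : bool :=
  if r is Some r' then (k <= r')%N else true.

Section Diffeo.
Variables (R : realType) (d : nat) (M : closedRiemannian R d).
Variables (vol : probability (borel M) R) (r : option nat).

Definition local_coord (i j : chart_index M) (f : M -> M) (a : 'I_d)
  (u : 'rV[R]_d) : R := chart j (f (cinv i u)) ord0 a.

Definition map_class_C (f : M -> M) : Prop :=
  continuous f /\ forall i j (a : 'I_d) k, le_reg k r ->
    class_C k (chart i @` (cdom i `&` f @^-1` cdom j)) (local_coord i j f a).

Record diffVol := DiffVol {
  diffVol_fun :> M -> M ;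
  diffVol_class : map_class_C diffVol_fun ;
  diffVol_inv : exists g : M -> M,
    [/\ map_class_C g, cancel diffVol_fun g & cancel g diffVol_fun] ;
  diffVol_vol : forall E : set (borel M), measurable E ->
    vol (diffVol_fun @^-1` E) = vol E
}.

Lemma id_class_C : map_class_C id.
Proof.
by split=> [x|i j a k _]; [exact: cvg_id|exact: transition_smooth].
Qed.

Definition diffVol_id : diffVol :=
  @DiffVol id id_class_C
    (ex_intro _ id (And3 id_class_C (fun=> erefl) (fun=> erefl)))
    (fun _ _ => erefl).

HB.instance Definition _ := gen_eqMixin diffVol.
HB.instance Definition _ := gen_choiceMixin diffVol.
HB.instance Definition _ := isPointed.Build diffVol diffVol_id.

(* Subbase of the C^r topology: the maps whose derivatives up to the order [k],
   read in the charts [i] and [j], are [eps]-close to those of [f] on the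
   compact set [K]. *)
Definition Cr_subbase : set (set diffVol) :=
  [set N | exists (f : diffVol) (i j : chart_index M) (K : set M) (k : nat)
                  (eps : R),
    [/\ compact K, K `<=` cdom i & f @` K `<=` cdom j] /\
    [/\ le_reg k r, 0 < eps &
     N = [set g : diffVol | g @` K `<=` cdom j /\
       forall (l : seq 'I_d) (a : 'I_d) (x : M), (size l <= k)%N -> K x ->
         `|partials l (local_coord i j g a) (chart i x)
           - partials l (local_coord i j f a) (chart i x)| < eps]]].

HB.instance Definition _ :=
  @isSubBaseTopological.Build diffVol (set diffVol) Cr_subbase id.

Definition borelDiff : Type := g_sigma_algebraType (@open diffVol).
HB.instance Definition _ := Measurable.on borelDiff.

Definition cylinders : set (set (nat -> borelDiff)) :=
  [set C | exists n (B : set borelDiff),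
     measurable B /\ C = [set w | B (w n)]].

Definition words : Type := g_sigma_algebraType cylinders.
HB.instance Definition _ := Measurable.on words.

(* [P] is the infinite product measure mu^N; these values on cylinders
   determine it. *)
Definition is_product_measure (mu : probability borelDiff R)
    (P : probability words R) : Prop :=
  forall (n : nat) (B : nat -> set borelDiff), (forall i, measurable (B i)) ->
    P [set w | forall i, (i < n)%N -> B i (w i)] = (\prod_(i < n) mu (B i))%E.

Fixpoint compose (w : words) (n : nat) (x : borel M) : borel M :=
  if n is n'.+1 then (w n' : diffVol) (compose w n' x) else x.

Definition two_point_mixing (P : probability words R) (I : countType)
    (phi : I -> borel M -> R) (lam : I -> R) (p : R) : Prop :=
  let vol2 := (vol \x vol)%E in
  let H := sobolev0 vol2 (tensor_basis phi) (tensor_eigenvalue lam) p in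
  let norm :=
    sobolev_norm vol2 (tensor_basis phi) (tensor_eigenvalue lam) p in
  exists C alpha : R, [/\ 0 <= C, 0 < alpha &
    forall (A B : borel M * borel M -> R) (N : nat), H A -> H B ->
      `|\int[P]_w \int[vol2]_z
           (A z * B (compose w N z.1, compose w N z.2))|
      <= C * norm A * norm B * expR (- alpha * N%:R)].

End Diffeo.

(* Main.v *)
Require Import Defs.
From HB Require Import structures.
From mathcomp Require Import all_boot all_order all_algebra.
From mathcomp Require Import all_classical all_reals all_analysis.
From mathcomp Require Import measurable_realfun ring lra zify.
Set Implicit Arguments.
Unset Strict Implicit.
Unset Printing Implicit Defensive.
Import Order.TTheory GRing.Theory Num.Theory.
Import numFieldNormedType.Exports.
Local Open Scope classical_set_scope.
Local Open Scope ring_scope.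

(** The square of a one-point correlation \int f(x) g(F^k x) dx is the two-point
    correlation of f(x) f(y) and g(x) g(y), so its expectation decays like
    e^(-alpha k) when f and g are finite combinations of eigenfunctions, with a
    loss polynomial in the eigenvalues.  The functions psi_i used here are the
    eigenfunctions phi_i corrected by a multiple of one fixed eigenfunction of
    nonzero mean, so as to have mean zero.  By the shift invariance of P, the
    sum over all starting times N (weighted by 1/(N(N+1))), all k (weighted by
    an exponential) and all pairs i, j with eigenvalues at most e^(eps k) of the
    squared correlations is an integrable random variable; its square root is
    C(omega) up to constants, and Markov's inequality gives the tail.  The
    part of A and B above the frequency e^(eps k) has L^2 norm
    O(e^(-eps s k / 2)).

    The number of eigenvalues at most L must be polynomial in L.  If there were
    more eigenfunctions than cells in a grid of mesh 1/n on finitely many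
    coordinate cubes covering M, some combination u of them would have mean zero
    on every cell; the Poincare inequality on the cells and the Caccioppoli
    inequality on the cubes would then give |u| <= C (1 + L) |u| / n in L^2.
    Eigenvalues are nonnegative by the maximum principle. *)

(** * Lebesgue measure on Euclidean boxes *)

(** The exceptional null set must be fixed before [A] and [B], which range over uncountable spaces.
    Only the correlations of the countably many psi_i are treated as random; passing from them to
    [A] and [B] is a deterministic estimate for each word.

    Exponents. At the cutoff e^(eps k) there are O(e^(4 d eps k)) pairs, and the Sobolev loss is
    O(e^(p eps k)); eps is small enough that both together cost at most e^(alpha k / 2). Half of the
    remaining rate alpha / 2 is spent on summing over k and the square root halves the rest, which
    leaves alpha / 8; the high frequencies decay at rate eps s / 2. The factor N is the square root
    of the inverse weight N (N + 1), up to a constant.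

    All integrations by parts take place in one coordinate cube, against a cutoff vanishing on its
    faces; no global Green formula enters. This is also why eigenfunctions are made mean-zero by
    hand. The count obtained grows like L^(2 d) where Weyl's law has L^(d / 2); polynomial growth is
    all that the choice of eps uses. *)

Lemma measurable_bigcup_countType d (X : sigmaRingType d) (I : countType) (P : set I)
    (F : I -> set X) :
  (forall i, P i -> measurable (F i)) -> measurable (\bigcup_(i in P) F i).
Proof.
move=> mF; rewrite bigcup_mkcond; apply: countable_bigcupT_measurable => // i.
by case: ifPn => // /set_mem; exact: mF.
Qed.

Section sf_prod.
Context d1 d2 (T1 : measurableType d1) (T2 : measurableType d2) (R : realType).
Context (m1 : {sigma_finite_measure set T1 -> \bar R}).
Context (m2 : {sigma_finite_measure set T2 -> \bar R}).
(** A copy of the product measure under its own name, so that a sigma-finite structure can be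
    attached to it; the recursion of [leb] iterates this structure. *)
Definition sf_prod : set (T1 * T2) -> \bar R := (m1 \x m2)%E.
HB.instance Definition _ := Measure.on sf_prod.
Lemma sf_prod_sigma_finite : sigma_finite setT sf_prod.
Proof.
have /sigma_finiteP[F [TF ndF Foo]] := sigma_finiteT m1.
have /sigma_finiteP[G [TG ndG Goo]] := sigma_finiteT m2.
exists (fun n => F n `*` G n) => [|k].
  apply/esym; rewrite -subTset => -[x y] _.
  have [n _ Fnx] : (\bigcup_n F n) x by rewrite -TF.
  have [k _ Gky] : (\bigcup_n G n) y by rewrite -TG.
  exists (maxn n k) => //; split => /=.
    by move: x Fnx; exact/subsetPset/ndF/leq_maxl.
  by move: y Gky; exact/subsetPset/ndG/leq_maxr.
have [mF Fk] := Foo k; have [mG Gk] := Goo k.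
split; first exact: measurableX.
by rewrite /sf_prod product_measure1E// lte_mul_pinfty// ge0_fin_numE.
Qed.
HB.instance Definition _ := @Measure_isSigmaFinite.Build _ _ _ sf_prod sf_prod_sigma_finite.
End sf_prod.

(* R^d as an iterated product, the form in which product measures are available;
   [pt] identifies it with row vectors. *)
Section euclid.
Variable R : realType.

Definition lineT : measurableType (sigma_display R.-ocitv.-measurable) :=
  g_sigma_algebraType R.-ocitv.-measurable.

Fixpoint eu_disp (d : nat) : measure_display :=
  match d with
  | 0 => default_measure_display
  | d'.+1 => measure_prod_display (sigma_display R.-ocitv.-measurable, eu_disp d')
  end.
Fixpoint eu (d : nat) : measurableType (eu_disp d) :=
  match d return measurableType (eu_disp d) with
  | 0 => unit
  | d'.+1 => (lineT * eu d')%type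
  end.
Fixpoint leb d : {sigma_finite_measure set (eu d) -> \bar R} :=
  match d return {sigma_finite_measure set (eu d) -> \bar R} with
  | 0 => @dirac _ (unit : measurableType _) tt R
  | d'.+1 => (sf_prod (@lebesgue_measure R) (leb d') :
      {sigma_finite_measure set (lineT * eu d')%type -> \bar R})
  end.
Definition consR d (t : R) (v : 'rV[R]_d) : 'rV[R]_d.+1 :=
  row_mx (const_mx t : 'rV[R]_1) v.

Lemma consR0 d t (v : 'rV[R]_d) : consR t v ord0 ord0 = t.
Proof.
have -> : (ord0 : 'I_d.+1) = lshift d (ord0 : 'I_1) by exact/val_inj.
by rewrite /consR (@row_mxEl _ _ 1 d) mxE.
Qed.

Lemma consRS d t (v : 'rV[R]_d) (a : 'I_d) : consR t v ord0 (lift ord0 a) = v ord0 a.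
Proof.
have -> : lift ord0 a = rshift 1 a :> 'I_d.+1 by exact/val_inj.
by rewrite /consR (@row_mxEr _ _ 1 d).
Qed.

Fixpoint pt d : eu d -> 'rV[R]_d :=
  match d return eu d -> 'rV[R]_d with
  | 0 => fun _ => 0
  | d'.+1 => fun z => consR z.1 (pt z.2)
  end.

Lemma measurable_pt d (a : 'I_d) : measurable_fun setT (fun z : eu d => pt z ord0 a).
Proof.
elim: d a => [[]//|d IH a].
rewrite [X in measurable_fun _ X](_ : _ = fun z : (lineT * eu d)%type =>
  if fintype.split (a : 'I_(1+d)) is inr b then pt z.2 ord0 b else z.1).
  case: (fintype.split _) => [_|b]; first exact: measurable_fst.
  exact: (measurableT_comp (IH b) measurable_snd).
by apply/funext => z /=; rewrite /consR mxE; case: (fintype.split _) => // b; rewrite mxE.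
Qed.

(** An open set is the countable union of the balls with rational centre and radius 1/(n+1) that it
    contains. Balls of row vectors are cubes, so lying in one is a separate condition on each
    coordinate. *)
Lemma measurable_open_rV d dX (X : measurableType dX) (F : X -> 'rV[R]_d) (D : set X) (O : set 'rV[R]_d) :
  measurable D ->
  (forall a, measurable_fun D (fun x => F x ord0 a)) -> open O -> measurable (D `&` F @^-1` O).
Proof.
move=> mD mF oO.
pose q2r (q : 'rV[rat]_d) : 'rV[R]_d := map_mx (@ratr R) q.
have -> : F @^-1` O = \bigcup_(qn in [set qn : 'rV[rat]_d * nat | ball (q2r qn.1) (qn.2.+1%:R^-1) `<=` O])
   (F @^-1` ball (q2r qn.1) (qn.2.+1%:R^-1)).
  apply/seteqP; split=> [x /= Ox|x [qn /= qnO]]; last by move=> /qnO.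
  have /nbhs_ballP[e /= e0 eO] := open_nbhs_nbhs (conj oO Ox).
  have [n ne] : exists n, (n.+1%:R^-1 : R) < e / 2.
    by have [n] := @ltr_add_invr R 0 (e / 2) (divr_gt0 e0 (ltr0Sn _ 1)); rewrite add0r; exists n.
  have n0 : 0 < (n.+1%:R^-1 : R) by rewrite invr_gt0 ltr0n.
  have /choice[q qP] : forall a, exists q : rat, `|F x ord0 a - ratr q| < n.+1%:R^-1.
    move=> a; have := @rat_in_itvoo R (F x ord0 a - n.+1%:R^-1) (F x ord0 a + n.+1%:R^-1).
    rewrite ltrBlDr -addrA ltrDl addr_gt0// => /(_ isT)[q].
    by rewrite in_itv /= => /andP[q1 q2]; exists q; rewrite ltr_norml; move: q1 q2;
      set u := _^-1; set v := F x ord0 a; set w := ratr q => q1 q2; apply/andP; split; lra.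
  have bx : ball (q2r (\row_a q a)) n.+1%:R^-1 (F x).
    split=> // i j; rewrite !mxE ord1 -ball_normE/= distrC; exact: qP.
  exists (\row_a q a, n) => //= y yb; apply: eO.
  by apply: ball_splitr (le_ball _ bx) (le_ball _ yb); exact: ltW.
rewrite setI_bigcupr.
apply: measurable_bigcup_countType => // qn _.
have -> : D `&` F @^-1` ball (q2r qn.1) qn.2.+1%:R^-1 =
   D `&` \bigcap_(a in [set: 'I_d]) (D `&` (fun x => F x ord0 a) @^-1` ball (q2r qn.1 ord0 a) qn.2.+1%:R^-1).
  apply/seteqP; split=> [x [Dx [_ H]]|x [Dx H]]; split=> //.
    by move=> a _; split=> //; exact: (H ord0 a).
  split=> [|i j]; first by rewrite invr_gt0.
  by rewrite ord1; have [] := H j I.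
apply: measurableI => //; apply: fin_bigcap_measurable => // a _.
apply: mF => //; apply: open_measurable; apply: ball_open; rewrite invr_gt0.
Qed.

(** Continuity of [g] is known only at the points of [F] over [D], so the preimage of [O] under [g]
    need not be open; seen from [D], it cannot be told from its interior, which is. *)
Lemma measurable_continuous_preimage d dX (X : measurableType dX) (F : X -> 'rV[R]_d)
    (D : set X) (Y : topologicalType) (g : 'rV[R]_d -> Y) (O : set Y) :
  measurable D -> (forall a, measurable_fun D (fun x => F x ord0 a)) ->
  (forall x, D x -> {for F x, continuous g}) -> open O ->
  measurable (D `&` (g \o F) @^-1` O).
Proof.
move=> mD mF cg oO.
have -> : D `&` (g \o F) @^-1` O = D `&` F @^-1` ((g @^-1` O)^°).
  apply/seteqP; split=> [x [Dx Ox]|x [Dx Ox]]; split=> //.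
    by apply: cg => //; exact: open_nbhs_nbhs.
  exact: (nbhs_singleton Ox).
by apply: measurable_open_rV => //; exact: open_interior.
Qed.

Lemma measurable_continuous_comp d dX (X : measurableType dX) (F : X -> 'rV[R]_d)
    (D : set X) (g : 'rV[R]_d -> R) :
  measurable D -> (forall a, measurable_fun D (fun x => F x ord0 a)) ->
  (forall x, D x -> {for F x, continuous g}) -> measurable_fun D (g \o F).
Proof.
move=> mD mF cg; apply: (measurability _ (RGenOpens.measurableE R)) => //.
move=> _ [_ [a [b ->] <-]].
by apply: measurable_continuous_preimage => //; exact: interval_open.
Qed.

Lemma integral_rVE d (f : 'rV[R]_d -> \bar R) : (forall u, 0 <= f u)%E ->
  measurable_fun setT (f \o @pt d) -> integral_rV f = (\int[leb d]_z f (pt z))%E.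
Proof.
elim: d f => [|d IH] f f0 mf /=; first by rewrite integral_dirac// diracT mul1e.
rewrite [RHS](fubini_tonelli1 (f \o @pt d.+1))//; last by move=> z; exact: f0.
apply: eq_integral => t _; rewrite IH//.
exact: (measurableT_comp mf (measurable_pair1 _)).
Qed.
End euclid.
Section prod.
Local Open Scope ereal_scope.
Context d1 d2 (T1 : measurableType d1) (T2 : measurableType d2) (R : realType).
Context (m1 : {sigma_finite_measure set T1 -> \bar R}).
Context (m2 : {sigma_finite_measure set T2 -> \bar R}).
Context (A : set T1) (B : set T2) (f : T1 * T2 -> \bar R).

Lemma integral_patch_setX1 x : \int[m2]_y (f \_ (A `*` B)) (x, y) =
  ((fun x => \int[m2]_(y in B) f (x, y)) \_ A) x.
Proof.
rewrite [RHS]patchE; case: ifPn => xA.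
  rewrite [RHS]integral_mkcond; apply: eq_integral => y _.
  by rewrite !patchE in_setX/= xA.
by rewrite integral0_eq// => y _; rewrite patchE in_setX/= (negbTE xA).
Qed.

Lemma integral_patch_setX2 y : \int[m1]_x (f \_ (A `*` B)) (x, y) =
  ((fun y => \int[m1]_(x in A) f (x, y)) \_ B) y.
Proof.
rewrite [RHS]patchE; case: ifPn => yB.
  rewrite [RHS]integral_mkcond; apply: eq_integral => x _.
  by rewrite !patchE in_setX/= yB andbT.
by rewrite integral0_eq// => x _; rewrite patchE in_setX/= (negbTE yB) andbF.
Qed.

Hypotheses (mA : measurable A) (mB : measurable B).
Let mX : measurable (A `*` B). Proof. exact: measurableX. Qed.

Section nonnegative.
Hypothesis mf : measurable_fun (A `*` B) f.
Hypothesis f0 : forall z, (A `*` B) z -> 0 <= f z.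

Let mp : measurable_fun setT (f \_ (A `*` B)).
Proof. exact/(measurable_restrictT _ mX). Qed.
Let p0 z : 0 <= (f \_ (A `*` B)) z.
Proof. by rewrite patchE; case: ifPn => // /set_mem; exact: f0. Qed.

Lemma ge0_integral_setX1 :
  \int[m1 \x m2]_(z in A `*` B) f z = \int[m1]_(x in A) \int[m2]_(y in B) f (x, y).
Proof.
rewrite integral_mkcond fubini_tonelli1// [RHS]integral_mkcond.
by apply: eq_integral => x _; exact: integral_patch_setX1.
Qed.

Lemma ge0_integral_setX2 :
  \int[m1 \x m2]_(z in A `*` B) f z = \int[m2]_(y in B) \int[m1]_(x in A) f (x, y).
Proof.
rewrite integral_mkcond fubini_tonelli2// [RHS]integral_mkcond.
by apply: eq_integral => y _; exact: integral_patch_setX2.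
Qed.

Lemma measurable_integral_setX1 :
  measurable_fun A (fun x => \int[m2]_(y in B) f (x, y)).
Proof.
apply/(measurable_restrictT _ mA).
rewrite (_ : _ \_ A = fubini_F m2 (f \_ (A `*` B))); first exact: measurable_fun_fubini_tonelli_F.
by apply/funext => x; rewrite -integral_patch_setX1.
Qed.

Lemma measurable_integral_setX2 :
  measurable_fun B (fun y => \int[m1]_(x in A) f (x, y)).
Proof.
apply/(measurable_restrictT _ mB).
rewrite (_ : _ \_ B = fubini_G m1 (f \_ (A `*` B))); first exact: measurable_fun_fubini_tonelli_G.
by apply/funext => y; rewrite -integral_patch_setX2.
Qed.
End nonnegative.

Hypothesis fi : (m1 \x m2)%E.-integrable (A `*` B) f.
Let ip : (m1 \x m2)%E.-integrable setT (f \_ (A `*` B)).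
Proof. by rewrite -integrable_mkcond. Qed.

Lemma integral_setX1 :
  \int[m1 \x m2]_(z in A `*` B) f z = \int[m1]_(x in A) \int[m2]_(y in B) f (x, y).
Proof.
rewrite integral_mkcond -(integral12_prod_meas1 ip) [RHS]integral_mkcond.
by apply: eq_integral => x _; exact: integral_patch_setX1.
Qed.

Lemma integral_setX2 :
  \int[m1 \x m2]_(z in A `*` B) f z = \int[m2]_(y in B) \int[m1]_(x in A) f (x, y).
Proof.
rewrite integral_mkcond -(integral21_prod_meas1 ip) [RHS]integral_mkcond.
by apply: eq_integral => y _; exact: integral_patch_setX2.
Qed.
End prod.

Section box.
Context (R : realType).
Implicit Types (lo : nat -> R) (h : R).

(** Corners are sequences indexed by [nat] instead of vectors of length [d]: dropping the first
    coordinate is then the shift [lotail], without any change of type. The box depends on the first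
    [d] values only. *)
Definition box d lo h : set 'rV[R]_d :=
  [set u | forall a : 'I_d, lo a <= u ord0 a <= lo a + h].
Definition ebox d lo h : set (eu R d) := @pt R d @^-1` box lo h.
Definition lotail lo : nat -> R := fun n => lo n.+1.

Lemma eboxS d lo h :
  @ebox d.+1 lo h = (`[lo 0, lo 0 + h]%classic : set (lineT R)) `*` @ebox d (lotail lo) h.
Proof.
apply/seteqP; split=> [z zb|z [/= z1 z2] a].
  split; first by have := zb ord0; rewrite (consR0 z.1 (pt z.2)) /= in_itv.
  by move=> a; have := zb (lift ord0 a); rewrite (consRS z.1 (pt z.2)) lift0.
case: (unliftP ord0 a) => [b ->|->]; first by rewrite (consRS z.1 (pt z.2)) lift0; exact: z2.
by rewrite (consR0 z.1 (pt z.2)); move: z1; rewrite in_itv.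
Qed.

Lemma measurable_ebox d lo h : measurable (@ebox d lo h).
Proof.
elim: d lo => [|d IH] lo; first by [].
by rewrite eboxS; apply: measurableX => //; exact: measurable_itv.
Qed.

Lemma leb_ebox d lo h : 0 <= h -> leb R d (ebox lo h) = (h ^+ d)%:E.
Proof.
move=> h0; elim: d lo => [|d IH] lo.
  by rewrite /= diracE expr0 mem_set// => -[].
rewrite eboxS /= /sf_prod product_measure1E//; last exact: measurable_ebox.
rewrite IH /= lebesgue_measure_itv/= lte_fin ltrDl.
have [h1|] := ltP; first by rewrite -EFinD addrAC subrr add0r -EFinM exprS.
by move=> h1; have -> : h = 0 by [lra]; rewrite mul0e exprS mul0r.
Qed.

Lemma compact_box d lo h : compact (@box d lo h).
Proof.
rewrite (_ : box _ _ = [set v : 'rV[R]_d | forall i : 'I_d, `[lo i, lo i + h]%classic (v ord0 i)]).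
  by apply: (@rV_compact R d (fun i => `[lo i, lo i + h]%classic)) => i; exact: segment_compact.
by apply/seteqP; split=> v H i; have := H i; rewrite /= in_itv.
Qed.

(** Continuity in the ambient space at each point of [B], which is stronger than continuity of the
    restriction. The functions in view live on an open chart image around a closed box, so they
    satisfy it up to the faces. *)
Definition cont_on d (B : set 'rV[R]_d) (f : 'rV[R]_d -> R) :=
  forall u, B u -> {for u, continuous f}.

Lemma cont_on_bounded d lo h (f : 'rV[R]_d -> R) : cont_on (box lo h) f ->
  exists2 C, 0 <= C & forall u, box lo h u -> `|f u| <= C.
Proof.
move=> cf; have [[u0 bu0]|/forallNP nb] := pselect (exists u, @box d lo h u); last first.
  by exists 0 => // u /nb.
have [||c _ cmax] := @EVT_max_rV R d (fun u => `|f u|) _ _ (@compact_box d lo h).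
- by exists u0.
- apply: continuous_in_subspaceT => u /set_mem bu.
  by apply: (continuous_comp (cf _ bu)); exact: norm_continuous.
by exists `|f c| => // u bu; apply: cmax; exact: mem_set.
Qed.

Lemma measurable_cont_on d lo h (f : 'rV[R]_d -> R) : cont_on (box lo h) f ->
  measurable_fun (ebox lo h) (f \o @pt R d).
Proof.
move=> cf; apply: measurable_continuous_comp; first exact: measurable_ebox; last first.
  by move=> z; exact: cf.
by move=> a; apply: (measurable_funS measurableT) => //; exact: measurable_pt.
Qed.

Lemma integrable_cont_on d lo h (f : 'rV[R]_d -> R) : 0 <= h -> cont_on (box lo h) f ->
  (leb R d).-integrable (ebox lo h) (EFin \o (f \o @pt R d)).
Proof.
move=> h0 cf; apply: measurable_bounded_integrable.
- exact: measurable_ebox.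
- by rewrite [X in (X < _)%E]leb_ebox// ltry.
- exact: measurable_cont_on.
have [C C0 fC] := cont_on_bounded cf.
exists C; split; first exact: num_real.
by move=> D CD z bz; apply: ltW; apply: le_lt_trans CD; exact: fC.
Qed.
End box.

(** * Poincare inequalities *)

Section calculus.
Context (R : realType).

Lemma is_derive_comp_affine (V W : normedModType R) (f : V -> R) (c : W -> V) (u v : V) (x w : W) (df : R) :
  (forall s, c (s *: w + x) = s *: v + u) -> is_derive u v f df -> is_derive x w (f \o c) df.
Proof.
move=> cE fu; have E : (fun h : R => h^-1 *: (((f \o c) \o shift x) (h *: w) - (f \o c) x)) =
    (fun h : R => h^-1 *: ((f \o shift u) (h *: v) - f u)).
  apply/funext => h /=; rewrite /= cE.
  by have := cE 0; rewrite !scale0r !add0r => ->.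
split; first by rewrite /derivable E; exact: ex_derive.
by rewrite /derive E; exact: derive_val.
Qed.

Local Notation mu := (@lebesgue_measure R).

Lemma is_derive1_continuous (F : R -> R) t df : is_derive (t : R) (1 : R) F (df : R) -> {for t, continuous F}.
Proof.
by move=> Ft; apply: differentiable_continuous; apply/derivable1_diffP; exact: ex_derive.
Qed.

Lemma ftc_segment (F f : R -> R) (a b : R) : a <= b ->
  (forall t, a <= t <= b -> is_derive (t : R) (1 : R) F (f t)) ->
  (forall t, a <= t <= b -> {for t, continuous f}) ->
  (\int[mu]_(t in `[a, b]) (f t)%:E = (F b - F a)%:E)%E.
Proof.
rewrite le_eqVlt => /predU1P[<- _ _|ab dF cf].
  by rewrite subrr set_itv1 integral_set1.
have cF t : a <= t <= b -> {for t, continuous F} by move=> /dF/is_derive1_continuous.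
rewrite (@continuous_FTC2 _ f F)// ?EFinB//.
- by apply: continuous_in_subspaceT => t /set_mem; rewrite /= in_itv; exact: cf.
- split.
  + by move=> t; rewrite in_itv => /andP[? ?]; have [] := dF t; rewrite // !ltW.
  + by apply: cvg_at_right_filter; apply: cF; rewrite lexx ltW.
  + by apply: cvg_at_left_filter; apply: cF; rewrite lexx ltW.
- move=> t; rewrite in_itv => /andP[? ?]; rewrite derive1E.
  by have [] := dF t; rewrite // !ltW.
Qed.

Lemma segment_integrable (f : R -> R) (a b : R) :
  (forall t, a <= t <= b -> {for t, continuous f}) ->
  mu.-integrable `[a, b] (EFin \o f).
Proof.
move=> cf; apply: continuous_compact_integrable; first exact: segment_compact.
by apply: continuous_in_subspaceT => t /set_mem; rewrite /= in_itv; exact: cf.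
Qed.

(* [(\int f)^2 <= (b - a) \int f^2], from [0 <= \int (f - m)^2] with [m] the mean. *)
Lemma sqr_integral_le (f : R -> R) (a b : R) : a <= b ->
  (forall t, a <= t <= b -> {for t, continuous f}) ->
  (\int[mu]_(t in `[a, b]) f t) ^+ 2 <= (b - a) * \int[mu]_(t in `[a, b]) (f t ^+ 2).
Proof.
rewrite le_eqVlt => /predU1P[<- _|ab cf].
  by rewrite subrr set_itv1 Rintegral_set1 expr0n mul0r.
have ba : 0 < b - a by rewrite subr_gt0.
set I := \int[mu]_(t in `[a, b]) f t; set m := I / (b - a).
have mI : measurable (`[a, b]%classic : set (measurableTypeR R)) by exact: measurable_itv.
have i1 : mu.-integrable `[a, b] (EFin \o f) by exact: segment_integrable.
have i2 : mu.-integrable `[a, b] (EFin \o (fun t => f t ^+ 2)).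
  by apply: segment_integrable => t /cf ft; exact: (cvgM ft ft).
have i3 : mu.-integrable `[a, b] (EFin \o (fun t => 2 * m * f t)).
  by apply: segment_integrable => t /cf ft; apply: cvgM => //; exact: cvg_cst.
have i4 : mu.-integrable `[a, b] (EFin \o (fun=> m ^+ 2)).
  by apply: segment_integrable => t _; exact: cvg_cst.
have i5 : mu.-integrable `[a, b] (EFin \o (fun t => f t ^+ 2 - 2 * m * f t)).
  by have := integrableB mI i2 i3; apply: eq_integrable.
have : 0 <= \int[mu]_(t in `[a, b]) ((f t ^+ 2 - 2 * m * f t) + m ^+ 2).
  apply: Rintegral_ge0 => t _; rewrite (_ : _ + _ = (f t - m) ^+ 2) ?sqr_ge0//; ring.
rewrite RintegralD// RintegralB// RintegralZl// Rintegral_cst//.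
rewrite -/I (_ : fine _ = b - a); last first.
  transitivity (fine (b - a)%:E) => //; congr fine.
  by apply: (eq_trans (lebesgue_measure_itv _)); rewrite /= lte_fin ab.
set J := \int[mu]_(t in _) _ => H.
rewrite -subr_ge0.
have -> : (b - a) * J - I ^+ 2 = (b - a) * (J - 2 * m * I + m ^+ 2 * (b - a)).
  by rewrite /m; field; rewrite gt_eqF.
by rewrite mulr_ge0// ltW.
Qed.

(** The fundamental theorem of calculus between [s] and [t], then Cauchy-Schwarz. Enlarging the
    interval of integration makes the bound independent of both points, so that it can be integrated
    over [t] and over the other coordinates. *)
Lemma poincare_segment (F f : R -> R) (a b s t : R) :
  a <= s <= b -> a <= t <= b ->
  (forall t, a <= t <= b -> is_derive (t : R) (1 : R) F (f t)) ->
  (forall t, a <= t <= b -> {for t, continuous f}) ->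
  (((F t - F s) ^+ 2)%:E <= (b - a)%:E * \int[mu]_(t in `[a, b]) (f t ^+ 2)%:E)%E.
Proof.
move=> /andP[sa sb] /andP[ta tb] dF cf.
wlog st : s t sa sb ta tb / s <= t.
  move=> H; have [/H|/ltW/H] := leP s t; first exact.
  by rewrite -[X in ((X ^+ 2)%:E <= _)%E]opprB sqrrN; exact.
have sub u : s <= u <= t -> a <= u <= b.
  by move=> /andP[su ut]; rewrite (le_trans sa)// (le_trans ut).
have cf2 u : a <= u <= b -> {for u, continuous (fun x => f x ^+ 2)}.
  by move=> /cf ft; exact: (cvgM ft ft).
have dF' u : s <= u <= t -> is_derive (u : R) (1 : R) F (f u) by move/sub; exact: dF.
have cf' u : s <= u <= t -> {for u, continuous f} by move/sub; exact: cf.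
have -> : F t - F s = \int[mu]_(u in `[s, t]) f u.
  by rewrite /Rintegral (ftc_segment st dF' cf').
apply: (@le_trans _ _ ((b - a) * \int[mu]_(u in `[s, t]) (f u ^+ 2))%:E).
  rewrite lee_fin; apply: le_trans (sqr_integral_le st cf') _.
  apply: ler_wpM2r; first by apply: Rintegral_ge0 => ? _; exact: sqr_ge0.
  by rewrite lerB.
rewrite EFinM; apply: lee_wpmul2l.
  by rewrite lee_fin subr_ge0 (le_trans sa).
have mI c d : measurable (`[c, d]%classic : set (measurableTypeR R)) by exact: measurable_itv.
rewrite /Rintegral fineK; last first.
  apply: integrable_fin_num => //; apply: segment_integrable => u /sub; exact: cf2.
apply: ge0_subset_integral => //.
- by have /integrableP[] := segment_integrable cf2.
- by move=> u _; rewrite lee_fin sqr_ge0.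
Qed.
End calculus.

(** * Slices and lines of a box *)

Section slices.
Context (R : realType).
Implicit Types (lo : nat -> R) (h : R).

Lemma rowP_ord d (u v : 'rV[R]_d.+1) : u ord0 ord0 = v ord0 ord0 ->
  (forall a, u ord0 (lift ord0 a) = v ord0 (lift ord0 a)) -> u = v.
Proof.
by move=> uv0 uvS; apply/rowP => a; case: (unliftP ord0 a) => [b ->|->].
Qed.

Lemma scaleaddE d s (w u : 'rV[R]_d) a : (s *: w + u) ord0 a = s * w ord0 a + u ord0 a.
Proof. by rewrite !mxE. Qed.

Lemma consRDl d s t (v : 'rV[R]_d) :
  consR (s + t) v = s *: delta_mx ord0 ord0 + consR t v.
Proof.
apply: rowP_ord => [|a]; rewrite scaleaddE ?consR0 ?consRS mxE /=.
  by rewrite mulr1.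
by rewrite mulr0 add0r.
Qed.

Lemma consRDr d s t (v : 'rV[R]_d) (b : 'I_d) :
  consR t (s *: delta_mx ord0 b + v) = s *: delta_mx ord0 (lift ord0 b) + consR t v.
Proof.
apply: rowP_ord => [|a]; rewrite scaleaddE ?consR0 ?consRS ?scaleaddE mxE /=.
  by rewrite mulr0 add0r.
by rewrite mxE (inj_eq lift_inj).
Qed.

Lemma box_consR d lo h t (v : 'rV[R]_d) :
  box lo h (consR t v) <-> (lo 0%N <= t <= lo 0%N + h /\ box (lotail lo) h v).
Proof.
split=> [H|[ht hv] a].
  split; first by have := H ord0; rewrite consR0.
  by move=> a; have := H (lift ord0 a); rewrite consRS lift0.
by case: (unliftP ord0 a) => [b ->|->]; rewrite ?consR0// consRS lift0; exact: hv.
Qed.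

Lemma consR_continuous1 d (t : R) (v : 'rV[R]_d) :
  {for t, continuous (fun s => consR s v)}.
Proof.
apply/cvg_ballP => e e0; apply: filterS (nbhsx_ballx t e e0) => s bs.
split=> // i j; rewrite ord1.
by case: (unliftP ord0 j) => [b ->|->]; rewrite ?consR0 ?consRS//; exact: ballxx.
Qed.

Lemma consR_continuous2 d (t : R) (v : 'rV[R]_d) : {for v, continuous (consR t)}.
Proof.
have FF := nbhs_filter v; apply/cvg_ballP => e e0; apply: (@filterS _ (nbhs v) (nbhs_filter v) _ _ _ (nbhsx_ballx v e e0)) => s [_ bs].
split=> // i j; rewrite ord1.
by case: (unliftP ord0 j) => [b ->|->]; rewrite ?consR0 ?consRS//; exact: ballxx.
Qed.

Lemma cont_on_slice d lo h t (f : 'rV[R]_d.+1 -> R) : lo 0%N <= t <= lo 0%N + h ->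
  cont_on (box lo h) f -> cont_on (box (lotail lo) h) (f \o consR t).
Proof.
move=> ht cf v bv; apply: continuous_comp; first exact: consR_continuous2.
by apply: cf; apply/box_consR.
Qed.

Lemma cont_on_line d lo h (v : 'rV[R]_d) (f : 'rV[R]_d.+1 -> R) :
  box (lotail lo) h v -> cont_on (box lo h) f ->
  forall t, lo 0%N <= t <= lo 0%N + h -> {for t, continuous (fun s => f (consR s v))}.
Proof.
move=> hv cf t ht; apply: (@continuous_comp _ _ _ (fun s => consR s v) f).
  exact: consR_continuous1.
by apply: cf; apply/box_consR.
Qed.

Lemma is_derive_slice d t (v : 'rV[R]_d) (b : 'I_d) (f : 'rV[R]_d.+1 -> R) df :
  is_derive (consR t v) (delta_mx ord0 (lift ord0 b)) f df ->
  is_derive v (delta_mx ord0 b) (f \o consR t) df.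
Proof. by apply: is_derive_comp_affine => s; exact: consRDr. Qed.

Lemma is_derive_line d (t : R) (v : 'rV[R]_d) (f : 'rV[R]_d.+1 -> R) (df : R) :
  is_derive (consR t v) (delta_mx ord0 ord0) f df ->
  is_derive (t : R) (1 : R) (fun s => f (consR s v)) df.
Proof.
apply: (@is_derive_comp_affine _ _ _ f (fun s => consR s v)) => s.
by rewrite scaler1 consRDl.
Qed.

(** The case of the divergence theorem needed for a cutoff function. Along lines of direction [a]
    the integral is a difference of two face values, both zero; the induction peels off coordinates
    until [a] is the first one. *)
Lemma integral_partial0 d lo h (a : 'I_d) (G g : 'rV[R]_d -> R) : 0 <= h ->
  (forall u, box lo h u -> is_derive u (delta_mx ord0 a) G (g u)) ->
  cont_on (box lo h) g ->
  (forall u, box lo h u -> (u ord0 a = lo a) \/ (u ord0 a = lo a + h) -> G u = 0) ->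
  (\int[leb R d]_(z in ebox lo h) (g (pt z))%:E = 0)%E.
Proof.
move=> h0; elim: d lo a G g => [? []//|d IH] lo a G g dG cg G0.
have gi := integrable_cont_on h0 cg; rewrite eboxS in gi *.
have mb := @measurable_ebox R d (lotail lo) h.
have mI : measurable (`[lo 0%N, lo 0%N + h]%classic : set (lineT R)) by exact: measurable_itv.
case: (unliftP ord0 a) dG G0 => [b ->|->] dG G0.
  rewrite (integral_setX1 mI mb gi); apply: integral0_eq => t /=; rewrite in_itv/= => ht.
  apply: (IH _ b (G \o consR t) (g \o consR t)).
  - by move=> v bv; apply: is_derive_slice; apply: dG; apply/box_consR.
  - exact: cont_on_slice.
  - move=> v bv H; apply: G0; first exact/box_consR.
    by rewrite consRS lift0.
rewrite (integral_setX2 mI mb gi); apply: integral0_eq => y yb /=.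
have hh : lo 0%N <= lo 0%N + h by rewrite lerDl.
have dF t : lo 0%N <= t <= lo 0%N + h ->
    is_derive (t : R) (1 : R) (fun s => G (consR s (pt y))) (g (consR t (pt y))).
  by move=> ht; apply: is_derive_line; apply: dG; apply/box_consR.
rewrite (ftc_segment hh dF); last exact: cont_on_line.
rewrite !G0 ?subrr//.
- by apply/box_consR; rewrite lexx lerDl h0.
- by left; rewrite consR0.
- by apply/box_consR; rewrite lexx hh.
- by right; rewrite consR0.
Qed.

End slices.

Section poincare.
Context (R : realType).
Implicit Types (lo : nat -> R) (h : R).
Local Notation mu := (@lebesgue_measure R).
Local Open Scope ereal_scope.

(** Some value is at most the mean: otherwise h S - I would be positive everywhere with zero
    integral, and an interval of length h > 0 would be negligible. Finiteness of the integral I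
    comes for free from the assumed strict inequality. *)
Lemma good_slice (S : lineT R -> \bar R) (a h : R) : (0 < h)%R ->
  measurable_fun (`[a, (a + h)%R]%classic : set (lineT R)) S ->
  (forall t, (a <= t <= a + h)%R -> 0 <= S t) ->
  exists2 t, (a <= t <= a + h)%R & h%:E * S t <= \int[mu]_(t in `[a, (a + h)%R]) S t.
Proof.
move=> h0 mS S0; apply: contrapT => H; set I := integral _ _ _ in H.
have mJ : measurable (`[a, (a + h)%R]%classic : set (lineT R)) by exact: measurable_itv.
have {}H t : (a <= t <= a + h)%R -> I < h%:E * S t.
  by move=> ht; rewrite ltNge; apply/negP => Hle; apply: H; exists t.
have ha : (a <= a <= a + h)%R by rewrite lexx lerDl ltW.
have S0' t : (`[a, (a + h)%R]%classic : set (lineT R)) t -> 0 <= S t.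
  by rewrite /= in_itv; exact: S0.
have I0 : 0 <= I by exact: integral_ge0.
have Ifin : I \is a fin_num.
  by rewrite ge0_fin_numE//; apply: lt_le_trans (H _ ha) _; exact: leey.
have iS : mu.-integrable `[a, (a + h)%R] S.
  apply/integrableP; split => //.
  rewrite (eq_integral S) -/I; first by rewrite ltey_eq Ifin.
  by move=> t /set_mem Jt; rewrite gee0_abs// S0'.
have muJ : mu `[a, (a + h)%R]%classic = h%:E.
  apply: (eq_trans (lebesgue_measure_itv _)).
  by rewrite /= lte_fin ltrDl h0 -EFinD addrAC subrr add0r.
have iI : mu.-integrable `[a, (a + h)%R] (fun=> I).
  apply/integrableP; split; first exact: measurable_cst.
  rewrite (integral_cst _ mJ) [X in _ * X]muJ gee0_abs//.
  by rewrite -(fineK Ifin) -EFinM ltry.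
have ihS : mu.-integrable `[a, (a + h)%R] (fun t => h%:E * S t).
  exact: integrableZl.
have : \int[mu]_(t in `[a, (a + h)%R]) `|h%:E * S t - I| = 0.
  rewrite (eq_integral (fun t => h%:E * S t - I)); last first.
    move=> t /set_mem /=; rewrite in_itv/= => ht; rewrite gee0_abs//.
    by rewrite sube_ge0 ?Ifin// ltW// H.
  rewrite integralB// integralZl// -/I (integral_cst _ mJ) [X in _ - _ * X]muJ.
  by rewrite muleC subee// -(fineK Ifin) -EFinM.
move/(ae_eq_integral_abs mu mJ).
have mg : measurable_fun (`[a, (a + h)%R]%classic : set (lineT R)) (fun t => h%:E * S t - I).
  by apply: emeasurable_funB; [exact: measurable_funeM|exact: measurable_cst].
move=> /(_ mg) Hae.
have : mu.-negligible `[a, (a + h)%R]%classic.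
  apply: negligibleS Hae => t /= ht Heq.
  move: (ht); rewrite in_itv/= => /H; rewrite -sube_gt0 ?Ifin//.
  by rewrite (Heq ht) ltxx.
move/(negligibleP _ mJ); rewrite [X in X = _]muJ => /eqP; rewrite eqe => /eqP hz.
by rewrite hz ltxx in h0.
Qed.

Lemma measurable_EFin_cont_on d lo h (q : 'rV[R]_d -> R) : cont_on (box lo h) q ->
  measurable_fun (ebox lo h) (fun z => (q (pt z))%:E).
Proof. by move=> cq; apply/measurable_EFinP; exact: measurable_cont_on. Qed.

Section fubini_box.
Context d lo h (q : 'rV[R]_d.+1 -> R).
Hypotheses (cq : cont_on (box lo h) q) (q0 : forall u, (0 <= q u)%R).

Let mJ : measurable (`[lo 0%N, (lo 0%N + h)%R]%classic : set (lineT R)).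
Proof. exact: measurable_itv. Qed.

Let mq : measurable_fun
  ((`[lo 0%N, (lo 0%N + h)%R]%classic : set (lineT R)) `*` @ebox R d (lotail lo) h)
  (fun z => (q (consR z.1 (pt z.2)))%:E).
Proof. by have := measurable_EFin_cont_on cq; rewrite eboxS. Qed.

Lemma box_fubini1 :
  \int[leb R d.+1]_(z in ebox lo h) (q (pt z))%:E =
  \int[mu]_(t in `[lo 0%N, (lo 0%N + h)%R])
    \int[leb R d]_(y in ebox (lotail lo) h) (q (consR t (pt y)))%:E.
Proof.
rewrite eboxS.
by rewrite (ge0_integral_setX1 _ _ mJ (@measurable_ebox R d (lotail lo) h) mq)// => z _; rewrite lee_fin.
Qed.

Lemma box_fubini2 :
  \int[leb R d.+1]_(z in ebox lo h) (q (pt z))%:E =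
  \int[leb R d]_(y in ebox (lotail lo) h)
    \int[mu]_(t in `[lo 0%N, (lo 0%N + h)%R]) (q (consR t (pt y)))%:E.
Proof.
rewrite eboxS.
by rewrite (ge0_integral_setX2 _ _ mJ (@measurable_ebox R d (lotail lo) h) mq)// => z _; rewrite lee_fin.
Qed.

Lemma measurable_slice1 :
  measurable_fun (`[lo 0%N, (lo 0%N + h)%R]%classic : set (lineT R))
   (fun t => \int[leb R d]_(y in ebox (lotail lo) h) (q (consR t (pt y)))%:E).
Proof.
apply: (measurable_integral_setX1 _ mJ (@measurable_ebox R d (lotail lo) h) mq) => z _.
by rewrite lee_fin.
Qed.

Lemma measurable_slice2 :
  measurable_fun (ebox (lotail lo) h)
   (fun y => \int[mu]_(t in `[lo 0%N, (lo 0%N + h)%R]) (q (consR t (pt y)))%:E).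
Proof.
apply: (measurable_integral_setX2 _ mJ (@measurable_ebox R d (lotail lo) h) mq) => z _.
by rewrite lee_fin.
Qed.
End fubini_box.

Lemma cont_on_sqr d (B : set 'rV[R]_d) (q : 'rV[R]_d -> R) :
  cont_on B q -> cont_on B (fun u => (q u ^+ 2)%R).
Proof. by move=> cq u /cq qu; exact: (cvgM qu qu). Qed.

Lemma cont_on_subC d (B : set 'rV[R]_d) (q : 'rV[R]_d -> R) c :
  cont_on B q -> cont_on B (fun u => (q u - c)%R).
Proof. by move=> cq u /cq qu; apply: (cvgB qu); exact: cvg_cst. Qed.

(** Induction on the dimension, with an unspecified constant [c] in place of the mean. Among the
    slices t = const, one has energy at most the average; induction provides [c] on it, and the
    one-dimensional inequality along lines compares any other point with that slice. The constants
    obey K -> 2 K + 2. *)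
Lemma poincare_box d : exists2 K : R, (0 <= K)%R &
  forall lo h (f : 'rV[R]_d -> R) (g : 'I_d -> 'rV[R]_d -> R), (0 < h)%R ->
  (forall a u, box lo h u -> is_derive u (delta_mx ord0 a) f (g a u)) ->
  cont_on (box lo h) f -> (forall a, cont_on (box lo h) (g a)) ->
  exists c : R, \int[leb R d]_(z in ebox lo h) ((f (pt z) - c) ^+ 2)%:E <=
    (K * h ^+ 2)%:E * \sum_(a < d) \int[leb R d]_(z in ebox lo h) (g a (pt z) ^+ 2)%:E.
Proof.
elim: d => [|d [K K0 IH]].
  exists 0%R => // lo h f g h0 _ _ _; exists (f 0%R).
  rewrite big_ord0 mule0 integral0_eq// => z _.
  by rewrite (_ : pt z = 0%R) ?subrr ?expr0n//; apply/rowP => -[].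
exists (2 * K + 2)%R; first by rewrite addr_ge0// mulr_ge0.
move=> lo h f g h0 df cf cg.
pose J := (`[lo 0%N, (lo 0%N + h)%R]%classic : set (lineT R)).
pose B := @ebox R d (lotail lo) h.
have mJ : measurable J by exact: measurable_itv.
have mB : measurable B by exact: measurable_ebox.
have muJ : mu J = h%:E.
  apply: (eq_trans (lebesgue_measure_itv _)).
  by rewrite /= lte_fin ltrDl h0 -EFinD addrAC subrr add0r.
have cg2 a : cont_on (box lo h) (fun u => (g a u ^+ 2)%R) by exact/cont_on_sqr.
pose I (a : 'I_d.+1) := \int[leb R d.+1]_(z in ebox lo h) (g a (pt z) ^+ 2)%:E.
have I0 a : 0 <= I a by apply: integral_ge0 => z _; rewrite lee_fin sqr_ge0.
pose S (t : lineT R) := \sum_(b < d) \int[leb R d]_(y in B) (g (lift ord0 b) (consR t (pt y)) ^+ 2)%:E.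
have [t0 ht0 HS] : exists2 t, (lo 0%N <= t <= lo 0%N + h)%R & h%:E * S t <= \sum_(b < d) I (lift ord0 b).
  have [||t ht Ht] := @good_slice S (lo 0%N) h h0.
  - by apply: emeasurable_fun_sum => b; exact: (measurable_slice1 (cg2 _) (fun=> sqr_ge0 _)).
  - by move=> t _; apply: sume_ge0 => b _; apply: integral_ge0 => y _; rewrite lee_fin sqr_ge0.
  exists t => //; apply: le_trans Ht _; rewrite ge0_integral_sum//.
  - by apply: lee_sum => b _; rewrite /I (box_fubini1 (cg2 _) (fun=> sqr_ge0 _)).
  - by move=> b; exact: (measurable_slice1 (cg2 _) (fun=> sqr_ge0 _)).
  - by move=> b t' _; apply: integral_ge0 => y _; rewrite lee_fin sqr_ge0.
have [||| c Hc] := IH (lotail lo) h (f \o consR t0) (fun b => g (lift ord0 b) \o consR t0) h0.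
- by move=> a v bv; apply: is_derive_slice; apply: df; apply/box_consR.
- exact: cont_on_slice.
- by move=> a; exact: cont_on_slice.
exists c.
have cfc : cont_on (box lo h) (fun u => ((f u - c) ^+ 2)%R) by exact/cont_on_sqr/cont_on_subC.
have cft : cont_on (box (lotail lo) h) (fun v => ((f (consR t0 v) - c) ^+ 2)%R).
  by have := cont_on_slice ht0 cfc.
pose A (y : eu R d) := \int[mu]_(s in J) (g ord0 (consR s (pt y)) ^+ 2)%:E.
pose Bf (y : eu R d) := ((f (consR t0 (pt y)) - c) ^+ 2)%:E.
have A0 y : 0 <= A y by apply: integral_ge0 => s _; rewrite lee_fin sqr_ge0.
have Bf0 y : 0 <= Bf y by rewrite lee_fin sqr_ge0.
have mA : measurable_fun B A by exact: (measurable_slice2 (cg2 _) (fun=> sqr_ge0 _)).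
have mBf : measurable_fun B Bf by exact: (measurable_EFin_cont_on cft).
rewrite (box_fubini2 cfc (fun=> sqr_ge0 _)).
have step y : B y -> \int[mu]_(t in J) ((f (consR t (pt y)) - c) ^+ 2)%:E <=
    (2 * h ^+ 2)%:E * A y + (2 * h)%:E * Bf y.
  move=> By.
  have dF t : (lo 0%N <= t <= lo 0%N + h)%R ->
      is_derive (t : R) (1%R : R) (fun s => f (consR s (pt y))) (g ord0 (consR t (pt y))).
    by move=> ht; apply: is_derive_line; apply: df; apply/box_consR.
  have cF := cont_on_line By (cg ord0).
  (* With p the value at [t] and q the value on the chosen slice, (p - c)^2 <= 2 (p - q)^2 + 2 (q -
     c)^2. *)
  have pw t : J t -> ((f (consR t (pt y)) - c) ^+ 2)%:E <= (2 * h)%:E * A y + 2%:E * Bf y.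
    rewrite /J /= in_itv/= => ht.
    apply: (@le_trans _ _ (2%:E * ((f (consR t (pt y)) - f (consR t0 (pt y))) ^+ 2)%:E + 2%:E * Bf y)).
      rewrite /Bf -!EFinM -EFinD lee_fin -subr_ge0.
      set p := f (consR t _); set q := f (consR t0 _).
      rewrite (_ : _ - _ = ((p - q) - (q - c)) ^+ 2)%R ?sqr_ge0//; ring.
    apply: leeD2r; rewrite [(2 * h)%:E]EFinM -muleA; apply: lee_wpmul2l; first by rewrite lee_fin.
    have := poincare_segment ht0 ht dF cF.
    by rewrite (_ : (lo 0%N + h - lo 0%N = h)%R)//; ring.
  have Cge : 0 <= (2 * h)%:E * A y + 2%:E * Bf y.
    by apply: adde_ge0; apply: mule_ge0 => //; rewrite lee_fin ?mulr_ge0// ltW.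
  apply: (@le_trans _ _ (\int[mu]_(t in J) ((2 * h)%:E * A y + 2%:E * Bf y))).
    apply: ge0_le_integral; [exact: mJ| | |exact: measurable_cst|exact: pw].
    - by move=> t _; rewrite lee_fin sqr_ge0.
    - apply/measurable_EFinP; apply: subspace_continuous_measurable_fun => //.
      apply: continuous_in_subspaceT => t /set_mem; rewrite /J /= in_itv /=.
      exact: (cont_on_line By cfc).
  rewrite (integral_cst _ mJ) [X in _ * X]muJ muleC ge0_muleDr; first last.
  - by rewrite mule_ge0.
  - by rewrite mule_ge0// lee_fin mulr_ge0// ltW.
  rewrite (muleA h%:E (2 * h)%:E) (muleA h%:E 2%:E) -!EFinM.
  rewrite (_ : (h * (2 * h) = 2 * h ^+ 2)%R); last by ring.
  by rewrite (mulrC h 2%R).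
apply: (@le_trans _ _ (\int[leb R d]_(y in B) ((2 * h ^+ 2)%:E * A y + (2 * h)%:E * Bf y))).
  apply: ge0_le_integral; [exact: mB| | | |exact: step].
  - by move=> y _; apply: integral_ge0 => t _; rewrite lee_fin sqr_ge0.
  - exact: (measurable_slice2 cfc (fun=> sqr_ge0 _)).
  - by apply: emeasurable_funD; exact: measurable_funeM.
have h2 : (0 <= 2 * h ^+ 2)%R by rewrite mulr_ge0// sqr_ge0.
have h1 : (0 <= 2 * h)%R by rewrite mulr_ge0// ltW.
rewrite ge0_integralD//; first last.
- exact: measurable_funeM.
- by move=> y _; rewrite mule_ge0.
- exact: measurable_funeM.
- by move=> y _; rewrite mule_ge0.
rewrite !ge0_integralZl_EFin//.
have -> : \int[leb R d]_(y in B) A y = I ord0.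
  by rewrite /I (box_fubini2 (cg2 _) (fun=> sqr_ge0 _)).
have KS : \int[leb R d]_(y in B) Bf y <= (K * h ^+ 2)%:E * S t0 by [].
have T0 : 0 <= \sum_(b < d) I (lift ord0 b) by apply: sume_ge0.
have S0 : 0 <= S t0.
  by apply: sume_ge0 => b _; apply: integral_ge0 => y _; rewrite lee_fin sqr_ge0.
rewrite big_ord_recl -/(I ord0) (ge0_muleDr _ (I0 ord0) T0).
apply: leeD.
  apply: lee_wpmul2r => //; rewrite lee_fin ler_wpM2r ?sqr_ge0//.
  by rewrite lerDr mulr_ge0.
apply: (@le_trans _ _ ((2 * K * h ^+ 2)%:E * (h%:E * S t0))).
  rewrite muleA -EFinM (_ : (2 * K * h ^+ 2 * h = 2 * h * (K * h ^+ 2))%R); last by ring.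
  by rewrite [(2 * h * (K * _))%:E]EFinM -muleA; apply: lee_wpmul2l; rewrite ?lee_fin.
apply: (@le_trans _ _ ((2 * K * h ^+ 2)%:E * \sum_(b < d) I (lift ord0 b))).
  by apply: lee_wpmul2l => //; rewrite lee_fin mulr_ge0 ?sqr_ge0// mulr_ge0.
apply: lee_wpmul2r => //; rewrite lee_fin ler_wpM2r ?sqr_ge0//.
by rewrite lerDl.
Qed.

End poincare.

(** * Subdivision of a cube into cells *)

Section grid.
Context (R : realType).
Implicit Types (lo : nat -> R) (h s : R).
Local Notation mu := (@lebesgue_measure R).

Lemma cont_on_sub d (B B' : set 'rV[R]_d) (q : 'rV[R]_d -> R) :
  B' `<=` B -> cont_on B q -> cont_on B' q.
Proof. by move=> BB cq u /BB; exact: cq. Qed.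

(** When the mean of f vanishes, the integral of (f - c)^2 is that of f^2 plus c^2 times the volume,
    so the unknown [c] can only improve when replaced by 0. *)
Lemma poincare_mean0 d : exists2 K : R, 0 <= K &
  forall lo h (f : 'rV[R]_d -> R) (g : 'I_d -> 'rV[R]_d -> R), 0 < h ->
  (forall a u, box lo h u -> is_derive u (delta_mx ord0 a) f (g a u)) ->
  cont_on (box lo h) f -> (forall a, cont_on (box lo h) (g a)) ->
  \int[leb R d]_(z in ebox lo h) f (pt z) = 0 ->
  (\int[leb R d]_(z in ebox lo h) (f (pt z) ^+ 2)%:E <=
    (K * h ^+ 2)%:E * \sum_(a < d) \int[leb R d]_(z in ebox lo h) (g a (pt z) ^+ 2)%:E)%E.
Proof.
have [K K0 HK] := poincare_box R d; exists K => // lo h f g h0 df cf cg f0.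
have [c Hc] := HK lo h f g h0 df cf cg; apply: le_trans Hc.
have mB : measurable (@ebox R d lo h) by exact: measurable_ebox.
have h0' := ltW h0.
have i1 := integrable_cont_on h0' (cont_on_sqr cf).
have i2 := integrable_cont_on h0' cf.
have i3 : (leb R d).-integrable (ebox lo h) (EFin \o (fun z => - 2 * c * f (pt z))).
  by have := integrableZl mB (- 2 * c) i2; apply: eq_integrable.
have i4 : (leb R d).-integrable (ebox lo h) (EFin \o (fun=> c ^+ 2)).
  have cc : cont_on (@box R d lo h) (fun=> c ^+ 2) by move=> u _; exact: cst_continuous.
  exact: (integrable_cont_on h0' cc).
have i34 : (leb R d).-integrable (ebox lo h) (EFin \o (fun z => - 2 * c * f (pt z) + c ^+ 2)).
  by have := integrableD mB i3 i4; apply: eq_integrable.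
rewrite [leRHS](_ : _ = \int[leb R d]_(z in ebox lo h)
   ((f (pt z) ^+ 2)%:E + (- 2 * c * f (pt z) + c ^+ 2)%:E))%E; last first.
  by apply: eq_integral => z _; rewrite -EFinD; congr EFin; ring.
rewrite integralD//; apply: leeDl.
rewrite -(fineK (integrable_fin_num mB i34)) lee_fin.
rewrite [leRHS](_ : _ = \int[leb R d]_(z in ebox lo h) (- 2 * c * f (pt z) + c ^+ 2))//.
rewrite RintegralD// RintegralZl// f0 mulr0 add0r.
by apply: Rintegral_ge0 => z _; rewrite sqr_ge0.
Qed.

(** Consecutive closed segments share an endpoint; this is harmless because points are null, so
    half-open pieces may be closed up. *)
Lemma ge0_integral_subdivision (F : lineT R -> \bar R) (a s : R) (n : nat) : 0 <= s ->
  measurable_fun (`[a, a + n%:R * s]%classic : set (lineT R)) F ->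
  (forall t, (a <= t <= a + n%:R * s)%R -> 0 <= F t)%E ->
  (\int[mu]_(t in `[a, (a + n%:R * s)%R]) F t =
   \sum_(i <- iota 0 n) \int[mu]_(t in `[(a + i%:R * s)%R, (a + i%:R * s + s)%R]) F t)%E.
Proof.
move=> s0; elim: n => [|n IH] mF F0.
  by rewrite big_nil mul0r addr0 set_itv1 integral_set1.
have E : a + n.+1%:R * s = a + n%:R * s + s by rewrite -natr1; ring.
have ns : 0 <= n%:R * s by rewrite mulr_ge0.
have an : a <= a + n%:R * s by rewrite lerDl.
have nn : a + n%:R * s <= a + n%:R * s + s by rewrite lerDl.
rewrite E in mF F0 *.
rewrite -addn1 iotaD big_cat big_seq1 -IH; first last.
- by move=> t /andP[t1 t2]; apply: F0; rewrite t1 (le_trans t2).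
- refine (measurable_funS _ _ mF); first exact: measurable_itv.
  by move=> t /=; rewrite !in_itv/= => /andP[-> t2]; rewrite (le_trans t2 nn).
rewrite add0n.
have mC c d : measurable (`[c, d]%classic : set (lineT R)) by exact: measurable_itv.
have mO c d : measurable (`]c, d]%classic : set (lineT R)) by exact: measurable_itv.
have U : `[a, a + n%:R * s + s]%classic =
    `[a, a + n%:R * s]%classic `|` `]a + n%:R * s, a + n%:R * s + s]%classic.
  by rewrite -itv_bndbnd_setU.
rewrite U in mF *; rewrite (ge0_integral_setU _ (mC _ _) (mO _ _) mF); first last.
- apply/disj_setPS => t [/=]; rewrite !in_itv/= => /andP[_ t1] /andP[t2 _].
  by have := lt_le_trans t2 t1; rewrite ltxx.
- by move=> t; rewrite -U /= in_itv/=; exact: F0.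
congr (_ + _)%E; apply: integral_itv_obnd_cbnd.
by refine (measurable_funS _ _ mF); [exact: measurableU|exact: subsetUr].
Qed.

Fixpoint grid d n lo s : seq (nat -> R) :=
  if d is d'.+1 then
    [seq (fun k => if k is k'.+1 then l k' else lo 0%N + i%:R * s)
      | i <- iota 0 n, l <- grid d' n (lotail lo) s]
  else [:: lo].

Lemma size_grid d n lo s : size (grid d n lo s) = (n ^ d)%N.
Proof.
elim: d lo => [|d IH] lo //=.
by rewrite size_allpairs IH size_iota expnS.
Qed.

Lemma grid_coord d n lo s l : 0 <= s -> l \in grid d n lo s ->
  forall a, (a < d)%N -> lo a <= l a /\ l a + s <= lo a + n%:R * s.
Proof.
move=> s0; elim: d lo l => [|d IH] lo l //=.
move=> /allpairsP[[i l'] /= [+ l'g ->]] [|a] ad; last first.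
  by move=> _; exact: (IH _ _ l'g a ad).
rewrite mem_iota add0n => /andP[_ i_n]; split; first by rewrite lerDl mulr_ge0.
rewrite -addrA lerD2l -[X in _ + X]mul1r -mulrDl ler_wpM2r//.
by rewrite natr1 ler_nat.
Qed.

Lemma box_grid_sub d n lo s l : 0 <= s -> l \in grid d n lo s ->
  @box R d l s `<=` @box R d lo (n%:R * s).
Proof.
move=> s0 lg u bu a; have [l1 l2] := grid_coord s0 lg (ltn_ord a).
have /andP[u1 u2] := bu a.
by rewrite (le_trans l1 u1) (le_trans u2 l2).
Qed.

Lemma box_grid_integral d n lo s (q : 'rV[R]_d -> R) : 0 <= s ->
  cont_on (box lo (n%:R * s)) q -> (forall u, 0 <= q u) ->
  (\int[leb R d]_(z in ebox lo (n%:R * s)) (q (pt z))%:E =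
   \sum_(l <- grid d n lo s) \int[leb R d]_(z in ebox l s) (q (pt z))%:E)%E.
Proof.
move=> s0; elim: d lo q => [|d IH] lo q cq q0.
  rewrite big_seq1; congr (integral _ _ _).
  by apply/seteqP; split=> z _ [].
rewrite box_fubini1// ge0_integral_subdivision//; first last.
- by move=> t _; apply: integral_ge0 => y _; rewrite lee_fin.
- exact: measurable_slice1.
rewrite /= big_allpairs_dep; apply: eq_big_seq => i.
rewrite mem_iota add0n => /andP[_ i_n].
have iJ t : lo 0%N + i%:R * s <= t <= lo 0%N + i%:R * s + s ->
    lo 0%N <= t <= lo 0%N + n%:R * s.
  move=> /andP[t1 t2]; rewrite (le_trans _ t1) ?lerDl ?mulr_ge0//=.
  apply: (le_trans t2); rewrite -addrA lerD2l -[X in _ + X]mul1r -mulrDl ler_wpM2r//.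
  by rewrite natr1 ler_nat.
set J := `[_, _]%classic.
have -> : (\int[mu]_(t in J) \int[leb R d]_(y in ebox (lotail lo) (n%:R * s)) (q (consR t (pt y)))%:E =
    \int[mu]_(t in J) \sum_(l <- grid d n (lotail lo) s) \int[leb R d]_(y in ebox l s) (q (consR t (pt y)))%:E)%E.
  apply: eq_integral => t; rewrite inE /J /= in_itv/= => /iJ tJ.
  by rewrite (IH _ (q \o consR t) (cont_on_slice tJ cq) (fun=> q0 _)).
have cql l : l \in grid d n (lotail lo) s ->
    cont_on (box (fun k => if k is k'.+1 then l k' else lo 0%N + i%:R * s) s) q.
  move=> lg; apply: cont_on_sub cq; apply: box_grid_sub => //.
  by apply/allpairsP; exists (i, l); rewrite mem_iota.
rewrite big_tnth; under eq_integral do rewrite big_tnth.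
rewrite ge0_integral_sum//; first last.
- by move=> k t _; apply: integral_ge0 => y _; rewrite lee_fin.
- by move=> k; have /cql := mem_tnth k (in_tuple (grid d n (lotail lo) s)) => /measurable_slice1; exact.
  exact: measurable_itv.
apply: eq_bigr => k _; rewrite (box_fubini1 _ q0)//.
exact: (cql _ (mem_tnth k (in_tuple _))).
Qed.

(** The gain is the square of the mesh [s], not of the side of the whole cube. It is bought with one
    linear condition per cell, and this trade is what limits the number of eigenfunctions. *)
Lemma poincare_grid d : exists2 K : R, 0 <= K &
  forall lo s n (f : 'rV[R]_d -> R) (g : 'I_d -> 'rV[R]_d -> R), 0 < s ->
  (forall a u, box lo (n%:R * s) u -> is_derive u (delta_mx ord0 a) f (g a u)) ->
  cont_on (box lo (n%:R * s)) f -> (forall a, cont_on (box lo (n%:R * s)) (g a)) ->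
  (forall l, l \in grid d n lo s -> \int[leb R d]_(z in ebox l s) f (pt z) = 0) ->
  (\int[leb R d]_(z in ebox lo (n%:R * s)) (f (pt z) ^+ 2)%:E <=
    (K * s ^+ 2)%:E *
     \sum_(a < d) \int[leb R d]_(z in ebox lo (n%:R * s)) (g a (pt z) ^+ 2)%:E)%E.
Proof.
have [K K0 HK] := poincare_mean0 d; exists K => // lo s n f g s0 df cf cg f0.
have s0' := ltW s0.
rewrite (@box_grid_integral _ _ _ _ (fun u => f u ^+ 2))//; first last.
- by move=> u; rewrite sqr_ge0.
- exact: cont_on_sqr.
rewrite (eq_bigr _ (fun a _ => box_grid_integral s0' (cont_on_sqr (cg a)) (fun=> sqr_ge0 _))).
rewrite exchange_big/= ge0_sume_distrr; last first.
  by move=> l _; apply: sume_ge0 => a _; apply: integral_ge0 => z _; rewrite lee_fin sqr_ge0.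
rewrite big_seq [leRHS]big_seq; apply: lee_sum => l lg.
have sub := @box_grid_sub d n lo s l s0' lg.
apply: HK => //.
- by move=> a u /sub; exact: df.
- exact: cont_on_sub cf.
- by move=> a; exact: cont_on_sub (cg a).
- exact: f0.
Qed.

End grid.

(** * Positive definite matrices *)

Section posdef.
Context (R : realType).

Definition posdef n (P : 'M[R]_n) :=
  forall v : 'rV[R]_n, v != 0 -> 0 < (v *m P *m v^T) ord0 ord0.

Lemma quad_formE n (v : 'rV[R]_n) (P : 'M[R]_n) :
  (v *m P *m v^T) ord0 ord0 = \sum_a \sum_b v ord0 a * P a b * v ord0 b.
Proof.
rewrite mxE exchange_big/=; apply: eq_bigr => b _.
by rewrite mxE mulr_suml; apply: eq_bigr => a _; rewrite mxE.
Qed.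

(** Block elimination with the pivot p: the Schur complement S - r^T r / p is again symmetric and
    positive definite, so it has a factor by the inductive assumption. *)
Lemma cholesky_step n (P : 'M[R]_(1 + n)) : P^T = P -> posdef P ->
  (forall S : 'M[R]_n, S^T = S -> posdef S -> exists B : 'M[R]_n, S = B *m B^T) ->
  exists B : 'M[R]_(1 + n), P = B *m B^T.
Proof.
move=> Psym Ppos IH.
pose p := P ord0 ord0; pose r : 'rV[R]_n := ursubmx P; pose S := drsubmx P.
have ul : ulsubmx P = p%:M.
  apply/matrixP => i j; rewrite !ord1 !mxE eqxx mulr1n /p.
  by congr (P _ _); apply/val_inj.
have dl : dlsubmx P = r^T by rewrite /r trmx_ursub Psym.
have Ssym : S^T = S by rewrite /S trmx_drsub Psym.
have PE : P = block_mx p%:M r r^T S by rewrite -[LHS]submxK ul dl.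
have qE (x : R) (y : 'rV[R]_n) :
    (row_mx x%:M y *m P *m (row_mx x%:M y)^T) ord0 ord0 =
    p * x ^+ 2 + 2 * x * (y *m r^T) ord0 ord0 + (y *m S *m y^T) ord0 ord0.
  rewrite PE mul_row_block tr_row_mx mul_row_col !mulmxDl tr_scalar_mx.
  rewrite -!scalar_mxM !mul_scalar_mx !mul_mx_scalar -scalemxAl.
  have -> : r *m y^T = (y *m r^T)^T by rewrite trmx_mul trmxK.
  set a := y *m r^T; rewrite !mxE eqxx mulr1n.
  ring.
have p0 : 0 < p.
  have := Ppos (row_mx 1%:M 0); rewrite qE !mul0mx !mxE expr1n !mulr1 !mulr0 !addr0; apply.
  apply/eqP => /matrixP/(_ ord0 (lshift n ord0)); rewrite row_mxEl !mxE eqxx.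
  by move/eqP; rewrite oner_eq0.
pose c := (Num.sqrt p)^-1.
have cp : c * c * p = 1.
  by rewrite -expr2 exprVn sqr_sqrtr ?mulVf ?gt_eqF// ltW.
have [||B BE] := IH (S - (c ^+ 2) *: (r^T *m r)).
- by rewrite linearB/= linearZ/= trmx_mul trmxK Ssym.
- move=> y y0.
  (* Since c^2 = 1/p, this first coordinate is the one minimising the form for given [y]; the
     minimum is the Schur complement at [y]. *)
  have := Ppos (row_mx (- c ^+ 2 * (y *m r^T) ord0 ord0)%:M y); rewrite qE.
  have -> : (y *m (S - c ^+ 2 *: (r^T *m r)) *m y^T) ord0 ord0 =
     (y *m S *m y^T) ord0 ord0 - c ^+ 2 * ((y *m r^T) ord0 ord0) ^+ 2.
    have E (A a : 'M[R]_1) k : (A - k *: (a *m a^T)) ord0 ord0 = A ord0 ord0 - k * a ord0 ord0 ^+ 2.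
      by rewrite !mxE big_ord1 mxE expr2.
    rewrite -E mulmxBr mulmxBl -scalemxAr -scalemxAl.
    by rewrite trmx_mul trmxK !mulmxA.
  set q := (y *m r^T) ord0 ord0; set Q := (y *m S *m y^T) ord0 ord0.
  have -> : p * (- c ^+ 2 * q) ^+ 2 + 2 * (- c ^+ 2 * q) * q + Q =
     (c * c * p) * c ^+ 2 * q ^+ 2 - 2 * c ^+ 2 * q ^+ 2 + Q by ring.
  rewrite cp mul1r => H; suff : 0 < Q - c ^+ 2 * q ^+ 2 by [].
  rewrite (_ : _ - _ = c ^+ 2 * q ^+ 2 - 2 * c ^+ 2 * q ^+ 2 + Q); last by ring.
  apply: H; apply: contraNN y0 => /eqP/matrixP H; apply/eqP/matrixP => i j.
  by have := H i (rshift 1 j); rewrite row_mxEr !mxE.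
exists (block_mx (Num.sqrt p)%:M 0 (c *: r^T) B).
have sp : Num.sqrt p * Num.sqrt p = p by rewrite -expr2 sqr_sqrtr// ltW.
have sc : Num.sqrt p * c = 1 by rewrite mulfV// gt_eqF// sqrtr_gt0.
rewrite tr_block_mx mulmx_block trmx0 !mulmx0 !mul0mx !addr0 {1}PE.
rewrite tr_scalar_mx -scalar_mxM sp linearZ/= trmxK.
rewrite mul_scalar_mx scalerA sc scale1r mul_mx_scalar scalerA sc scale1r.
by rewrite -scalemxAl -scalemxAr scalerA -expr2 -BE addrC subrK.
Qed.

(** The factorization stands in for diagonalization: it gives the sign of the determinant, the lower
    bound for the inverse, and a sum of second directional derivatives in the maximum principle. *)
Lemma cholesky n (P : 'M[R]_n) : P^T = P -> posdef P -> exists B : 'M[R]_n, P = B *m B^T.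
Proof.
elim: n P => [|n IH] P Psym Ppos; first by exists 0; apply/matrixP => -[].
exact: (@cholesky_step n P).
Qed.

Lemma posdef_det_gt0 n (P : 'M[R]_n) : P^T = P -> posdef P -> 0 < \det P.
Proof.
move=> Psym Ppos; rewrite lt_neqAle eq_sym; apply/andP; split; last first.
  by have [B ->] := cholesky Psym Ppos; rewrite det_mulmx det_tr -expr2 sqr_ge0.
apply/det0P => -[v v0 vP]; have := Ppos v v0.
by rewrite vP mul0mx mxE ltxx.
Qed.

Lemma posdef_unit n (P : 'M[R]_n) : P^T = P -> posdef P -> P \in unitmx.
Proof. by move=> Psym /(posdef_det_gt0 Psym) H; rewrite unitmxE unitfE gt_eqF. Qed.

Lemma posdef_inv n (P : 'M[R]_n) : P^T = P -> posdef P -> posdef (invmx P).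
Proof.
move=> Psym Ppos v v0; have uP := posdef_unit Psym Ppos.
have -> : v *m invmx P *m v^T = (v *m invmx P) *m P *m (v *m invmx P)^T.
  by rewrite trmx_mul trmx_inv Psym !mulmxA (mulmxKV uP).
apply: Ppos; apply: contraNN v0 => /eqP H.
by rewrite -[v](mulmxKV uP) H mul0mx.
Qed.

(* [|xi|^2 = <xi g^-1 B, xi B>] where [g = B B^T], and [|xi B|^2 <= L |xi|^2]. *)
Lemma posdef_inv_ge n (P : 'M[R]_n) (L : R) (v : 'rV[R]_n) : P^T = P -> posdef P -> 0 < L ->
  (v *m P *m v^T) ord0 ord0 <= L * \sum_a v ord0 a ^+ 2 ->
  L^-1 * \sum_a v ord0 a ^+ 2 <= (v *m invmx P *m v^T) ord0 ord0.
Proof.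
move=> Psym Ppos L0 Hle; have uP := posdef_unit Psym Ppos.
have [B PB] := cholesky Psym Ppos.
have sqE (w : 'rV[R]_n) : (w *m w^T) ord0 ord0 = \sum_a w ord0 a ^+ 2.
  by rewrite mxE; apply: eq_bigr => a _; rewrite mxE expr2.
have ge0 (w : 'rV[R]_n) : 0 <= (w *m w^T) ord0 ord0.
  by rewrite sqE; apply: sumr_ge0 => a _; exact: sqr_ge0.
pose x := v *m invmx P *m B; pose y := v *m B.
have xx : x *m x^T = v *m invmx P *m v^T.
  by rewrite /x !trmx_mul trmx_inv Psym !mulmxA -(mulmxA _ B) -PB (mulmxKV uP).
have yy : y *m y^T = v *m P *m v^T by rewrite /y trmx_mul !mulmxA -(mulmxA v B) -PB.
have xy : x *m y^T = v *m v^T.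
  by rewrite /x /y trmx_mul !mulmxA -(mulmxA _ B) -PB (mulmxKV uP).
have := ge0 (x - L^-1 *: y).
have -> : ((x - L^-1 *: y) *m (x - L^-1 *: y)^T) ord0 ord0 =
   (x *m x^T) ord0 ord0 - 2 * L^-1 * (x *m y^T) ord0 ord0 + L^-1 ^+ 2 * (y *m y^T) ord0 ord0.
  rewrite !mxE !mulr_sumr -sumrB -big_split/=; apply: eq_bigr => a _.
  have E (u w : 'rV[R]_n) (k : R) : (u - k *: w) ord0 a = u ord0 a - k * w ord0 a.
    by rewrite !mxE.
  have T (u : 'rV[R]_n) : u^T a ord0 = u ord0 a by rewrite mxE.
  by rewrite !T E; ring.
rewrite xy.
rewrite xx yy sqE => H; move: Hle.
set q := (v *m P *m v^T) ord0 ord0 in H *; set S := \sum_a _ in H *.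
set T := (v *m _ *m v^T) ord0 ord0 in H * => Hle.
have : L^-1 ^+ 2 * q <= L^-1 ^+ 2 * (L * S) by rewrite ler_wpM2l// sqr_ge0.
rewrite mulrA expr2 -(mulrA _ _ L) mulVf ?gt_eqF// mulr1 => H2.
lra.
Qed.

(** Each product of coordinates is at most half the sum of their squares; summing over the other
    index produces the factor [n]. *)
Lemma quad_form_le n (P : 'M[R]_n) (M : R) (v : 'rV[R]_n) : (forall a b, `|P a b| <= M) ->
  (v *m P *m v^T) ord0 ord0 <= M * n%:R * \sum_a v ord0 a ^+ 2.
Proof.
move=> PM; rewrite quad_formE.
apply: (@le_trans _ _ (\sum_a \sum_b M * ((v ord0 a ^+ 2 + v ord0 b ^+ 2) / 2))).
  apply: ler_sum => a _; apply: ler_sum => b _.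
  apply: le_trans (ler_norm _) _; rewrite !normrM.
  have M0 : 0 <= M by apply: le_trans (PM a b).
  have -> : `|v ord0 a| * `|P a b| * `|v ord0 b| = `|P a b| * (`|v ord0 a| * `|v ord0 b|) by ring.
  apply: ler_pM => //.
  rewrite ler_pdivlMr// -(real_normK (num_real (v ord0 a))) -(real_normK (num_real (v ord0 b))).
  rewrite -subr_ge0; set p := `|_|; set q := `|_|.
  by rewrite (_ : _ - _ = (p - q) ^+ 2) ?sqr_ge0//; ring.
under eq_bigr => a _ do rewrite -mulr_sumr -mulr_suml big_split/= sumr_const card_ord.
rewrite -mulr_sumr -mulr_suml big_split/= sumr_const card_ord.
rewrite sumrMnl; set T := \sum_i _; rewrite -(mulr_natr T n) le_eqVlt.
by apply/orP; left; apply/eqP; field.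
Qed.
End posdef.

(** * Differentiation and the Caccioppoli inequality *)

Section C1.
Context (R : realType) (d : nat).
Implicit Types (U : set 'rV[R]_d) (f g : 'rV[R]_d -> R).

(** The partial derivatives are carried as data because later arguments compute with them; [hasC1]
    hides them where mere existence is enough. Continuity of [f] is recorded as well, since
    existence of partial derivatives at a point does not give it. *)
Definition C1on U f (Df : 'I_d -> 'rV[R]_d -> R) : Prop := forall u, U u ->
  {for u, continuous f} /\ forall a,
    is_derive u (delta_mx ord0 a) f (Df a u) /\ {for u, continuous (Df a)}.
Definition hasC1 U f : Prop := exists Df, C1on U f Df.

Lemma C1on_ext U f g Df Dg : C1on U f Df -> (forall u, g u = f u) ->
  (forall a u, Dg a u = Df a u) -> C1on U g Dg.
Proof.
move=> Cf /funext -> DE; rewrite (_ : Dg = Df)//.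
by apply/funext => a; apply/funext => u.
Qed.

Lemma C1on_cst U c : C1on U (fun=> c) (fun _ _ => 0).
Proof.
move=> u _; split=> [|a]; first exact: cst_continuous.
by split; [exact: is_derive_cst|exact: cst_continuous].
Qed.

Lemma C1onD U f g Df Dg : C1on U f Df -> C1on U g Dg ->
  C1on U (fun u => f u + g u) (fun a u => Df a u + Dg a u).
Proof.
move=> Cf Cg u Uu; have [cf df] := Cf u Uu; have [cg dg] := Cg u Uu.
split=> [|a]; first exact: (cvgD cf cg).
have [dfa cfa] := df a; have [dga cga] := dg a.
by split; [exact: is_deriveD|exact: (cvgD cfa cga)].
Qed.

Lemma C1onM U f g Df Dg : C1on U f Df -> C1on U g Dg ->
  C1on U (fun u => f u * g u) (fun a u => f u * Dg a u + g u * Df a u).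
Proof.
move=> Cf Cg u Uu; have [cf df] := Cf u Uu; have [cg dg] := Cg u Uu.
split=> [|a]; first exact: (cvgM cf cg).
have [dfa cfa] := df a; have [dga cga] := dg a.
split; first exact: is_deriveM.
exact: (cvgD (cvgM cf cga) (cvgM cg cfa)).
Qed.

Lemma C1on_sum (I : Type) (s : seq I) U (f : I -> 'rV[R]_d -> R) Df :
  (forall i, C1on U (f i) (Df i)) ->
  C1on U (fun u => \sum_(i <- s) f i u) (fun a u => \sum_(i <- s) Df i a u).
Proof.
move=> Cf; elim: s => [|i s IH].
  by refine (C1on_ext (@C1on_cst U 0) _ _) => *; rewrite big_nil.
by refine (C1on_ext (C1onD (Cf i) IH) _ _) => *; rewrite big_cons.
Qed.

Lemma is_derive_of_line f u v (df : R) :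
  is_derive (0 : R) (1 : R) (fun t : R => f (t *: v + u)) df -> is_derive u v f df.
Proof.
move=> H; have E : (fun h : R => h^-1 *: ((f \o shift u) (h *: v) - f u)) =
  (fun h : R => h^-1 *: (((fun t : R => f (t *: v + u)) \o shift (0 : R)) (h *: (1 : R)) - (f (0 *: v + u)))).
  apply/funext => h /=; rewrite scale0r add0r; congr (_ *: (f (_ *: _ + _) - _)).
  by rewrite addr0 /GRing.scale/= mulr1.
split; first by rewrite /derivable E; exact: ex_derive.
by rewrite /derive E; exact: derive_val.
Qed.

Lemma is_derive_sqrt_comp f u v df : 0 < f u -> is_derive u v f df ->
  is_derive u v (fun w => Num.sqrt (f w)) ((2 * Num.sqrt (f u))^-1 * df).
Proof.
move=> fu0 dfu; apply: is_derive_of_line.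
have d0 : is_derive (0 : R) (1 : R) (fun t : R => f (t *: v + u)) df.
  apply: (@is_derive_comp_affine _ _ _ f (fun t : R => t *: v + u) u v) dfu => s.
  by rewrite /GRing.scale/= mulr1 addr0.
have ds : is_derive (f ((0 : R) *: v + u)) (1 : R) Num.sqrt (2 * Num.sqrt (f u))^-1.
  rewrite scale0r add0r; exact: is_derive1_sqrt.
have := @is_derive1_comp _ Num.sqrt (fun t : R => f (t *: v + u)) 0 _ _ ds d0.
by [].
Qed.

Lemma hasC1M U f g : hasC1 U f -> hasC1 U g -> hasC1 U (fun u => f u * g u).
Proof. by move=> [? Cf] [? Cg]; eexists; exact: C1onM Cf Cg. Qed.

Lemma hasC1_sum (I : Type) (s : seq I) U (f : I -> 'rV[R]_d -> R) :
  (forall i, hasC1 U (f i)) -> hasC1 U (fun u => \sum_(i <- s) f i u).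
Proof. by move=> /choice[Df Cf]; eexists; exact: C1on_sum Cf. Qed.

Lemma hasC1_cst U c : hasC1 U (fun=> c).
Proof. by eexists; exact: C1on_cst. Qed.

Lemma hasC1_prod (I : Type) (s : seq I) U (f : I -> 'rV[R]_d -> R) :
  (forall i, hasC1 U (f i)) -> hasC1 U (fun u => \prod_(i <- s) f i u).
Proof.
move=> Cf; elim: s => [|i s IH].
  by under eq_fun do rewrite big_nil; exact: hasC1_cst.
by under eq_fun do rewrite big_cons; exact: hasC1M.
Qed.

Lemma hasC1V U f : (forall u, U u -> f u != 0) -> hasC1 U f -> hasC1 U (fun u => (f u)^-1).
Proof.
move=> f0 [Df Cf]; exists (fun a u => - (f u) ^- 2 * Df a u) => u Uu.
have [cf df] := Cf u Uu.
have cV : {for u, continuous (fun w => (f w)^-1)} by exact: cvgV (f0 u Uu) cf.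
split=> [|a]; first exact: cV.
have [dfa cfa] := df a; split.
  split; first exact: derivableV (f0 u Uu) _.
  by rewrite deriveV ?f0// derive_val.
rewrite (_ : (fun u => _) = fun u => - ((f u)^-1 * (f u)^-1) * Df a u); last first.
  by apply/funext => w; rewrite -expr2 exprVn.
apply: (cvgM _ cfa); apply: cvgN; exact: (cvgM cV cV).
Qed.

Lemma hasC1_sqrt U f : (forall u, U u -> 0 < f u) -> hasC1 U f ->
  hasC1 U (fun u => Num.sqrt (f u)).
Proof.
move=> f0 [Df Cf]; exists (fun a u => (2 * Num.sqrt (f u))^-1 * Df a u) => u Uu.
have [cf df] := Cf u Uu.
have cs : {for u, continuous (fun w => Num.sqrt (f w))}.
  exact: (continuous_comp cf (@sqrt_continuous _ _)).
split=> [|a]; first exact: cs.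
have [dfa cfa] := df a; split; first exact: is_derive_sqrt_comp (f0 u Uu) dfa.
apply: (cvgM _ cfa); apply: cvgV; first by rewrite mulf_neq0// gt_eqF// sqrtr_gt0 f0.
by apply: (cvgM _ cs); exact: cst_continuous.
Qed.

Lemma hasC1_open_ext U f g : open U -> (forall u, U u -> f u = g u) -> hasC1 U f -> hasC1 U g.
Proof.
move=> oU fg [Df Cf]; exists Df => u Uu; have [cf df] := Cf u Uu.
have nU : \near u, f u = g u.
  by apply: filterS (open_nbhs_nbhs (conj oU Uu)) => w; exact: fg.
split=> [|a].
  suff : g x @[x --> u] --> g u by [].
  rewrite -(fg u Uu); apply: cvg_trans cf; have FF := nbhs_filter u; exact: (near_eq_cvg nU).
by have [dfa cfa] := df a; split=> //; exact: near_eq_is_derive dfa.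
Qed.

Lemma hasC1_det U n (A : 'rV[R]_d -> 'M[R]_n) : (forall i j, hasC1 U (fun u => A u i j)) ->
  hasC1 U (fun u => \det (A u)).
Proof.
move=> CA; rewrite /determinant; apply: hasC1_sum => s; apply: hasC1M; first exact: hasC1_cst.
by apply: hasC1_prod => i; exact: CA.
Qed.

(** Cramer's formula. [invmx] agrees with it only where the matrix is invertible, whence the detour
    through equality on an open set. *)
Lemma hasC1_inv U n (A : 'rV[R]_d -> 'M[R]_n) i j : (forall i j, hasC1 U (fun u => A u i j)) ->
  open U -> (forall u, U u -> A u \in unitmx) -> hasC1 U (fun u => invmx (A u) i j).
Proof.
move=> CA oU uA.
have Cad : hasC1 U (fun u => (\det (A u))^-1 * \adj (A u) i j).
  apply: hasC1M.
    by apply: hasC1V (hasC1_det CA) => u /uA; rewrite unitmxE unitfE.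
  under eq_fun do rewrite mxE /cofactor; apply: hasC1M; first exact: hasC1_cst.
  apply: hasC1_det => k l; under eq_fun do rewrite !mxE; exact: CA.
apply: hasC1_open_ext Cad => // u Uu.
by rewrite /invmx uA// [in RHS]mxE.
Qed.
End C1.

Section coordinates.
Context (R : realType) (d : nat).

Lemma coord_continuous_rV (a : 'I_d) (u : 'rV[R]_d) : {for u, continuous (fun w : 'rV[R]_d => w ord0 a)}.
Proof.
have FF := nbhs_filter u; apply/cvg_ballP => e e0.
apply: filterS (nbhsx_ballx u e e0) => w [_ bw]; exact: bw.
Qed.

Lemma C1on_coord (U : set 'rV[R]_d) (a : 'I_d) :
  C1on U (fun u => u ord0 a) (fun b _ => (a == b)%:R).
Proof.
move=> u _; split=> [|b]; first exact: coord_continuous_rV.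
split; last exact: cst_continuous.
apply: is_derive_of_line.
rewrite (_ : (fun t => _) = fun t : R => t * (a == b)%:R + u ord0 a); last first.
  by apply/funext => t; rewrite !mxE.
apply: is_derive_eq; by rewrite !scaler0 add0r addr0 /GRing.scale/= mulr1.
Qed.

(** A polynomial cutoff: it vanishes on the faces, which is what integration by parts over the box
    asks for, and it is bounded below on the concentric box of half the side. *)
Definition bump (lo : nat -> R) (H : R) (u : 'rV[R]_d) : R :=
  \prod_(a < d) ((u ord0 a - lo a) * (lo a + H - u ord0 a)).

Lemma bump_ge (lo : nat -> R) (H : R) u : 0 < H ->
  box (fun k => lo k + H / 4) (H / 2) u -> ((H / 4) ^+ 2) ^+ d <= bump lo H u.
Proof.
move=> H0 bu; rewrite -[X in _ ^+ X](card_ord d) -prodr_const; apply: ler_prod => a _.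
rewrite sqr_ge0/= expr2; move: (bu a) => /= /andP[u1 u2].
by apply: ler_pM; lra.
Qed.

Lemma bump_face (lo : nat -> R) (H : R) (u : 'rV[R]_d) (a : 'I_d) :
  u ord0 a = lo a \/ u ord0 a = lo a + H -> bump lo H u = 0.
Proof.
move=> ua; apply/eqP/prodf_eq0; exists a => //.
by case: ua => ->; rewrite ?subrr ?mul0r ?mulr0.
Qed.

Lemma hasC1D (U : set 'rV[R]_d) f g : hasC1 U f -> hasC1 U g -> hasC1 U (fun u => f u + g u).
Proof. by move=> [? Cf] [? Cg]; eexists; exact: C1onD Cf Cg. Qed.

Lemma hasC1_bump U lo H : hasC1 U (bump lo H).
Proof.
apply: hasC1_prod => a; apply: hasC1M.
  by apply: hasC1D; [eexists; exact: C1on_coord|exact: hasC1_cst].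
have -> : (fun u : 'rV[R]_d => lo a + H - u ord0 a) = fun u => (lo a + H) + (-1) * u ord0 a.
  by apply/funext => u; rewrite mulN1r.
apply: hasC1D; first exact: hasC1_cst.
by apply: hasC1M; [exact: hasC1_cst|eexists; exact: C1on_coord].
Qed.

End coordinates.

Section caccioppoli.
Context (R : realType) (d : nat) (U : set 'rV[R]_d) (lo : nat -> R) (H : R).
Hypotheses (H0 : 0 < H) (bU : box lo H `<=` U).
Context (h : 'I_d -> 'I_d -> 'rV[R]_d -> R) (kappa : R) (dens : 'rV[R]_d -> R).
Hypotheses (Ch : forall a b, hasC1 U (h a b)) (k0 : 0 < kappa).
Hypothesis ell : forall u, box lo H u -> forall xi : 'I_d -> R,
  kappa * \sum_a xi a ^+ 2 <= \sum_a \sum_b xi a * h a b u * xi b.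
Hypothesis cdens : cont_on (box lo H) dens.

Lemma C1on_cont f Df : C1on U f Df -> cont_on (box lo H) f.
Proof. by move=> Cf u /bU /Cf[]. Qed.

Lemma C1on_contD f Df a : C1on U f Df -> cont_on (box lo H) (Df a).
Proof. by move=> Cf u /bU /Cf[_ /(_ a)[]]. Qed.

Lemma cont_onM (B : set 'rV[R]_d) f g : cont_on B f -> cont_on B g -> cont_on B (fun u => f u * g u).
Proof. by move=> cf cg u Bu; exact: (cvgM (cf u Bu) (cg u Bu)). Qed.

Lemma cont_onD (B : set 'rV[R]_d) f g : cont_on B f -> cont_on B g -> cont_on B (fun u => f u + g u).
Proof. by move=> cf cg u Bu; exact: (cvgD (cf u Bu) (cg u Bu)). Qed.

Lemma cont_on_cst (B : set 'rV[R]_d) c : cont_on B (fun=> c).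
Proof. by move=> u _; exact: cst_continuous. Qed.

Lemma cont_on_sum (B : set 'rV[R]_d) (I : Type) (s : seq I) (f : I -> 'rV[R]_d -> R) :
  (forall i, cont_on B (f i)) -> cont_on B (fun u => \sum_(i <- s) f i u).
Proof.
move=> cf; elim: s => [|i s IH].
  by under eq_fun do rewrite big_nil; exact: cont_on_cst.
by under eq_fun do rewrite big_cons; exact: cont_onD.
Qed.

(* [2 |eta F q_b D_b| <= (kappa/2) eta^2 D_b^2 + (2/kappa) q_b^2 F^2] *)
Lemma caccioppoli_pointwise (eta F G r : R) (D q : 'I_d -> R) (E N Q : R) :
  kappa * \sum_a D a ^+ 2 <= E -> `|eta ^+ 2 * r| <= N -> (forall b, `|q b| <= Q) ->
  kappa / 2 * (eta ^+ 2 * \sum_a D a ^+ 2) <=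
  (N + 2 / kappa * Q ^+ 2 * d%:R) * (F ^+ 2 + G ^+ 2) +
  (- (eta ^+ 2 * r * F * G) + eta ^+ 2 * E + 2 * F * eta * \sum_b q b * D b).
Proof.
move=> HE HN HQ.
have N0 : 0 <= N by apply: le_trans HN.
have H1 : eta ^+ 2 * r * F * G <= N * (F ^+ 2 + G ^+ 2).
  apply: le_trans (ler_norm _) _; rewrite -mulrA normrM; apply: ler_pM => //.
  rewrite normrM -(real_normK (num_real F)) -(real_normK (num_real G)).
  set x := `|F|; set y := `|G|; rewrite -subr_ge0.
  have -> : x ^+ 2 + y ^+ 2 - x * y = ((x - y) ^+ 2 + x ^+ 2 + y ^+ 2) / 2 by field.
  by rewrite divr_ge0// !addr_ge0// sqr_ge0.
have H2 : eta ^+ 2 * (kappa * \sum_a D a ^+ 2) <= eta ^+ 2 * E.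
  by rewrite ler_wpM2l// sqr_ge0.
have H3 : - (2 * F * eta * \sum_b q b * D b) <=
   kappa / 2 * (eta ^+ 2 * \sum_a D a ^+ 2) + 2 / kappa * Q ^+ 2 * d%:R * F ^+ 2.
  rewrite !mulr_sumr -sumrN.
  have -> : 2 / kappa * Q ^+ 2 * d%:R * F ^+ 2 = \sum_(b < d) 2 / kappa * Q ^+ 2 * F ^+ 2.
    by rewrite sumr_const card_ord -mulr_natr; ring.
  rewrite -big_split/=; apply: ler_sum => b _.
  apply: (@le_trans _ _ (kappa / 2 * (eta ^+ 2 * D b ^+ 2) + 2 / kappa * q b ^+ 2 * F ^+ 2)).
    rewrite -subr_ge0.
    have -> : kappa / 2 * (eta ^+ 2 * D b ^+ 2) + 2 / kappa * q b ^+ 2 * F ^+ 2 -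
       - (2 * F * eta * (q b * D b)) = 2 / kappa * (kappa / 2 * eta * D b + q b * F) ^+ 2.
      by field; rewrite gt_eqF.
    by rewrite mulr_ge0 ?sqr_ge0// divr_ge0// ltW.
  rewrite lerD2l; apply: ler_wpM2r; first exact: sqr_ge0.
  apply: ler_wpM2l; first by rewrite divr_ge0// ltW.
  by rewrite -(real_normK (num_real (q b))) !expr2; apply: ler_pM.
have H4 : 0 <= 2 / kappa * Q ^+ 2 * d%:R * G ^+ 2.
  by apply: mulr_ge0; rewrite ?sqr_ge0// mulr_ge0// mulr_ge0 ?sqr_ge0// divr_ge0// ltW.
move: H1 H2 H3 H4; set S := \sum_a _; set T := \sum_b _.
set c := 2 / kappa * _ * _.
have -> : eta ^+ 2 * (kappa * S) = 2 * (kappa / 2 * (eta ^+ 2 * S)) by field.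
rewrite !mulrDl !mulrDr.
set X := kappa / 2 * _; set Y := _ * F * G; set Z := 2 * F * eta * T.
move=> *; lra.
Qed.
Lemma box_inner_sub : box (fun k => lo k + H / 4) (H / 2) `<=` @box R d lo H.
Proof.
move=> u bu a; move: (bu a) => /= /andP[u1 u2].
by apply/andP; split; move: H0 u1 u2; set x := u ord0 a; set y := lo a => *; lra.
Qed.

(** Let V be [h] applied to the gradient of F, so that div V = - dens G on the box. The field eta^2
    F V vanishes on the faces, hence its divergence has integral zero; expanding it bounds the
    energy weighted by eta^2, the cross term being absorbed pointwise. [C] depends only on the box
    and the coefficients, so it serves all functions F at once. *)
Lemma caccioppoli : exists2 C : R, 0 <= C & forall F DF G DV,
  C1on U F DF -> cont_on (box lo H) G ->
  (forall a, C1on U (fun u => \sum_b h a b u * DF b u) (DV a)) ->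
  (forall u, box lo H u -> \sum_a DV a a u = - (dens u * G u)) ->
  (\int[leb R d]_(z in ebox (fun k => lo k + H / 4)%R (H / 2)) (\sum_a DF a (pt z) ^+ 2)%:E
   <= C%:E * \int[leb R d]_(z in ebox lo H) (F (pt z) ^+ 2 + G (pt z) ^+ 2)%:E)%E.
Proof.
pose eta := bump lo H : 'rV[R]_d -> R.
have [Deta Ceta] : hasC1 U eta := hasC1_bump _ _ _.
have ceta := C1on_cont Ceta.
have ch a b : cont_on (box lo H) (h a b) by have [? /C1on_cont] := Ch a b.
(* The gradient of the cutoff contracted with [h]; the cross term becomes 2 F eta times the sum of
   the q_b DF_b. *)
pose q b u := \sum_a Deta a u * h a b u.
have cq b : cont_on (box lo H) (q b).
  by apply: cont_on_sum => a; apply: cont_onM; [exact: C1on_contD Ceta|exact: ch].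
have [N N0 HN] := cont_on_bounded (cont_onM (cont_on_sqr ceta) cdens).
have /choice[Qb HQb] : forall b, exists Qb, 0 <= Qb /\ forall u, box lo H u -> `|q b u| <= Qb.
  by move=> b; have [Q ? ?] := cont_on_bounded (cq b); exists Q.
pose Q := \sum_b Qb b.
have HQ b u : box lo H u -> `|q b u| <= Q.
  move=> bu; apply: le_trans ((HQb b).2 u bu) _.
  by rewrite /Q (bigD1 b)//= lerDl; apply: sumr_ge0 => c _; exact: (HQb c).1.
pose C0 := N + 2 / kappa * Q ^+ 2 * d%:R.
have C00 : 0 <= C0.
  by rewrite addr_ge0// mulr_ge0// mulr_ge0 ?sqr_ge0// divr_ge0// ltW.
pose e0 := ((H / 4) ^+ 2) ^+ d.
have e00 : 0 < e0 by rewrite !exprn_gt0// divr_gt0.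
(* [e0] is the lower bound for eta on the inner box, so that eta^2 is at least e0^2 there. *)
pose k1 := kappa / 2 * e0 ^+ 2.
have k10 : 0 < k1 by rewrite mulr_gt0 ?divr_gt0// exprn_gt0.
exists (k1^-1 * C0); first by rewrite mulr_ge0// invr_ge0 ltW.
move=> F DF G DV CF cG CV PDE.
have cF := C1on_cont CF.
have cDF a : cont_on (box lo H) (DF a) by exact: C1on_contD CF.
pose V a u := \sum_b h a b u * DF b u.
have cV a : cont_on (box lo H) (V a) by exact: C1on_cont (CV a).
have cDV a : cont_on (box lo H) (DV a a) by exact: C1on_contD (CV a).
pose X u := eta u * eta u * F u.
pose DX a u := eta u * eta u * DF a u + F u * (eta u * Deta a u + eta u * Deta a u).
have CX : C1on U X DX by exact: C1onM (C1onM Ceta Ceta) CF.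
(* The derivative of [X * V a] in the direction [a]; the sum over [a] is the divergence of eta^2 F
   V. *)
pose dW a u := X u * DV a a u + V a u * DX a u.
have cX := C1on_cont CX.
have cdW a : cont_on (box lo H) (dW a).
  by apply: cont_onD; apply: cont_onM => //; exact: C1on_contD CX.
have mB : measurable (@ebox R d lo H) by exact: measurable_ebox.
have H0' := ltW H0.
have int0 a : (\int[leb R d]_(z in ebox lo H) (dW a (pt z))%:E = 0)%E.
  apply: (@integral_partial0 R d lo H a (fun u => X u * V a u)) => //.
  - by move=> u /bU Uu; have [_ /(_ a)[]] := C1onM CX (CV a) Uu.
  - by move=> u bu /bump_face ua; rewrite /X /eta ua !mul0r.
pose S u := \sum_a DF a u ^+ 2.
have cS : cont_on (box lo H) S by apply: cont_on_sum => a; exact: cont_on_sqr.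
have S0 u : 0 <= S u by apply: sumr_ge0 => a _; exact: sqr_ge0.
pose W u := \sum_a dW a u.
have cW : cont_on (box lo H) W by exact: cont_on_sum.
pose E2 u := F u ^+ 2 + G u ^+ 2.
have cE2 : cont_on (box lo H) E2 by apply: cont_onD; exact: cont_on_sqr.
have E20 u : 0 <= E2 u by rewrite addr_ge0// sqr_ge0.
have pw u : box lo H u -> kappa / 2 * (eta u ^+ 2 * S u) <= C0 * E2 u + W u.
  move=> bu.
  have := @caccioppoli_pointwise (eta u) (F u) (G u) (dens u) (fun a => DF a u) (fun b => q b u)
     (\sum_a \sum_b DF a u * h a b u * DF b u) N Q (ell bu _) (HN _ bu) (fun b => HQ b _ bu).
  move/le_trans; apply; rewrite lerD2l le_eqVlt; apply/orP; left; apply/eqP.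
  have -> : W u = X u * (\sum_a DV a a u) + \sum_a V a u * DX a u.
    by rewrite /W big_split/= mulr_sumr.
  rewrite PDE//.
  have -> : \sum_a V a u * DX a u =
     eta u ^+ 2 * (\sum_a \sum_b DF a u * h a b u * DF b u) + 2 * F u * eta u * \sum_a Deta a u * V a u.
    rewrite !mulr_sumr -big_split/=; apply: eq_bigr => a _.
    have -> : \sum_b DF a u * h a b u * DF b u = DF a u * V a u.
      by rewrite /V mulr_sumr; apply: eq_bigr => b _; rewrite mulrA.
    by rewrite /DX; ring.
  have -> : \sum_a Deta a u * V a u = \sum_b q b u * DF b u.
    rewrite /V /q; under eq_bigr do rewrite mulr_sumr.
    rewrite exchange_big/=; apply: eq_bigr => b _; rewrite mulr_suml.
    by apply: eq_bigr => a _; rewrite mulrA.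
  by rewrite /X; ring.
have k1E : (k1%:E * \int[leb R d]_(z in ebox (fun k => lo k + H / 4)%R (H / 2)) (S (pt z))%:E
   <= C0%:E * \int[leb R d]_(z in ebox lo H) (E2 (pt z))%:E)%E.
  have cSi := cont_on_sub box_inner_sub cS.
  have mBi : measurable (@ebox R d (fun k => lo k + H / 4) (H / 2)) by exact: measurable_ebox.
  rewrite -ge0_integralZl_EFin//; first last.
  - exact: ltW.
  - exact: measurable_EFin_cont_on.
  - by move=> z _; rewrite lee_fin.
  have cL : cont_on (box lo H) (fun u => kappa / 2 * (eta u ^+ 2 * S u)).
    by apply: cont_onM; [exact: cont_on_cst|apply: cont_onM => //; exact: cont_on_sqr].
  have L0 u : 0 <= kappa / 2 * (eta u ^+ 2 * S u).
    by apply: mulr_ge0; [rewrite divr_ge0// ltW|rewrite mulr_ge0// sqr_ge0].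
  apply: (@le_trans _ _ (\int[leb R d]_(z in ebox (fun k => lo k + H / 4)%R (H / 2))
      (kappa / 2 * (eta (pt z) ^+ 2 * S (pt z)))%:E)%E).
    apply: ge0_le_integral; [exact: mBi| | | | ].
    - by move=> z _; rewrite -EFinM lee_fin mulr_ge0// ltW.
    - by apply: measurable_funeM; exact: measurable_EFin_cont_on.
    - exact: measurable_EFin_cont_on (cont_on_sub box_inner_sub cL).
    - move=> z bz; rewrite -EFinM lee_fin /k1 -(mulrA (kappa / 2)).
      apply: ler_wpM2l; first by rewrite divr_ge0// ltW.
      apply: ler_wpM2r; first exact: S0.
      rewrite !expr2; have := bump_ge H0 bz; rewrite -/e0 -/eta => he.
      by apply: ler_pM => //; exact: ltW.
  apply: (@le_trans _ _ (\int[leb R d]_(z in ebox lo H)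
      (kappa / 2 * (eta (pt z) ^+ 2 * S (pt z)))%:E)%E).
    apply: ge0_subset_integral; [exact: mBi|exact: mB| | | ].
    - exact: measurable_EFin_cont_on cL.
    - by move=> z _; rewrite lee_fin.
    - by move=> z; exact: box_inner_sub.
  have i1 : (leb R d).-integrable (ebox lo H) (fun z => (C0 * E2 (pt z))%:E).
    exact: integrable_cont_on (cont_onM (@cont_on_cst _ C0) cE2).
  have i2 : (leb R d).-integrable (ebox lo H) (fun z => (W (pt z))%:E).
    exact: integrable_cont_on cW.
  apply: (@le_trans _ _ (\int[leb R d]_(z in ebox lo H) ((C0 * E2 (pt z))%:E + (W (pt z))%:E))%E).
    apply: ge0_le_integral; [exact: mB| | | | ].
    - by move=> z _; rewrite lee_fin.
    - exact: measurable_EFin_cont_on cL.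
    - by apply: emeasurable_funD; [have /integrableP[] := i1|have /integrableP[] := i2].
    - by move=> z bz; rewrite -EFinD lee_fin; exact: pw.
  rewrite integralD//.
  have -> : (\int[leb R d]_(z in ebox lo H) (W (pt z))%:E = 0)%E.
    rewrite /W; under eq_integral do rewrite -sumEFin.
    rewrite integral_sum//; first by rewrite big1.
    by move=> a; exact: integrable_cont_on (cdW a).
  rewrite adde0; under eq_integral do rewrite EFinM.
  rewrite ge0_integralZl_EFin//.
  - by move=> z _; rewrite lee_fin.
  - exact: measurable_EFin_cont_on.
apply: (@le_trans _ _ (k1^-1%:E * (k1%:E *
    \int[leb R d]_(z in ebox (fun k => lo k + H / 4)%R (H / 2)) (S (pt z))%:E))%E).
  by rewrite muleA -EFinM mulVf ?mul1e// gt_eqF.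
rewrite (EFinM k1^-1 C0) -muleA; apply: lee_wpmul2l; [by rewrite lee_fin invr_ge0 ltW|exact: k1E].
Qed.

End caccioppoli.

(** * Riemannian geometry in charts *)

Section compare.
Local Open Scope ereal_scope.
Context (R : realType).

Lemma integral_mrestr d (X : measurableType d) (m : {measure set X -> \bar R})
    (D : set X) (mD : measurable D) (f : X -> \bar R) :
  measurable_fun setT f -> (forall x, 0 <= f x) ->
  \int[mrestr m mD]_x f x = \int[m]_(x in D) f x.
Proof.
move=> mf f0; rewrite -(setvU D) ge0_integral_setU//; first last.
- by apply/disj_setPS; rewrite setICl.
- by rewrite setvU.
- exact: measurableC.
rewrite [X in X + _](_ : _ = 0) ?add0e; last first.
  rewrite (eq_measure_integral mzero) ?integral_measure_zero// => A mA AD.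
  by rewrite /mzero /= /mrestr (_ : A `&` D = set0) ?measure0//; apply/disjoints_subset.
by apply: eq_measure_integral => A mA AD /=; rewrite /mrestr setIidl.
Qed.

Context d d' (X : measurableType d) (Y : measurableType d').
Context (m : {measure set X -> \bar R}) (n : {measure set Y -> \bar R}).
Context (Q : set X) (D : set Y) (kap : Y -> X) (k : R).
Hypotheses (mQ : measurable Q) (mD : measurable D) (k0 : (0 <= k)%R).
Hypothesis mkap : measurable_fun D kap.
Hypothesis kQ : forall y, D y -> Q (kap y).

(** Pushing a measure forward requires a map that is measurable on the whole space. Outside [D] a
    constant is used; if [X] has no point to offer, [Y] is empty and [kap] itself will do. *)
Lemma exists_total_ext : exists kt : Y -> X, measurable_fun setT kt /\
   forall y, D y -> kt y = kap y.
Proof.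
have [x0|/forallNP noX] := pselect (exists x : X, True); last first.
  by exists kap; split=> // _ E mE; rewrite setTI (_ : _ @^-1` _ = set0)//;
    apply/seteqP; split=> // y _; exact: (noX (kap y)).
have [x _] := x0.
exists (fun y => if y \in D then kap y else x); split=> [|y Dy]; last by rewrite mem_set.
apply: measurable_fun_if => //.
- by apply: measurable_fun_bool; rewrite setTI (_ : _ @^-1` _ = D)//;
    apply/seteqP; split=> y /=; [move/set_mem|move/mem_set].
- by rewrite setTI (_ : _ @^-1` _ = D)//;
    apply/seteqP; split=> y /=; [move/set_mem|move/mem_set].
Qed.

Section le.
Context (f : X -> \bar R).
Hypotheses (mf : measurable_fun setT f) (f0 : forall x, 0 <= f x).

(** [nu] is k times the image under [kap] of n restricted to D. Comparing integrals of [f] is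
    thereby reduced to comparing [m] and [nu] on sets, in either direction. *)
Lemma scaled_image_measure : exists nu : {measure set X -> \bar R},
  (forall S, measurable S -> nu S = k%:E * n (D `&` kap @^-1` (S `&` Q))) /\
  k%:E * \int[n]_(y in D) f (kap y) = \int[nu]_x f x.
Proof.
have [kt [mkt ktE]] := exists_total_ext.
pose nD : {measure set Y -> \bar R} := mrestr n mD.
pose nuF := pushforward nD kt : {measure set X -> \bar R}.
pose nu := nuF mkt.
exists (mscale (NngNum k0) nu); split=> [S mS|].
  rewrite /= /mscale /= /nu /pushforward /nD /= /mrestr; congr (_ * n _).
  apply/seteqP; split=> [y [Sy Dy]|y [Dy [Sy _]]]; split=> //=.
    by split; [rewrite -ktE|exact: kQ].
  by rewrite ktE.
rewrite ge0_integral_mscale//=; congr (_ * _).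
rewrite [RHS]ge0_integral_pushforward//= [RHS]integral_mrestr//.
- by apply: eq_integral => y /set_mem Dy /=; rewrite ktE.
- exact: measurableT_comp.
Qed.

Lemma integral_le_of_le_preimage :
  (forall E, measurable E -> E `<=` Q -> m E <= k%:E * n (D `&` kap @^-1` E)) ->
  \int[m]_(x in Q) f x <= k%:E * \int[n]_(y in D) f (kap y).
Proof.
move=> H; have [nu [nuE ->]] := scaled_image_measure.
rewrite -(integral_mrestr m mQ mf f0); apply: ge0_le_measure_integral => // S mS.
by rewrite nuE//; apply: H; [exact: measurableI|exact: subIsetr].
Qed.

Lemma integral_ge_of_ge_preimage :
  (forall E, measurable E -> E `<=` Q -> k%:E * n (D `&` kap @^-1` E) <= m E) ->
  k%:E * \int[n]_(y in D) f (kap y) <= \int[m]_(x in Q) f x.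
Proof.
move=> H; have [nu [nuE ->]] := scaled_image_measure.
rewrite -(integral_mrestr m mQ mf f0); apply: ge0_le_measure_integral => // S mS.
by rewrite nuE//; apply: H; [exact: measurableI|exact: subIsetr].
Qed.
End le.
End compare.

Lemma smooth_C1on (R : realType) (d : nat) (U : set 'rV[R]_d) (f : 'rV[R]_d -> R) (l : seq 'I_d) :
  smooth_on U f -> C1on U (partials l f) (fun a => partials (a :: l) f).
Proof.
move=> sf u Uu; split; first by have [/(_ (leqnn _)) H _] := sf (size l) l; exact/H/mem_set.
move=> a; split; last by have [/(_ (leqnn _)) H _] := sf (size l).+1 (a :: l); exact/H/mem_set.
have [_ /(_ (leqnn _) a u Uu)] := sf (size l).+1 l; exact: derivableP.
Qed.

Section manifold.
Context (R : realType) (d : nat) (M : closedRiemannian R d).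
Implicit Types i : chart_index M.

Definition cimg i : set 'rV[R]_d := chart i @` cdom i.

Lemma cimg_cinv i u : cimg i u -> cdom i (cinv i u) /\ chart i (cinv i u) = u.
Proof. by move=> [x ix <-]; rewrite (chartK ix). Qed.

Lemma cmet_hasC1 i a b : hasC1 (cimg i) (fun u => cmet i u a b).
Proof. by eexists; have := @smooth_C1on _ _ _ _ [::] (@cmet_smooth _ _ M i a b); exact. Qed.

Lemma cmet_posdef i u : cimg i u -> posdef (cmet i u).
Proof. by move=> iu v v0; exact: cmet_pos. Qed.

Lemma cmet_unit i u : cimg i u -> cmet i u \in unitmx.
Proof. by move=> iu; apply: posdef_unit; [exact: cmet_sym|exact: cmet_posdef]. Qed.

Lemma vol_density_gt0 i u : cimg i u -> 0 < vol_density i u.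
Proof.
by move=> iu; rewrite sqrtr_gt0; apply: posdef_det_gt0; [exact: cmet_sym|exact: cmet_posdef].
Qed.

Lemma vol_density_hasC1 i : hasC1 (cimg i) (@vol_density _ _ M i).
Proof.
apply: hasC1_sqrt; last by apply: hasC1_det => a b; exact: cmet_hasC1.
by move=> u iu; apply: posdef_det_gt0; [exact: cmet_sym|exact: cmet_posdef].
Qed.

(** |g|^(1/2) g^(ab), the coefficients of the Laplacian written in divergence form. *)
Definition flux_coef i (a b : 'I_d) u : R := vol_density i u * invmx (cmet i u) a b.

Lemma flux_coef_hasC1 i a b : hasC1 (cimg i) (flux_coef i a b).
Proof.
apply: hasC1M; first exact: vol_density_hasC1.
apply: hasC1_inv; [exact: cmet_hasC1|exact: cimg_open|exact: cmet_unit].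
Qed.

Section inbox.
Context i (lo : nat -> R) (H : R).
Hypotheses (H0 : 0 < H) (bU : box lo H `<=` cimg i).

Lemma cont_on_hasC1 f : hasC1 (cimg i) f -> cont_on (box lo H) f.
Proof. by move=> [Df Cf] u /bU /Cf[]. Qed.

Lemma density_bounds : exists2 k : R, 0 < k & forall u, box lo H u ->
  k^-1 <= vol_density i u <= k.
Proof.
have cd := cont_on_hasC1 (vol_density_hasC1 i).
have cv : cont_on (box lo H) (fun u => (vol_density i u)^-1).
  apply: cont_on_hasC1; apply: hasC1V (vol_density_hasC1 i).
  by move=> u /vol_density_gt0 H1; rewrite gt_eqF.
have [K1 K10 HK1] := cont_on_bounded cd; have [K2 K20 HK2] := cont_on_bounded cv.
exists (K1 + K2 + 1); first by rewrite ltr_wpDl// addr_ge0.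
move=> u bu; have v0 := vol_density_gt0 (bU bu).
have := HK1 u bu; have := HK2 u bu.
rewrite (gtr0_norm v0) gtr0_norm ?invr_gt0// => h2 h1; apply/andP; split; last by lra.
rewrite -[leRHS]invrK lef_pV2 ?posrE ?invr_gt0//; last by rewrite ltr_wpDl// addr_ge0.
by lra.
Qed.

(** On the compact box the entries of the metric are bounded, so its quadratic form is bounded above
    and that of its inverse below, by [posdef_inv_ge]; the density contributes a lower bound of its
    own. *)
Lemma flux_elliptic : exists2 kappa : R, 0 < kappa &
  forall u, box lo H u -> forall xi : 'I_d -> R,
  kappa * \sum_a xi a ^+ 2 <= \sum_a \sum_b xi a * flux_coef i a b u * xi b.
Proof.
have [k k0 Hk] := density_bounds.
have /choice[Mab HM] : forall ab : 'I_d * 'I_d, exists m : R, 0 <= m /\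
    forall u, box lo H u -> `|cmet i u ab.1 ab.2| <= m.
  move=> ab; have [m ? ?] := cont_on_bounded (cont_on_hasC1 (cmet_hasC1 i ab.1 ab.2)).
  by exists m.
pose m := \sum_ab Mab ab + 1.
have m0 : 0 < m by rewrite ltr_wpDl//; apply: sumr_ge0 => ab _; exact: (HM ab).1.
pose L := m * d%:R + 1.
have L0 : 0 < L by rewrite ltr_wpDl// mulr_ge0// ltW.
exists (k^-1 * L^-1); first by rewrite mulr_gt0 ?invr_gt0.
move=> u bu xi; have iu := bU bu.
have sy := cmet_sym iu; have pd := cmet_posdef iu.
pose v : 'rV[R]_d := \row_a xi a.
have vS : \sum_a v ord0 a ^+ 2 = \sum_a xi a ^+ 2.
  by apply: eq_bigr => a _; rewrite mxE.
have S0 : 0 <= \sum_a xi a ^+ 2 by apply: sumr_ge0 => a _; exact: sqr_ge0.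
have Hq : (v *m cmet i u *m v^T) ord0 ord0 <= L * \sum_a v ord0 a ^+ 2.
  apply: le_trans (@quad_form_le _ _ _ m v _) _.
    move=> a b; apply: le_trans ((HM (a, b)).2 u bu) _.
    rewrite /m (bigD1 (a, b))//= -addrA lerDl addr_ge0//.
    by apply: sumr_ge0 => ab _; exact: (HM ab).1.
  by rewrite vS ler_wpM2r// /L lerDl.
have := posdef_inv_ge sy pd L0 Hq; rewrite vS quad_formE => Hi.
have -> : \sum_a \sum_b xi a * flux_coef i a b u * xi b =
   vol_density i u * \sum_a \sum_b v ord0 a * invmx (cmet i u) a b * v ord0 b.
  rewrite mulr_sumr; apply: eq_bigr => a _; rewrite mulr_sumr; apply: eq_bigr => b _.
  by rewrite !mxE /flux_coef; ring.
have /andP[k1 _] := Hk u bu.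
by rewrite -mulrA; apply: ler_pM => //; rewrite ?invr_ge0 ?mulr_ge0 ?invr_ge0 // ltW.
Qed.

End inbox.
End manifold.

Section volume.
Context (R : realType) (d : nat) (M : closedRiemannian R d).
Implicit Types i : chart_index M.

Lemma open_measurable_borel (O : set M) : open O -> measurable (O : set (borel M)).
Proof. by move=> oO; exact: sub_sigma_algebra. Qed.

Lemma closed_measurable_borel (O : set M) : closed O -> measurable (O : set (borel M)).
Proof.
by move=> cO; rewrite -(setCK O); apply: measurableC; apply: open_measurable_borel; exact: closed_openC.
Qed.

Lemma measurable_to_borel dX (X : measurableType dX) (D : set X) (f : X -> borel M) :
  (forall O : set M, open O -> measurable (D `&` f @^-1` O)) -> measurable_fun D f.
Proof.
move=> mO; apply: (@measurability _ _ X (borel M) D f (@open M)) => //.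
by move=> _ [W oW <-]; exact: mO.
Qed.

Section inbox.
Context i (lo : nat -> R) (H : R).
Hypotheses (H0 : 0 < H) (bU : box lo H `<=` cimg i).

Definition cpt (z : eu R d) : borel M := cinv i (pt z).
Definition cbox : set (borel M) := cinv i @` box lo H.

Lemma closed_cbox : closed (cbox : set M).
Proof.
apply: compact_closed; first exact: carrier_hausdorff.
apply: continuous_compact; last exact: compact_box.
apply: continuous_in_subspaceT => u /set_mem /bU iu.
by apply: (@cinv_continuous _ _ M i); apply/mem_set.
Qed.

Lemma measurable_cbox : measurable cbox.
Proof. apply: closed_measurable_borel; exact: closed_cbox. Qed.

Lemma measurable_cpt : measurable_fun (ebox lo H) cpt.
Proof.
apply: measurable_to_borel => O oO.
apply: measurable_continuous_preimage => //; first exact: measurable_ebox.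
  by move=> a; apply: (measurable_funS measurableT) => //; exact: measurable_pt.
by move=> z /bU iu; apply: (@cinv_continuous _ _ M i); apply/mem_set.
Qed.

Lemma cpt_cbox z : ebox lo H z -> cbox (cpt z).
Proof. by move=> bz; exists (pt z). Qed.

Context (vol : probability (borel M) R) (c : R).
Hypothesis hc : forall i (E : set (borel M)), measurable E -> E `<=` cdom i ->
    vol E = (c%:E * integral_rV (fun u =>
             (\1_(chart i @` E) u * vol_density i u)%:E))%E.

Lemma cbox_cdom : cbox `<=` cdom i.
Proof. by move=> _ [u /bU iu <-]; exact: (cimg_cinv iu).1. Qed.

(** Inside the box, the image of [E] under the chart is the preimage of [E] under [cpt]. This
    replaces a direct image by a preimage and makes the integrand measurable. *)
Lemma vol_cboxE (E : set (borel M)) : measurable E -> E `<=` cbox ->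
  (vol E = c%:E * \int[leb R d]_(z in ebox lo H) (\1_E (cpt z) * vol_density i (pt z))%:E)%E.
Proof.
move=> mE EQ; rewrite (@hc i E mE); last exact: subset_trans EQ cbox_cdom.
have mB : measurable (@ebox R d lo H) by exact: measurable_ebox.
have imgE z : (chart i @` E) (pt z) <-> ebox lo H z /\ E (cpt z).
  split=> [[x Ex xz]|[bz Ez]].
    have [u bu ux] := EQ x Ex; have [_ cu] := cimg_cinv (bU bu).
    have uz : u = pt z by rewrite -cu ux xz.
    by rewrite /ebox /= -uz /cpt -uz ux.
  by exists (cpt z) => //; exact: (cimg_cinv (bU bz)).2.
have patchE : (fun z => (\1_(chart i @` E) (pt z) * vol_density i (pt z))%:E) =
    (fun z => (\1_E (cpt z) * vol_density i (pt z))%:E) \_ (ebox lo H).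
  apply/funext => z; rewrite /patch; case: ifPn => [/set_mem bz|/negP bz].
    congr (_ * _)%:E; rewrite !indicE; congr (nat_of_bool _)%:R.
    by apply/idP/idP => /set_mem h; apply/mem_set; [have [] := (imgE z).1 h|apply/imgE].
  rewrite indicE memNset ?mul0r// => /imgE[bz' _]; exact/bz/mem_set.
rewrite integral_rVE.
- by congr (_ * _)%E; rewrite [RHS]integral_mkcond -patchE.
- by move=> u; rewrite lee_fin mulr_ge0// sqrtr_ge0.
rewrite (_ : _ \o _ = (fun z => (\1_E (cpt z) * vol_density i (pt z))%:E) \_ (ebox lo H)) -?patchE//.
rewrite patchE; apply/(measurable_restrictT _ mB); apply/measurable_EFinP.
apply: measurable_funM.
  by apply: (measurable_comp measurableT) => //; exact: measurable_cpt.
by apply: measurable_cont_on; apply: (cont_on_hasC1 bU); exact: vol_density_hasC1.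
Qed.

Lemma integral_indic_cpt (E : set (borel M)) : measurable E ->
  (\int[leb R d]_(z in ebox lo H) (\1_E (cpt z))%:E = leb R d (ebox lo H `&` cpt @^-1` E))%E.
Proof.
move=> mE; have mB : measurable (@ebox R d lo H) by exact: measurable_ebox.
have mP : measurable (ebox lo H `&` cpt @^-1` E) by exact: measurable_cpt.
rewrite (eq_integral (fun z => (\1_(ebox lo H `&` cpt @^-1` E) z)%:E)).
  by rewrite integral_indic//; congr (leb R d _); apply/seteqP; split=> z /=; tauto.
move=> z /set_mem bz; rewrite !indicE; congr (nat_of_bool _)%:R%:E.
by apply/idP/idP => /set_mem h; apply/mem_set; [split|case: h].
Qed.

Hypothesis c0 : 0 < c.

Lemma vol_compare : exists2 k : R, 0 < k & forall f : borel M -> \bar R,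
  measurable_fun setT f -> (forall x, 0 <= f x)%E ->
  (k^-1%:E * \int[leb R d]_(z in ebox lo H) f (cpt z) <= \int[vol]_(x in cbox) f x)%E /\
  (\int[vol]_(x in cbox) f x <= k%:E * \int[leb R d]_(z in ebox lo H) f (cpt z))%E.
Proof.
have [k k0 Hk] := density_bounds bU.
have mB : measurable (@ebox R d lo H) by exact: measurable_ebox.
(* One constant for both directions: K >= c k gives the upper bound and 1/K <= c/k the lower one. *)
pose K := c * k + c^-1 * k.
have c'0 : 0 < c^-1 by rewrite invr_gt0.
exists K; first by rewrite addr_gt0// mulr_gt0.
move=> f mf f0.
have mI E : measurable E -> measurable_fun (ebox lo H) (fun z => (\1_E (cpt z))%:E : \bar R).
  move=> mE; apply/measurable_EFinP.
  by apply: (measurable_comp measurableT) => //; exact: measurable_cpt.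
have mID (E : set (borel M)) : measurable E ->
    measurable_fun (ebox lo H) (fun z => (\1_E (cpt z) * vol_density i (pt z))%:E).
  move=> mE; apply/measurable_EFinP; apply: measurable_funM.
    by apply: (measurable_comp measurableT) => //; exact: measurable_cpt.
  by apply: measurable_cont_on; apply: (cont_on_hasC1 bU); exact: vol_density_hasC1.
split.
  apply: integral_ge_of_ge_preimage => //.
  - exact: measurable_cbox.
  - by rewrite invr_ge0 ltW// addr_gt0// mulr_gt0.
  - exact: measurable_cpt.
  - exact: cpt_cbox.
  move=> E mE EQ; rewrite [leRHS](vol_cboxE mE EQ) -[X in (_ * X <= _)%E](integral_indic_cpt mE).
  apply: (@le_trans _ _ ((c * k^-1)%:E * \int[leb R d]_(z in ebox lo H) (\1_E (cpt z))%:E)%E).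
    apply: lee_wpmul2r; first by apply: integral_ge0 => z _; rewrite lee_fin.
    rewrite lee_fin -[leRHS]invrK lef_pV2 ?posrE ?invr_gt0 ?mulr_gt0 ?invr_gt0//; last first.
      by rewrite addr_gt0// mulr_gt0.
    by rewrite invfM invrK /K lerDr mulr_ge0// ltW.
  rewrite EFinM -muleA; apply: lee_wpmul2l; first by rewrite lee_fin ltW.
  rewrite -ge0_integralZl_EFin//; first last.
  - by rewrite invr_ge0 ltW.
  - exact: mI.
  apply: ge0_le_integral; [exact: mB| | | |].
  - by move=> z _; rewrite -EFinM lee_fin mulr_ge0// invr_ge0 ltW.
  - by apply: measurable_funeM; exact: mI.
  - exact: mID.
  - move=> z bz; rewrite -EFinM lee_fin mulrC ler_wpM2l//.
    by have /andP[] := Hk _ bz.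
apply: integral_le_of_le_preimage => //.
- exact: measurable_cbox.
- by rewrite ltW// addr_gt0// mulr_gt0.
- exact: measurable_cpt.
- exact: cpt_cbox.
move=> E mE EQ; rewrite [leLHS](vol_cboxE mE EQ) -[X in (_ <= _ * X)%E](integral_indic_cpt mE).
apply: (@le_trans _ _ ((c * k)%:E * \int[leb R d]_(z in ebox lo H) (\1_E (cpt z))%:E)%E); last first.
  apply: lee_wpmul2r; first by apply: integral_ge0 => z _; rewrite lee_fin.
  by rewrite lee_fin lerDl mulr_ge0// ltW.
rewrite EFinM -muleA; apply: lee_wpmul2l; first by rewrite lee_fin ltW.
rewrite -ge0_integralZl_EFin//; first last.
- exact: ltW.
- exact: mI.
apply: ge0_le_integral; [exact: mB| | | |].
- by move=> z bz; rewrite lee_fin mulr_ge0// ltW// (vol_density_gt0 (bU bz)).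
- exact: mID.
- by apply: measurable_funeM; exact: mI.
- move=> z bz; rewrite -EFinM lee_fin [leRHS]mulrC ler_wpM2l//.
  by have /andP[] := Hk _ bz.
Qed.

End inbox.
End volume.

(** * Square-integrable functions *)

Section L2.
Context d (X : measurableType d) (R : realType) (m : {measure set X -> \bar R}).
Implicit Types f g : X -> R.
Local Notation L2 := (Lfun m 2%:E).

Lemma L2_measurable f : f \in L2 -> measurable_fun setT f.
Proof. by rewrite inE => /andP[/[!inE]]. Qed.

Lemma L2_sqr_lty f : f \in L2 -> (\int[m]_x (f x ^+ 2)%:E < +oo)%E.
Proof.
move=> /Lfun2_integrable_sqr/integrableP[_]; apply: le_lt_trans.
by rewrite le_eqVlt; apply/orP; left; apply/eqP; apply: eq_integral => x _ /=; rewrite ger0_norm// sqr_ge0.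
Qed.

Lemma L2P f : measurable_fun setT f -> (\int[m]_x (f x ^+ 2)%:E < +oo)%E -> f \in L2.
Proof.
move=> mf fi; rewrite inE; apply/andP; split; rewrite inE//=.
rewrite /finite_norm unlock poweR_lty//.
rewrite (eq_integral (fun x => (f x ^+ 2)%:E))// => x _ /=.
by rewrite ?poweR_EFin powR_mulrn ?normr_ge0// real_normK// num_real.
Qed.

Lemma L2M f g : f \in L2 -> g \in L2 -> m.-integrable setT (EFin \o (fun x => f x * g x)).
Proof. by move=> fL gL; apply/Lfun1_integrable; exact: Lfun2_mul_Lfun1. Qed.

Lemma coef_sqr f : f \in L2 -> (coef m f f)%:E = (\int[m]_x (f x ^+ 2)%:E)%E.
Proof.
move=> fL; rewrite /coef /Rintegral fineK.
  by apply: eq_integral => x _; rewrite expr2.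
exact: (integrable_fin_num measurableT (L2M fL fL)).
Qed.

Lemma coef_ge0 f : 0 <= coef m f f.
Proof. by apply: Rintegral_ge0 => x _; rewrite -expr2 sqr_ge0. Qed.

Lemma coefC f g : coef m f g = coef m g f.
Proof. by apply: eq_Rintegral => x _; rewrite mulrC. Qed.

Lemma L2D f g : f \in L2 -> g \in L2 -> (fun x => f x + g x) \in L2.
Proof.
move=> fL gL; have p1 : (1 <= 2%:E :> \bar R)%E by rewrite lee_fin ler1n.
have [_ H] := Lfun_addr_closed m p1; exact: (H f g fL gL).
Qed.

Lemma L2Z (r : R) f : f \in L2 -> (fun x => r * f x) \in L2.
Proof.
move=> fL; have := @Lfun_scale _ _ _ m f r 2 _ fL; rewrite ler1n => /(_ isT).
by rewrite (_ : (fun x => r * f x) = r \o* f)//; apply/funext => x /=; rewrite mulrC.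
Qed.

Lemma L20 : (fun _ : X => 0 : R) \in L2.
Proof. by apply: L2P; [exact: measurable_cst|rewrite integral0_eq// => x _; rewrite expr0n]. Qed.

Lemma L2_sum (I : Type) (s : seq I) (f : I -> X -> R) (P : pred I) : (forall i, P i -> f i \in L2) ->
  (fun x => \sum_(i <- s | P i) f i x) \in L2.
Proof.
move=> fL; elim: s => [|i s IH].
  by rewrite (_ : (fun x => _) = fun=> 0) ?L20//; apply/funext => x; rewrite big_nil.
case: (boolP (P i)) => Pi.
  rewrite (_ : (fun x => _) = fun x => f i x + \sum_(i <- s | P i) f i x); last first.
    by apply/funext => x; rewrite big_cons Pi.
  exact: (L2D (fL i Pi) IH).
by rewrite (_ : (fun x => _) = fun x => \sum_(i <- s | P i) f i x)//; apply/funext => x; rewrite big_cons (negbTE Pi).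
Qed.

Lemma coefDl f g h : f \in L2 -> g \in L2 -> h \in L2 ->
  coef m (fun x => f x + g x) h = coef m f h + coef m g h.
Proof.
move=> fL gL hL; rewrite /coef -RintegralD//; [|exact: L2M|exact: L2M].
by apply: eq_Rintegral => x _; rewrite mulrDl.
Qed.

Lemma coefZl r f h : f \in L2 -> h \in L2 -> coef m (fun x => r * f x) h = r * coef m f h.
Proof.
move=> fL hL; rewrite /coef -RintegralZl//; last exact: L2M.
by apply: eq_Rintegral => x _; rewrite mulrA.
Qed.

Lemma coef0l h : coef m (fun=> 0) h = 0.
Proof. by rewrite /coef /Rintegral integral0_eq// => x _; rewrite mul0r. Qed.

Lemma coef_suml (I : Type) (s : seq I) (P : pred I) (f : I -> X -> R) h : (forall i, P i -> f i \in L2) -> h \in L2 ->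
  coef m (fun x => \sum_(i <- s | P i) f i x) h = \sum_(i <- s | P i) coef m (f i) h.
Proof.
move=> fL hL; elim: s => [|i s IH].
  rewrite big_nil -[RHS](coef0l h); congr (coef _ _ _).
  by apply/funext => x; rewrite big_nil.
rewrite big_cons; case: ifPn => Pi; rewrite -IH.
  rewrite -coefDl ?fL//; last exact: L2_sum.
  by congr (coef _ _ _); apply/funext => x; rewrite big_cons Pi.
by congr (coef _ _ _); apply/funext => x; rewrite big_cons (negbTE Pi).
Qed.

(* The discriminant argument: [0 <= coef (f - t g) (f - t g)] at the optimal [t]. *)
Lemma coef_cauchy_schwarz f g : f \in L2 -> g \in L2 ->
  coef m f g ^+ 2 <= coef m f f * coef m g g.
Proof.
move=> fL gL.
have E (t : R) : 0 <= coef m f f + 2 * t * coef m f g + t ^+ 2 * coef m g g.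
  have hL : (fun x => f x + t * g x) \in L2 by apply: L2D => //; exact: L2Z.
  have := coef_ge0 (fun x => f x + t * g x).
  rewrite coefDl//; last exact: L2Z.
  rewrite coefZl// (coefC f) (coefC g) !coefDl ?L2Z// !coefZl// (coefC g f).
  by rewrite (_ : _ + _ = coef m f f + 2 * t * coef m f g + t ^+ 2 * coef m g g)//; ring.
have [g0|g0] := eqVneq (coef m g g) 0.
  rewrite g0 mulr0; suff -> : coef m f g = 0 by rewrite expr0n.
  apply: contrapT => /eqP H; have := E (- (coef m f f + 1) / (2 * coef m f g)).
  rewrite g0 mulr0 addr0 (_ : _ + _ = -1); [by rewrite ler0N1|by field].
have gg : 0 < coef m g g by rewrite lt_neqAle eq_sym g0 coef_ge0.
have := E (- coef m f g / coef m g g).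
rewrite (_ : _ + _ + _ = (coef m f f * coef m g g - coef m f g ^+ 2) / coef m g g); last by field.
by rewrite pmulr_lge0 ?invr_gt0// subr_ge0.
Qed.

Lemma coef_le_sqrt f g : f \in L2 -> g \in L2 ->
  `|coef m f g| <= Num.sqrt (coef m f f) * Num.sqrt (coef m g g).
Proof.
move=> fL gL; rewrite -sqrtrM ?coef_ge0// -sqrtr_sqr ler_sqrt ?mulr_ge0 ?coef_ge0//.
exact: coef_cauchy_schwarz.
Qed.
End L2.

Section orthonormal.
Context d (X : measurableType d) (R : realType) (m : {measure set X -> \bar R}).
Context (n : nat) (e : 'I_n -> X -> R).
Hypotheses (eL : forall k, e k \in Lfun m 2%:E).
Hypothesis eO : forall k l, coef m (e k) (e l) = (k == l)%:R.

Lemma coef_comb_sqr (c : 'I_n -> R) :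
  coef m (fun x => \sum_k c k * e k x) (fun x => \sum_k c k * e k x) = \sum_k c k ^+ 2.
Proof.
have cL k : (fun x => c k * e k x) \in Lfun m 2%:E by exact: L2Z.
rewrite coef_suml//; last exact: L2_sum.
apply: eq_bigr => k _; rewrite coefC coef_suml// (bigD1 k)//= big1 ?addr0.
  by rewrite coefZl// coefC coefZl// eO eqxx mulr1 expr2.
by move=> l lk; rewrite coefZl// coefC coefZl// eO eq_sym (negbTE lk) !mulr0.
Qed.
End orthonormal.

(** * Counting eigenvalues *)

Section eigen_local.
Context (R : realType) (d : nat) (M : closedRiemannian R d).
Context (N : nat) (phi : 'I_N -> borel M -> R) (lam : 'I_N -> R).
Hypothesis sphi : forall k, smooth_fun (phi k : M -> R).
Hypothesis eig : forall k (i : chart_index M) x, cdom i x ->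
  - laplacian i (phi k) (chart i x) = lam k * phi k x.
Context (i : chart_index M).
Implicit Types c : 'I_N -> R.

Definition hphi k u := phi k (cinv i u).
Definition comb c (x : M) := \sum_k c k * phi k x.
Definition hcomb c u := \sum_k c k * hphi k u.
Definition Dhcomb c b u := \sum_k c k * partials [:: b] (hphi k) u.

Lemma C1on_hphi k : C1on (cimg i) (hphi k) (fun a => partials [:: a] (hphi k)).
Proof. exact: (@smooth_C1on _ _ _ _ [::] (sphi k i)). Qed.

Lemma C1on_Dhphi k b : C1on (cimg i) (partials [:: b] (hphi k)) (fun a => partials [:: a; b] (hphi k)).
Proof. exact: (@smooth_C1on _ _ _ _ [:: b] (sphi k i)). Qed.

Lemma C1onZ (U : set 'rV[R]_d) f Df (r : R) : C1on U f Df -> C1on U (fun u => r * f u) (fun a u => r * Df a u).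
Proof.
move=> Cf; refine (C1on_ext (C1onM (@C1on_cst _ _ U r) Cf) _ _) => // a u.
by rewrite mulr0 addr0.
Qed.

Lemma C1on_hcomb c : C1on (cimg i) (hcomb c) (Dhcomb c).
Proof. by apply: C1on_sum => k; apply: C1onZ; exact: C1on_hphi. Qed.

Definition flux k a u := \sum_b flux_coef i a b u * partials [:: b] (hphi k) u.

(** The eigenvalue equation multiplied by the density. Having the derivatives as explicit functions
    [DV] allows eigenfunctions of different eigenvalues to be combined linearly before any estimate
    is made. *)
Lemma flux_divergence k : exists DV : 'I_d -> 'I_d -> 'rV[R]_d -> R,
  (forall a, C1on (cimg i) (flux k a) (DV a)) /\
  (forall u, cimg i u -> \sum_a DV a a u = - (vol_density i u * (lam k * hphi k u))).
Proof.
have /choice[DV CDV] : forall a, exists D, C1on (cimg i) (flux k a) D.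
  move=> a; apply: hasC1_sum => b; apply: hasC1M; first exact: flux_coef_hasC1.
  by eexists; exact: C1on_Dhphi.
exists DV; split=> // u iu.
have [xi cx] := cimg_cinv iu.
have := eig k xi; rewrite cx /hphi => <-; rewrite mulrN opprK /laplacian mulrA.
rewrite mulfV ?gt_eqF ?vol_density_gt0// mul1r; apply: eq_bigr => a _.
rewrite /partials /=.
have [_ /(_ a)[Hd _]] := CDV a u iu.
rewrite -[LHS](@derive_val _ _ _ _ _ _ _ Hd); congr (derive _ _ _).
by apply/funext => w; rewrite /flux mulr_sumr; apply: eq_bigr => b _; rewrite mulrA.
Qed.

End eigen_local.

Section eigen_box.
Context (R : realType) (d : nat) (M : closedRiemannian R d) (i : chart_index M).
Context (lo : nat -> R) (H : R).
Hypotheses (H0 : 0 < H) (bU : box lo H `<=` cimg i).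

(** Poincare on the cells of the inner box, of mesh H/(2n), gives 1/n^2 times the energy there;
    Caccioppoli bounds this energy by u and its Laplacian on the full box. For a combination with
    coefficients c_k, minus the Laplacian has coefficients c_k lam_k. The constant does not depend
    on the family. *)
Lemma eigen_local_estimate : exists2 C : R, 0 <= C &
  forall (N : nat) (phi : 'I_N -> borel M -> R) (lam : 'I_N -> R),
  (forall k, smooth_fun (phi k : M -> R)) ->
  (forall k (i : chart_index M) x, cdom i x ->
    - laplacian i (phi k) (chart i x) = lam k * phi k x) ->
  forall (n : nat) (c : 'I_N -> R), (0 < n)%N ->
  (forall l, l \in grid d n (fun k => lo k + H / 4) (H / 2 / n%:R) ->
     \int[leb R d]_(z in ebox l (H / 2 / n%:R)) hcomb phi i c (pt z) = 0) ->
  (\int[leb R d]_(z in ebox (fun k => lo k + H / 4)%R (H / 2)) (hcomb phi i c (pt z) ^+ 2)%:E <=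
   (C / n%:R ^+ 2)%:E * \int[leb R d]_(z in ebox lo H)
     (hcomb phi i c (pt z) ^+ 2 + hcomb phi i (fun k => c k * lam k) (pt z) ^+ 2)%:E)%E.
Proof.
have [K K0 HK] := @poincare_grid R d.
have [kappa k0 ell] := flux_elliptic bU.
have cdens := cont_on_hasC1 bU (vol_density_hasC1 i).
have [C C0 HC] := caccioppoli H0 bU (flux_coef_hasC1 i) k0 ell cdens.
exists (K * (H / 2) ^+ 2 * C); first by rewrite mulr_ge0// mulr_ge0// sqr_ge0.
move=> N phi lam sphi eig n c n0 mean0.
have n0' : 0 < n%:R :> R by rewrite ltr0n.
have nsE : n%:R * (H / 2 / n%:R) = H / 2 by field; rewrite gt_eqF.
have s0 : 0 < H / 2 / n%:R by rewrite divr_gt0// divr_gt0.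
have inner := @box_inner_sub R d lo H H0.
have innU u : box (fun k => lo k + H / 4) (n%:R * (H / 2 / n%:R)) u -> cimg i u.
  by rewrite nsE => /inner /bU.
have := HK (fun k => lo k + H / 4) (H / 2 / n%:R) n (hcomb phi i c) (Dhcomb phi i c) s0.
rewrite nsE => HKs.
have cD a : cont_on (box (fun k => lo k + H / 4) (H / 2)) (Dhcomb phi i c a).
  by move=> u /inner /bU iu; have [_ /(_ a)[]] := C1on_hcomb sphi c iu.
apply: le_trans (HKs _ _ cD mean0) _.
- by move=> a u /inner /bU iu; have [_ /(_ a)[]] := C1on_hcomb sphi c iu.
- by move=> u /inner /bU iu; have [] := C1on_hcomb sphi c iu.
have /choice[DV HDV] := @flux_divergence _ _ _ _ _ _ sphi eig i.
have := HC (hcomb phi i c) (Dhcomb phi i c) (hcomb phi i (fun k => c k * lam k)) (fun a b u => \sum_k c k * DV k a b u)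
  (C1on_hcomb sphi c).
have cG : cont_on (box lo H) (hcomb phi i (fun k => c k * lam k)).
  by move=> u /bU iu; have [] := C1on_hcomb sphi (fun k => c k * lam k) iu.
have CV a : C1on (cimg i) (fun u => \sum_b flux_coef i a b u * Dhcomb phi i c b u)
    (fun b u => \sum_k c k * DV k a b u).
  have C1 := C1on_sum (index_enum 'I_N) (fun k => C1onZ (c k) ((HDV k).1 a)).
  refine (C1on_ext C1 _ _) => // u.
  rewrite /Dhcomb /flux; under eq_bigr do rewrite mulr_sumr.
  rewrite exchange_big/=; apply: eq_bigr => k _; rewrite mulr_sumr.
  by apply: eq_bigr => b _; rewrite mulrCA.
have PDE u : box lo H u -> \sum_a \sum_k c k * DV k a a u =
    - (vol_density i u * hcomb phi i (fun k => c k * lam k) u).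
  move=> /bU iu; rewrite exchange_big/= /hcomb mulr_sumr -sumrN; apply: eq_bigr => k _.
  by rewrite -mulr_sumr (HDV k).2//; ring.
move=> /(_ cG CV PDE) Hca.
rewrite -ge0_integral_sum//; first last.
- by move=> a z _; rewrite lee_fin sqr_ge0.
- by move=> a; apply: (@measurable_EFin_cont_on _ _ _ _ (fun u => Dhcomb phi i c a u ^+ 2)); exact: cont_on_sqr.
- exact: measurable_ebox.
under eq_integral do rewrite sumEFin.
have -> : ((K * (H / 2) ^+ 2 * C / n%:R ^+ 2)%:E = (K * (H / 2 / n%:R) ^+ 2)%:E * C%:E)%E.
  by rewrite -EFinM; congr EFin; field; rewrite gt_eqF.
rewrite -muleA; apply: lee_wpmul2l; last exact: Hca.
by rewrite lee_fin mulr_ge0// sqr_ge0.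
Qed.
End eigen_box.

(** * Covering the manifold by coordinate cubes *)

Section chart_boxes.
Context (R : realType) (d : nat) (M : closedRiemannian R d).

Lemma smooth_fun_continuous (f : M -> R) : smooth_fun f -> continuous f.
Proof.
move=> sf x; have [i ix] := cdom_cover x.
have iu : cimg i (chart i x) by exists x.
have [cf _] := @smooth_C1on _ _ _ _ [::] (sf i) (chart i x) iu.
have cc : {for x, continuous (chart i)} by apply: (@chart_continuous _ _ M i); exact/mem_set.
have c1 : {for x, continuous ((f \o cinv i) \o chart i)} by exact: continuous_comp.
have E : {near nbhs x, ((f \o cinv i) \o chart i) =1 f}.
  by apply: filterS (open_nbhs_nbhs (conj (cdom_open i) ix)) => y iy /=; rewrite chartK.
have fx : f x = ((f \o cinv i) \o chart i) x by rewrite /= chartK.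
rewrite /continuous_at fx; apply: cvg_trans c1; exact: near_eq_cvg.
Qed.

Lemma chart_box_ex (x : M) : exists q : chart_index M * (nat -> R) * R,
  [/\ 0 < q.2, box q.1.2 q.2 `<=` cimg q.1.1 &
    nbhs x (cbox q.1.1 (fun k => q.1.2 k + q.2 / 4) (q.2 / 2) : set M)].
Proof.
have [i ix] := cdom_cover x.
have iu : cimg i (chart i x) by exists x.
have /nbhs_ballP[e /= e0 eU] := open_nbhs_nbhs (conj (@cimg_open _ _ M i) iu).
pose u0 := chart i x.
(* The corner of the cube of side [e] centred at [u0]; indices beyond the dimension receive a dummy
   value. *)
pose lo (k : nat) : R := oapp (fun a : 'I_d => u0 ord0 a) 0 (insub k) - e / 2.
have loE (a : 'I_d) : lo a = u0 ord0 a - e / 2 by rewrite /lo valK.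
exists (i, lo, e); split => //= [u bu|].
  apply: eU; split=> // a b; rewrite ord1 -ball_normE /= ltr_norml.
  have := bu b; rewrite loE -/u0; set p := u0 _ _; set q := u _ _ => /andP[? ?].
  by apply/andP; split; lra.
have cc : {for x, continuous (chart i)} by apply: (@chart_continuous _ _ M i); exact/mem_set.
have e4 : 0 < e / 4 by rewrite divr_gt0.
have n1 : nbhs x [set y | ball u0 (e / 4) (chart i y)] := cc _ (nbhsx_ballx u0 (e / 4) e4).
have n2 : nbhs x (cdom i) := open_nbhs_nbhs (conj (cdom_open i) ix).
apply: filterS (filterI n1 n2) => y [[_ by1] iy].
exists (chart i y); last by rewrite chartK.
move=> a; have := by1 ord0 a; rewrite loE -ball_normE /= ltr_norml.
set p := u0 _ _; set q := chart i y _ _ => /andP[? ?].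
by apply/andP; split; lra.
Qed.

(** Compactness. The half-size inner boxes are made to cover, because the interior estimates control
    a function only there. *)
Lemma chart_box_cover : exists (m : nat) (ci : 'I_m -> chart_index M) (lo : 'I_m -> nat -> R) (H : 'I_m -> R),
  [/\ forall k, 0 < H k, forall k, box (lo k) (H k) `<=` cimg (ci k) &
    forall x : M, exists k, cbox (ci k) (fun a => lo k a + H k / 4) (H k / 2) x].
Proof.
have /choice[q qP] := chart_box_ex.
have := @carrier_compact _ _ M; rewrite compact_cover => /(_ M [set: M]
  (fun x => (cbox (q x).1.1 (fun k => (q x).1.2 k + (q x).2 / 4) ((q x).2 / 2) : set M)^°)).
case=> [y _|y _|D _ Dcov]; first exact: open_interior.
  by exists y => //; have [_ _] := qP y.
pose s : seq M := finmap.enum_fset D.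
exists (size s), (fun k => (q (tnth (in_tuple s) k)).1.1), (fun k => (q (tnth (in_tuple s) k)).1.2),
  (fun k => (q (tnth (in_tuple s) k)).2); split=> [k|k|x].
- by have [] := qP (tnth (in_tuple s) k).
- by have [] := qP (tnth (in_tuple s) k).
have [y yD yx] := Dcov x I.
have ys : y \in s by [].
have /tnthP[k yk] : y \in in_tuple s by [].
by exists k; rewrite -yk; exact: interior_subset yx.
Qed.

End chart_boxes.

Section counting.
Context (R : realType) (d : nat) (M : closedRiemannian R d).
Context (vol : probability (borel M) R) (hvol : is_normalized_volume vol).

Definition eigen_family N (phi : 'I_N -> borel M -> R) (lam : 'I_N -> R) :=
  [/\ forall k, smooth_fun (phi k : M -> R),
   forall k (i : chart_index M) x, cdom i x ->
    - laplacian i (phi k) (chart i x) = lam k * phi k x,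
   forall k, phi k \in Lfun vol 2%:E &
   forall k l, coef vol (phi k) (phi l) = (k == l)%:R].

Lemma measurable_comb N (phi : 'I_N -> borel M -> R) c :
  (forall k, phi k \in Lfun vol 2%:E) -> measurable_fun setT (comb phi c : borel M -> R).
Proof.
move=> pL; apply: (@L2_measurable _ _ _ vol).
by apply: (@L2_sum _ _ _ vol _ _ (fun k x => c k * phi k x) predT) => k _; exact: L2Z.
Qed.

Lemma local_vol_estimate (i : chart_index M) (lo : nat -> R) (H : R) :
  0 < H -> box lo H `<=` cimg i ->
  exists2 C : R, 0 <= C & forall N (phi : 'I_N -> borel M -> R) lam, eigen_family phi lam ->
  forall (n : nat) (c : 'I_N -> R), (0 < n)%N ->
  (forall l, l \in grid d n (fun k => lo k + H / 4) (H / 2 / n%:R) ->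
     \int[leb R d]_(z in ebox l (H / 2 / n%:R)) hcomb phi i c (pt z) = 0) ->
  (\int[vol]_(x in cbox i (fun k => lo k + H / 4)%R (H / 2)) (comb phi c x ^+ 2)%:E <=
   (C / n%:R ^+ 2)%:E * \int[vol]_x
     (comb phi c x ^+ 2 + comb phi (fun k => c k * lam k) x ^+ 2)%:E)%E.
Proof.
move=> H0 bU; have [C C0 HC] := eigen_local_estimate H0 bU.
have inner := @box_inner_sub R d lo H H0.
have H2 : 0 < H / 2 by rewrite divr_gt0.
have bU' : box (fun k => lo k + H / 4) (H / 2) `<=` cimg i by exact: subset_trans inner bU.
have [c0 c00 hc] := hvol.
have [k1 k10 Hk1] := vol_compare bU' hc c00.
have [k2 k20 Hk2] := vol_compare bU hc c00.
exists (k1 * C * k2); first by rewrite !mulr_ge0// ltW.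
move=> N phi lam [sphi eig pL _] n c n0 mean0.
have n2 : 0 <= (n%:R ^+ 2)^-1 :> R by rewrite invr_ge0 sqr_ge0.
pose f x := (comb phi c x ^+ 2)%:E.
pose g x := (comb phi c x ^+ 2 + comb phi (fun k => c k * lam k) x ^+ 2)%:E.
have mf : measurable_fun setT (f : borel M -> \bar R).
  by apply/measurable_EFinP; apply: measurable_funX; exact: measurable_comb.
have mg : measurable_fun setT (g : borel M -> \bar R).
  by apply/measurable_EFinP; apply: measurable_funD; apply: measurable_funX; exact: measurable_comb.
have f0 x : (0 <= f x)%E by rewrite lee_fin sqr_ge0.
have g0 x : (0 <= g x)%E by rewrite lee_fin addr_ge0// sqr_ge0.
apply: le_trans (Hk1 f mf f0).2 _.
have step : (\int[leb R d]_(z in ebox (fun k => lo k + H / 4)%R (H / 2)) f (cpt i z) <=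
  (C / n%:R ^+ 2)%:E * \int[leb R d]_(z in ebox lo H) g (cpt i z))%E.
  exact: (HC N phi lam sphi eig n c n0 mean0).
have step2 : (\int[leb R d]_(z in ebox lo H) g (cpt i z) <= k2%:E * \int[vol]_x g x)%E.
  apply: (@le_trans _ _ (k2%:E * \int[vol]_(x in cbox i lo H) g x)%E).
    have := (Hk2 g mg g0).1 => Hk.
    apply: (@le_trans _ _ (k2%:E * (k2^-1%:E * \int[leb R d]_(z in ebox lo H) g (cpt i z)))%E).
      by rewrite muleA -EFinM mulfV ?gt_eqF// mul1e.
    by apply: lee_wpmul2l => //; rewrite lee_fin ltW.
  apply: lee_wpmul2l; first by rewrite lee_fin ltW.
  apply: ge0_subset_integral => //; exact: measurable_cbox.
apply: (@le_trans _ _ (k1%:E * ((C / n%:R ^+ 2)%:E * (k2%:E * \int[vol]_x g x)))%E).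
  apply: lee_wpmul2l; first by rewrite lee_fin ltW.
  by apply: le_trans step _; apply: lee_wpmul2l; rewrite ?lee_fin ?mulr_ge0.
rewrite !muleA -!EFinM (_ : k1 * (C / n%:R ^+ 2) * k2 = k1 * C * k2 / n%:R ^+ 2)//; ring.
Qed.

Lemma ge0_integral_cover (m : nat) (Q : 'I_m -> set (borel M)) (g : borel M -> \bar R) :
  (forall k, measurable (Q k)) -> (forall x, exists k, Q k x) ->
  measurable_fun setT g -> (forall x, 0 <= g x)%E ->
  (\int[vol]_x g x <= \sum_k \int[vol]_(x in Q k) g x)%E.
Proof.
move=> mQ cQ mg g0.
have mgQ k : measurable_fun setT (g \_ (Q k)).
  by apply/(measurable_restrictT _ (mQ k)); exact: measurable_funS mg.
have gQ0 k x : (0 <= (g \_ (Q k)) x)%E by rewrite patchE; case: ifP.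
under eq_bigr do rewrite integral_mkcond.
rewrite -ge0_integral_sum//.
apply: ge0_le_integral => //.
  by apply: emeasurable_fun_sum.
move=> x _; have [k Qx] := cQ x.
rewrite (bigD1 k)//= patchE mem_set// leeDl//.
by apply: sume_ge0.
Qed.

Lemma Rintegral_seq_sum dX (X : measurableType dX) (mu : {measure set X -> \bar R})
    (D : set X) (I : Type) (s : seq I) (f : I -> X -> R) : measurable D ->
  (forall k, mu.-integrable D (EFin \o f k)) ->
  \int[mu]_(x in D) (\sum_(k <- s) f k x) = \sum_(k <- s) \int[mu]_(x in D) f k x.
Proof.
move=> mD fi.
have H t : mu.-integrable D (EFin \o (fun x => \sum_(k <- t) f k x)).
  elim: t => [|k t IH].
    have := @integrable0 _ _ _ mu D; apply: eq_integrable => // x _ /=.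
    by rewrite big_nil.
  have := integrableD mD (fi k) IH; apply: eq_integrable => // x _ /=.
  by rewrite big_cons EFinD.
elim: s => [|k s IH]; last first.
  rewrite big_cons -IH -RintegralD//; apply: eq_Rintegral => x _; by rewrite big_cons.
rewrite big_nil /Rintegral integral0_eq// => x _; by rewrite big_nil.
Qed.

Lemma exists_kernel_vector (N p : nat) (T : 'M[R]_(N, p)) : (p < N)%N ->
  exists2 c : 'rV[R]_N, c != 0 & c *m T = 0.
Proof.
move=> pN; have : kermx T != 0.
  rewrite kermx_eq0; apply/negP => /eqP rT.
  by have := rank_leq_col T; rewrite rT leqNgt pN.
by move=> /rowV0Pn[c /sub_kermxP cT c0]; exists c.
Qed.

(** There are m n^d conditions for m boxes and n cells per side, and n is of order (1 + L)^2, whence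
    the exponent 2 d. [K] depends only on the chosen boxes, not on the family. *)
Lemma eigen_count : exists (K : R), 0 <= K /\
  forall N (phi : 'I_N -> borel M -> R) lam (L : R), eigen_family phi lam -> 0 <= L ->
  (forall k, `|lam k| <= L) -> N%:R <= K * (1 + L) ^+ (2 * d).
Proof.
have [m [ci [lo [H [H0 bU cov]]]]] := chart_box_cover M.
have /choice[C HC] : forall k, exists C, 0 <= C /\ _ := fun k =>
  let: ex_intro2 C C0 HC := local_vol_estimate (H0 k) (bU k) in ex_intro _ C (conj C0 HC).
pose C1 := \sum_k C k.
have C10 : 0 <= C1 by apply: sumr_ge0 => k _; exact: (HC k).1.
exists (m%:R * (C1 + 1) ^+ d); split.
  by rewrite mulr_ge0// exprn_ge0// addr_ge0.
move=> N phi lam L ef L0 lamL.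
(* Chosen so that C1 (1 + L^2) < n <= n^2, against the bound n^2 <= C1 (1 + L^2) that too many
   eigenfunctions would force. *)
pose n := (Num.truncn (C1 * (1 + L ^+ 2))).+1.
have B0 : 0 <= C1 * (1 + L ^+ 2) by rewrite mulr_ge0// addr_ge0// sqr_ge0.
have n_gt : C1 * (1 + L ^+ 2) < n%:R by rewrite /n truncnS_gt.
have n_le : n%:R <= (C1 + 1) * (1 + L) ^+ 2.
  rewrite /n -natr1; apply: (@le_trans _ _ (C1 * (1 + L ^+ 2) + 1)).
    by rewrite lerD2r; have /andP[] := truncn_itv B0.
  rewrite mulrDl mul1r; apply: lerD.
    by apply: ler_wpM2l => //; rewrite sqrrD expr1n !mul1r addrAC lerDl mulrn_wge0.
  by rewrite expr2 -[leLHS]mulr1; apply: ler_pM => //; rewrite lerDl.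
have n1 : 1 <= n%:R :> R by rewrite ler1n.
have key : (N <= m * n ^ d)%N.
  rewrite leqNgt; apply/negP => mN.
  pose gr k := grid d n (fun a => lo k a + H k / 4) (H k / 2 / n%:R).
  (* The integrals of the j-th eigenfunction over all cells of all boxes; flattened by [mxvec], they
     are row j of a matrix with m n^d columns. *)
  pose A (j : 'I_N) : 'M[R]_(m, n ^ d) := \matrix_(k, l)
    \int[leb R d]_(z in ebox (nth (fun=> 0) (gr k) l) (H k / 2 / n%:R)) hphi phi (ci k) j (pt z).
  have [v v0 vT] := exists_kernel_vector (\matrix_j mxvec (A j)) mN.
  pose c k := v ord0 k.
  have [sphi eig pL pO] := ef.
  have mean0 k l : l \in gr k ->
      \int[leb R d]_(z in ebox l (H k / 2 / n%:R)) hcomb phi (ci k) c (pt z) = 0.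
    move=> lg; have s0 : 0 < H k / 2 / n%:R by rewrite divr_gt0 ?divr_gt0// (lt_le_trans _ n1).
    have sub : box l (H k / 2 / n%:R) `<=` cimg (ci k).
      apply: subset_trans (bU k); apply: subset_trans (@box_inner_sub R d (lo k) (H k) (H0 k)).
      have := box_grid_sub (ltW s0) lg.
      by rewrite (_ : n%:R * _ = H k / 2)//; field; rewrite gt_eqF// (lt_le_trans _ n1).
    have il : (index l (gr k) < n ^ d)%N by rewrite -(size_grid d n (fun a => lo k a + H k / 4) (H k / 2 / n%:R)) index_mem.
    have := congr1 (fun w : 'rV[R]_(m * n ^ d) => w ord0 (mxvec_index k (Ordinal il))) vT.
    rewrite [in RHS]mxE [in LHS]mxE => E; rewrite -[RHS]E.
    have ch j : cont_on (box l (H k / 2 / n%:R)) (hphi phi (ci k) j).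
      by move=> u /sub iu; have [] := C1on_hphi sphi j iu.
    have mBl : measurable (@ebox R d l (H k / 2 / n%:R)) by exact: measurable_ebox.
    rewrite /hcomb Rintegral_seq_sum//; last first.
      move=> j; exact: (integrable_cont_on (ltW s0) (cont_onM (@cont_on_cst R d _ (c j)) (ch j))).
    apply: eq_bigr => j _; rewrite [X in _ = _ * X]mxE mxvecE [X in _ = _ * X]mxE /= nth_index//.
    by rewrite RintegralZl//; exact: (integrable_cont_on (ltW s0) (ch j)).
  have sqE b : (\int[vol]_x (comb phi b x ^+ 2)%:E = (\sum_k b k ^+ 2)%:E)%E.
    rewrite -(coef_comb_sqr pL pO) coef_sqr//.
    by apply: (@L2_sum _ _ _ vol _ _ (fun k x => b k * phi k x) predT) => k _; exact: L2Z.
  pose S := \sum_k c k ^+ 2.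
  have S0 : 0 < S.
    rewrite lt_neqAle; apply/andP; split; last by apply: sumr_ge0 => k _; exact: sqr_ge0.
    apply: contraNneq v0 => S0; apply/eqP/rowP => k; rewrite mxE; apply/eqP.
    rewrite -sqrf_eq0; apply/eqP.
    have /eqP := esym S0; rewrite psumr_eq0; last by move=> *; exact: sqr_ge0.
    by move=> /allP/(_ k); rewrite mem_index_enum => /(_ isT)/eqP.
  pose g x := (comb phi c x ^+ 2 + comb phi (fun k => c k * lam k) x ^+ 2)%:E.
  have mc b : measurable_fun setT (fun x : borel M => (comb phi b x ^+ 2)%:E : \bar R).
    by apply/measurable_EFinP; apply: measurable_funX; exact: measurable_comb.
  have gE : (\int[vol]_x g x <= (S * (1 + L ^+ 2))%:E)%E.
    rewrite /g; under eq_integral do rewrite EFinD.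
    rewrite ge0_integralD//; try by move=> x _; rewrite lee_fin sqr_ge0.
    rewrite !sqE -EFinD lee_fin mulrDr mulr1 lerD2l mulr_suml; apply: ler_sum => k _.
    rewrite exprMn ler_wpM2l ?sqr_ge0// -(real_normK (num_real (lam k))) !expr2.
    by apply: ler_pM.
  have : (S%:E <= (C1 / n%:R ^+ 2)%:E * (S * (1 + L ^+ 2))%:E)%E.
    rewrite -(sqE c); apply: le_trans (@ge0_integral_cover m
      (fun k => cbox (ci k) (fun a => lo k a + H k / 4) (H k / 2)) _ _ cov (mc c) _) _.
    - move=> k; apply: measurable_cbox; apply: subset_trans (bU k).
      exact: (@box_inner_sub R d (lo k) (H k) (H0 k)).
    - by move=> x; rewrite lee_fin sqr_ge0.
    apply: (@le_trans _ _ (\sum_k (C k / n%:R ^+ 2)%:E * (S * (1 + L ^+ 2))%:E)%E).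
      apply: lee_sum => k _.
      have /le_trans := (HC k).2 N phi lam ef n c isT (mean0 k); apply.
      apply: lee_wpmul2l gE; rewrite lee_fin divr_ge0 ?sqr_ge0//; exact: (HC k).1.
    move: (S * _) => B; rewrite -EFinM /C1 2!mulr_suml -sumEFin.
    by apply: lee_sum => k _; rewrite -EFinM.
  rewrite -EFinM lee_fin => Hle.
  have : n%:R ^+ 2 <= C1 * (1 + L ^+ 2).
    have np : 0 < n%:R ^+ 2 :> R by rewrite exprn_gt0// (lt_le_trans _ n1).
    have : S * n%:R ^+ 2 <= S * (C1 * (1 + L ^+ 2)).
      rewrite -ler_pdivlMr//; apply: le_trans Hle _.
      by rewrite le_eqVlt; apply/orP; left; apply/eqP; ring.
    by rewrite ler_pM2l.
  apply/negP; rewrite -ltNge; apply: lt_le_trans n_gt _.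
  by rewrite expr2 -[leLHS]mulr1 ler_pM.
apply: (@le_trans _ _ (m * n ^ d)%:R); first by rewrite ler_nat.
rewrite natrM natrX -mulrA ler_wpM2l// exprM -exprMn.
by apply: lerXn2r; rewrite ?nnegrE// mulr_ge0 ?exprn_ge0 ?addr_ge0.
Qed.

End counting.

(** * Nonnegativity of the eigenvalues *)

Section maximum.
Context (R : realType) (d : nat).
Implicit Types (U : set 'rV[R]_d) (f : 'rV[R]_d -> R).

(** The mean value theorem on the segment, with the continuity of the partial derivative at [u]. The
    estimate is uniform in the base point [p] near [u], which is what permits changing one
    coordinate after another. *)
Lemma coordinate_increment U f Df u (a : 'I_d) e : open U -> C1on U f Df -> U u -> 0 < e ->
  exists2 r, 0 < r & forall p s, ball u r p -> ball u r (s *: delta_mx ord0 a + p) ->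
    `|f (s *: delta_mx ord0 a + p) - f p - s * Df a u| <= e * `|s|.
Proof.
move=> oU Cf Uu e0.
have [_ /(_ a)[_ ca]] := Cf u Uu.
have FF := nbhs_filter u.
have caE : \forall w \near u, ball (Df a u) e (Df a w) by exact: (ca _ (nbhsx_ballx _ _ e0)).
have : nbhs u [set p | U p /\ ball (Df a u) e (Df a p)].
  by apply: filterI; [exact: (open_nbhs_nbhs (conj oU Uu))|exact: caE].
move=> /nbhs_ballP[r /= r0 Hr]; exists r => // p s bp bq.
have seg th : 0 <= th <= 1 -> ball u r ((th * s) *: delta_mx ord0 a + p).
  move=> /andP[th0 th1]; split=> // i j; have [_ bp'] := bp; have [_ bq'] := bq.
  have := bp' ord0 j; have := bq' ord0 j; rewrite (ord1 i) -!ball_normE /= !scaleaddE !mxE !eqxx/=.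
  have [->|ja] := eqVneq j a; last by rewrite !mulr0 !add0r.
  rewrite !mulr1; set x := u _ _; set y := p _ _; rewrite !ltr_norml => /andP[? ?] /andP[? ?].
  have [s0|s0] := leP 0 s.
    have ts : th * s <= s by rewrite -[leRHS]mul1r ler_wpM2r.
    have ts0 : 0 <= th * s by rewrite mulr_ge0.
    by move: (th * s) ts ts0 => q *; apply/andP; split; lra.
  have ts : s <= th * s.
    have : 0 <= (th - 1) * s by apply: mulr_le0; [rewrite subr_le0|exact: ltW].
    by rewrite mulrBl mul1r subr_ge0.
  have ts0 : th * s <= 0 by apply: mulr_ge0_le0 => //; exact: ltW.
  by move: (th * s) ts ts0 => q *; apply/andP; split; lra.
pose g (th : R) := f ((th * s) *: delta_mx ord0 a + p).
have dg th : 0 <= th <= 1 -> is_derive (th : R) (1 : R) g (s * Df a ((th * s) *: delta_mx ord0 a + p)).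
  move=> /seg/Hr[Uq _]; have [_ /(_ a)[dfa _]] := Cf _ Uq.
  have d1 : is_derive (th * s : R) (1 : R) (fun t : R => f (t *: delta_mx ord0 a + p))
      (Df a ((th * s) *: delta_mx ord0 a + p)).
    apply: (@is_derive_comp_affine _ _ _ f (fun t : R => t *: delta_mx ord0 a + p)) dfa => t.
    by rewrite scaler1 scalerDl addrA.
  have d2 : is_derive (th : R) (1 : R) (fun th : R => th * s) s.
    by apply: is_derive_eq; rewrite !(scaler0, add0r, addr0) /GRing.scale/= mulr1.
  by have := @is_derive1_comp R _ (fun t : R => t * s) th _ _ d1 d2; rewrite [X in is_derive _ _ _ X]mulrC.
have [||c c01 E] := @MVT_segment R g (fun th => s * Df a ((th * s) *: delta_mx ord0 a + p)) 0 1 ler01.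
- by move=> th; rewrite in_itv/= => /andP[? ?]; apply: dg; rewrite !ltW.
- apply: continuous_in_subspaceT => th /set_mem; rewrite /= in_itv/= => /dg.
  exact: is_derive1_continuous.
move: c01; rewrite in_itv/= => /seg/Hr[_]; rewrite -ball_normE /= => /ltW Hc.
move: E; rewrite /g mul1r mul0r scale0r add0r subr0 mulr1 => ->.
by rewrite -mulrBr normrM mulrC ler_wpM2r// distrC.
Qed.

(** The classical proof that continuous partial derivatives give differentiability: the increment is
    split into moves along single coordinates, by induction on the list of coordinates already
    moved. *)
Lemma directional_increment U f Df u (v : 'rV[R]_d) e : open U -> C1on U f Df -> U u -> 0 < e ->
  exists2 r, 0 < r & forall t, `|t| < r ->
    `|f (t *: v + u) - f u - t * \sum_a v ord0 a * Df a u| <= e * `|t|.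
Proof.
move=> oU Cf Uu e0.
pose part (l : seq 'I_d) : 'rV[R]_d := \sum_(a <- l) v ord0 a *: delta_mx ord0 a.
have claim (l : seq 'I_d) e' : 0 < e' -> exists2 r, 0 < r & forall t, `|t| < r ->
    `|f (t *: part l + u) - f u - t * \sum_(a <- l) v ord0 a * Df a u| <= e' * `|t|.
  elim: l e' => [|a l IH] e' e'0.
    exists 1 => // t _; rewrite /part !big_nil scaler0 add0r subrr mulr0 subr0 normr0.
    by rewrite mulr_ge0// ltW.
  have e2 : 0 < e' / 2 by rewrite divr_gt0.
  have [r1 r10 H1] := IH _ e2.
  (* Dividing the error by |v_a| + 1 keeps the contribution of this coordinate below (e'/2) |t|,
     also when v_a = 0. *)
  pose k := `|v ord0 a| + 1; have k0 : 0 < k by rewrite ltr_wpDl.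
  have ek : 0 < e' / 2 / k by rewrite divr_gt0.
  have [r2 r20 H2] := coordinate_increment a oU Cf Uu ek.
  have small (w : 'rV[R]_d) : exists2 r, 0 < r & forall t, `|t| < r -> ball u r2 (t *: w + u).
    exists (r2 / (`|w| + 1)); first by rewrite divr_gt0// ltr_wpDl.
    move=> t tr; rewrite -ball_normE /= opprD addrCA subrr addr0 normrN normrZ.
    apply: (@le_lt_trans _ _ (`|t| * (`|w| + 1))); first by rewrite ler_wpM2l// lerDl.
    by rewrite -ltr_pdivlMr// ltr_wpDl.
  have [r3 r30 H3] := small (part l); have [r4 r40 H4] := small (part (a :: l)).
  exists (Num.min r1 (Num.min r3 r4)); first by rewrite !lt_min r10 r30.
  move=> t; rewrite !lt_min => /and3P[t1 t3 t4].
  have pE : t *: part (a :: l) + u = (t * v ord0 a) *: delta_mx ord0 a + (t *: part l + u).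
    by rewrite /part big_cons scalerDr scalerA addrA.
  have b4 := H4 t t4; rewrite pE in b4 *.
  have := H2 _ _ (H3 t t3) b4; have := H1 t t1; rewrite big_cons.
  set F0 := f u; set F1 := f (t *: part l + u); set F2 := f _ => A1 A2.
  have -> : F2 - F0 - t * (v ord0 a * Df a u + \sum_(j <- l) v ord0 j * Df j u) =
    (F2 - F1 - t * v ord0 a * Df a u) + (F1 - F0 - t * \sum_(j <- l) v ord0 j * Df j u) by ring.
  apply: le_trans (ler_normD _ _) _.
  rewrite [e' in leRHS]splitr mulrDl; apply: lerD => //; apply: le_trans A2 _.
  have kv : k^-1 * `|v ord0 a| <= 1 by rewrite ler_pdivrMl// mulr1 /k lerDl.
  rewrite normrM (mulrC `|t|) mulrA ler_wpM2r// -(mulrA (e' / 2)).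
  by apply: ler_piMr => //; exact: ltW.
have [r r0 H] := claim (index_enum 'I_d) e e0; exists r => // t tr.
have := H t tr; rewrite (_ : part _ = v)//.
by rewrite [RHS]row_sum_delta.
Qed.

Lemma C1on_directional U f Df u (v : 'rV[R]_d) : open U -> C1on U f Df -> U u ->
  is_derive u v f (\sum_a v ord0 a * Df a u).
Proof.
move=> oU Cf Uu.
have H : (fun h : R => h^-1 *: ((f \o shift u) (h *: v) - f u)) h @[h --> 0^'] --> \sum_a v ord0 a * Df a u.
  apply/cvgrPdist_le => e e0; have [r r0 Hr] := directional_increment v oU Cf Uu e0.
  exists r => //= t; rewrite /= sub0r normrN => tr t0.
  rewrite distrC /GRing.scale/=.
  have -> : t^-1 * (f (t *: v + u) - f u) - \sum_a v ord0 a * Df a u =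
     t^-1 * (f (t *: v + u) - f u - t * \sum_a v ord0 a * Df a u).
    by rewrite [RHS]mulrBr [in RHS]mulrA mulVf// mul1r.
  rewrite normrM normfV ler_pdivrMl ?normr_gt0// [leRHS]mulrC; exact: Hr.
split; first by apply/cvg_ex; exists (\sum_a v ord0 a * Df a u).
exact: cvg_lim H.
Qed.
Section at_maximum.
Context (U : set 'rV[R]_d) (F : 'rV[R]_d -> R) (DF : 'I_d -> 'rV[R]_d -> R).
Context (D2 : 'I_d -> 'I_d -> 'rV[R]_d -> R) (u0 : 'rV[R]_d).
Hypotheses (oU : open U) (CF : C1on U F DF) (CDF : forall b, C1on U (DF b) (D2 b)).
Hypotheses (Uu0 : U u0) (Fmax : forall u, U u -> F u <= F u0).

Lemma line_in_open (v : 'rV[R]_d) : exists2 r, 0 < r & forall t, `|t| < r -> U (t *: v + u0).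
Proof.
have /nbhs_ballP[e /= e0 He] := open_nbhs_nbhs (conj oU Uu0).
exists (e / (`|v| + 1)); first by rewrite divr_gt0// ltr_wpDl.
move=> t tr; apply: He; rewrite -ball_normE /= opprD addrCA subrr addr0 normrN normrZ.
apply: (@le_lt_trans _ _ (`|t| * (`|v| + 1))); first by rewrite ler_wpM2l// lerDl.
by rewrite -ltr_pdivlMr// ltr_wpDl.
Qed.

Lemma grad_max_eq0 (v : 'rV[R]_d) : \sum_a v ord0 a * DF a u0 = 0.
Proof.
set L := \sum_a _; apply: contrapT => /eqP L0.
have L0' : 0 < `|L| / 2 by rewrite divr_gt0// normr_gt0.
have [r1 r10 H1] := directional_increment v oU CF Uu0 L0'.
have [r2 r20 H2] := line_in_open v.
pose t := Num.sg L * (Num.min r1 r2 / 2).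
have m0 : 0 < Num.min r1 r2 / 2 by rewrite divr_gt0// lt_min r10.
have tN : `|t| = Num.min r1 r2 / 2 by rewrite normrM normr_sg L0 mul1r gtr0_norm.
have tm : `|t| < Num.min r1 r2.
  by rewrite tN; have : 0 < Num.min r1 r2 by [rewrite lt_min r10]; lra.
move: tm; rewrite lt_min => /andP[t1 t2].
have := H1 t t1; rewrite -/L ler_norml => /andP[Hl _].
have tL : t * L = `|t| * `|L|.
  by rewrite tN /t mulrAC -normrEsg mulrC.
have := Fmax (H2 t t2).
rewrite tL in Hl; rewrite leNgt => /negP; apply; rewrite -subr_gt0.
have : 0 < `|t| * `|L| / 2.
  by apply: divr_gt0 => //; apply: mulr_gt0; [rewrite tN|rewrite normr_gt0].
move: Hl; rewrite (mulrAC _ 2^-1) (mulrC `|L|).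
set q := `|t| * `|L|; move=> Hl q0; lra.
Qed.

(** If the second derivative along [v] were positive, the directional derivative [Q], zero at the
    maximum, would be positive just after it, and F would increase along the ray by the mean value
    theorem. Only a first-order expansion of [Q] is needed. *)
Lemma hess_max_le0 (v : 'rV[R]_d) : \sum_a \sum_b v ord0 a * v ord0 b * D2 b a u0 <= 0.
Proof.
set S := \sum_a _; rewrite leNgt; apply/negP => S0.
have S2 : 0 < S / 2 by rewrite divr_gt0.
pose Q u := \sum_b v ord0 b * DF b u.
have CQ : C1on U Q (fun a u => \sum_b v ord0 b * D2 b a u).
  by apply: C1on_sum => b; apply: C1onZ; exact: CDF.
have [r1 r10 H1] := directional_increment v oU CQ Uu0 S2.
have [r2 r20 H2] := line_in_open v.
pose t := Num.min r1 r2 / 2.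
have t0 : 0 < t by rewrite divr_gt0// lt_min r10.
have tm : t < Num.min r1 r2.
  by rewrite /t; have : 0 < Num.min r1 r2 by [rewrite lt_min r10]; lra.
move: tm; rewrite lt_min => /andP[t1 t2].
have SE : \sum_a v ord0 a * \sum_b v ord0 b * D2 b a u0 = S.
  by apply: eq_bigr => a _; rewrite mulr_sumr; apply: eq_bigr => b _; rewrite mulrA.
have Qpos s : 0 < s -> s <= t -> 0 < Q (s *: v + u0).
  move=> s0 st; have sr : `|s| < r1 by rewrite gtr0_norm// (le_lt_trans st).
  have := H1 s sr; rewrite SE (gtr0_norm s0) ler_norml => /andP[Hl _].
  have Q0 : Q u0 = 0 by exact: grad_max_eq0.
  have : 0 < s * S by rewrite mulr_gt0.
  move: Hl; rewrite Q0 subr0 mulrAC (mulrC S); set q := s * S => *; lra.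
pose g s := F (s *: v + u0).
have dg s : 0 <= s <= t -> is_derive (s : R) (1 : R) g (Q (s *: v + u0)).
  move=> /andP[s0 st]; have Us : U (s *: v + u0).
    by apply: H2; rewrite ger0_norm// (le_lt_trans st).
  apply: (@is_derive_comp_affine _ _ _ F (fun t : R => t *: v + u0)) (C1on_directional v oU CF Us) => t'.
  by rewrite scaler1 scalerDl addrA.
have [||c c01 E] := @MVT R g (fun s => Q (s *: v + u0)) 0 t t0.
- by move=> s; rewrite in_itv/= => /andP[? ?]; apply: dg; rewrite !ltW.
- apply: continuous_in_subspaceT => s /set_mem; rewrite /= in_itv/= => /dg.
  exact: is_derive1_continuous.
move: c01; rewrite in_itv/= => /andP[c0 ct].
have := Fmax (H2 t _); rewrite (gtr0_norm t0) => /(_ t2).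
move: E; rewrite /g scale0r add0r subr0 => E.
apply/negP; rewrite -ltNge -subr_gt0 E mulr_gt0// Qpos//; exact: ltW.
Qed.

(** With P = B B^T, the sum is that of the second derivatives along the columns of [B], each
    nonpositive. *)
Lemma trace_hess_max_le0 (P : 'M[R]_d) : P^T = P -> posdef P ->
  \sum_a \sum_b P a b * D2 b a u0 <= 0.
Proof.
move=> Ps Pp; have [B PB] := cholesky Ps Pp.
have -> : \sum_a \sum_b P a b * D2 b a u0 =
    \sum_k \sum_a \sum_b (row k B^T) ord0 a * (row k B^T) ord0 b * D2 b a u0.
  rewrite [RHS]exchange_big/=; apply: eq_bigr => a _; rewrite exchange_big/=; apply: eq_bigr => b _.
  rewrite -mulr_suml PB mxE; congr (_ * _); apply: eq_bigr => k _.
  by rewrite !mxE.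
by apply: sumr_le0 => k _; exact: hess_max_le0.
Qed.
End at_maximum.
End maximum.

Section eigenvalue_ge0.
Context (R : realType) (d : nat) (M : closedRiemannian R d).

(** At a maximum of |phi|, after multiplying by the sign there, the Laplacian reduces to the trace
    of the Hessian against the inverse metric, which is nonpositive, while the equation makes it -
    lam |phi(x0)|. *)
Lemma eigenvalue_ge0 (phi : borel M -> R) (lam : R) :
  smooth_fun (phi : M -> R) ->
  (forall (i : chart_index M) x, cdom i x -> - laplacian i phi (chart i x) = lam * phi x) ->
  (exists x, phi x != 0) -> 0 <= lam.
Proof.
move=> sphi eig [y y0].
have cphi := smooth_fun_continuous sphi.
have [|||x0 _ xmax] := @compact_EVT_max M R (fun x => `|phi x|) setT.
- by exists y.
- exact: carrier_compact.
- by apply: continuous_subspaceT => x; apply: continuous_comp; [exact: cphi|exact: norm_continuous].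
have {}xmax x : `|phi x| <= `|phi x0| by apply: xmax; rewrite inE.
have p0 : 0 < `|phi x0| by apply: lt_le_trans (xmax y); rewrite normr_gt0.
have [i ix] := cdom_cover x0.
pose u0 := chart i x0; have iu : cimg i u0 by exists x0.
pose ep := Num.sg (phi x0).
(* A family with one member, so that the statements about families apply. *)
pose ph (k : 'I_1) := phi; pose lm (k : 'I_1) := lam.
have sph k : smooth_fun (ph k : M -> R) by [].
have egh k (i' : chart_index M) x : cdom i' x -> - laplacian i' (ph k) (chart i' x) = lm k * ph k x.
  exact: eig.
pose f := hphi ph i ord0.
have Cf : C1on (cimg i) f (fun a => partials [:: a] f) := C1on_hphi sph ord0.
have CDf b : C1on (cimg i) (partials [:: b] f) (fun a => partials [:: a; b] f) := C1on_Dhphi sph ord0 b.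
have CF := C1onZ ep Cf; have CDF b := C1onZ ep (CDf b).
have oU := @cimg_open _ _ M i.
have fx0 : f u0 = phi x0 by rewrite /f /hphi /u0 chartK.
have Fmax u : cimg i u -> ep * f u <= ep * f u0.
  move=> _; rewrite fx0 -normrEsg; apply: le_trans (ler_norm _) _; rewrite normrM normr_sg.
  by apply: le_trans (xmax (cinv i u)); rewrite ler_piMl// lern1 leq_b1.
have gr b : partials [:: b] f u0 = 0.
  have := grad_max_eq0 oU CF iu Fmax (delta_mx ord0 b).
  rewrite (bigD1 b)//= mxE !eqxx mul1r big1 ?addr0; last first.
    by move=> a ab; rewrite mxE (negbTE ab) andbF mul0r.
  by move/eqP; rewrite mulf_eq0 sgr_eq0 -normr_eq0 gt_eqF//= => /eqP.
have sy := cmet_sym iu; have pd := cmet_posdef iu.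
have iT : (invmx (cmet i u0))^T = invmx (cmet i u0) by rewrite trmx_inv sy.
have Htr := trace_hess_max_le0 oU CF CDF iu Fmax iT (posdef_inv sy pd).
have [DV [CDV HDV]] := flux_divergence sph egh i ord0.
(* The gradient vanishes at [u0], so the derivatives of the metric coefficients drop out. *)
have DVE a : DV a a u0 = \sum_b flux_coef i a b u0 * partials [:: a; b] f u0.
  have [_ /(_ a)[Hd _]] := CDV a u0 iu.
  have /choice[Dh CDh] := fun b => flux_coef_hasC1 i a b.
  have Cfl := C1on_sum (index_enum 'I_d) (fun b => C1onM (CDh b) (CDf b)).
  have [_ /(_ a)[Hd2 _]] := Cfl u0 iu.
  rewrite -(@derive_val _ _ _ _ _ _ _ Hd) (@derive_val _ _ _ _ _ _ _ Hd2).
  by apply: eq_bigr => b _; rewrite gr mul0r addr0.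
have := HDV u0 iu; under eq_bigr do rewrite DVE.
have -> : \sum_a \sum_b flux_coef i a b u0 * partials [:: a; b] f u0 =
   vol_density i u0 * \sum_a \sum_b invmx (cmet i u0) a b * partials [:: a; b] f u0.
  rewrite mulr_sumr; apply: eq_bigr => a _; rewrite mulr_sumr; apply: eq_bigr => b _.
  by rewrite /flux_coef mulrA.
rewrite -mulrN => /(mulfI _) H.
have v0 := vol_density_gt0 iu.
have {}H := H (lt0r_neq0 v0).
have HE : \sum_a \sum_b invmx (cmet i u0) a b * (ep * partials [:: a; b] f u0) =
    ep * \sum_a \sum_b invmx (cmet i u0) a b * partials [:: a; b] f u0.
  rewrite mulr_sumr; apply: eq_bigr => a _; rewrite mulr_sumr; apply: eq_bigr => b _.
  by rewrite mulrCA.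
rewrite HE H -/f fx0 mulrN mulrCA -normrEsg oppr_le0 pmulr_lge0// in Htr.
Qed.
End eigenvalue_ge0.

(** * Joint measurability of random compositions *)

Section compact_neighbourhood.
Context (R : realType).

Lemma compact_ball_sub (V : pseudoMetricType R) (K O : set V) : compact K -> open O -> K `<=` O ->
  exists2 e : R, 0 < e & forall x, K x -> ball x e `<=` O.
Proof.
move=> /compact_near_coveringP cK oO KO.
have H x : K x -> \forall x' \near x & e \near (0 : R)^'+, ball x' e `<=` O.
  move=> /KO Ox; have /nbhs_ballP[r /= r0 rO] := open_nbhs_nbhs (conj oO Ox).
  have r2 : 0 < r / 2 by rewrite divr_gt0.
  exists (ball x (r / 2), [set e | e < r / 2]).
    by split; [exact: nbhsx_ballx|exact: nbhs_right_lt].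
  move=> [x' e] [/= bx' er] y bx'y; apply: rO.
  by rewrite (splitr r); apply: (ball_triangle bx'); apply: le_ball bx'y; exact: ltW.
have C := cK _ _ _ (@at_right_proper_filter R 0) H.
have /filter_ex[e [/= e0 eK]] := @filterI _ _ (@at_right_proper_filter R 0) _ _ (nbhs_right_gt (0 : R)) C.
by exists e.
Qed.
End compact_neighbourhood.

Section evaluation.
Context (R : realType) (d : nat) (M : closedRiemannian R d).
Context (vol : probability (borel M) R) (r : option nat).

(** The chart image of f(K) is compact inside an open set, so a uniform margin [e] separates it from
    the complement; maps that are [e]-close to f on K still send K into V. *)
Lemma open_maps_compact_to (i j : chart_index M) (K V : set M) :
  compact K -> K `<=` cdom i -> open V -> V `<=` cdom j ->
  open [set f : diffVol vol r | f @` K `<=` V].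
Proof.
move=> cK Ki oV Vj; rewrite openE => f /= fKV.
have [cf _] := diffVol_class f.
have oCV : open (chart j @` V).
  have -> : chart j @` V = cimg j `&` cinv j @^-1` V.
    apply/seteqP; split=> [_ [x Vx <-]|u [ju Vu]].
      by split; [exists x => //; exact: Vj|rewrite /preimage /= chartK//; exact: Vj].
    by exists (cinv j u) => //; exact: (cimg_cinv ju).2.
  rewrite openE => u [ju Vu].
  have n1 : nbhs u (cimg j) := open_nbhs_nbhs (conj (@cimg_open _ _ M j) ju).
  have n2 : nbhs u (cinv j @^-1` V).
    by apply: (@cinv_continuous _ _ M j); [exact/mem_set|exact: (open_nbhs_nbhs (conj oV Vu))].
  have FF := nbhs_filter u; exact: filterI n1 n2.
have cI : compact ((chart j \o f) @` K).
  apply: continuous_compact => //; apply: continuous_in_subspaceT => x /set_mem Kx.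
  apply: continuous_comp; first exact: cf.
  by apply: (@chart_continuous _ _ M j); apply/mem_set; apply: Vj; apply: fKV; exists x.
have IV : (chart j \o f) @` K `<=` chart j @` V.
  by move=> _ [x Kx <-]; exists (f x) => //; apply: fKV; exists x.
have [e e0 He] := compact_ball_sub cI oCV IV.
(* A subbasic neighbourhood of order 0: the empty list of derivatives is the only one tested, so it
   is available whatever the regularity [r]. *)
pose N := [set g : diffVol vol r | g @` K `<=` cdom j /\
       forall (l : seq 'I_d) (a : 'I_d) (x : M), (size l <= 0)%N -> K x ->
         `|partials l (local_coord i j g a) (chart i x)
           - partials l (local_coord i j f a) (chart i x)| < e].
have fN : N f.
  split; first by move=> y /fKV /Vj.
  by move=> l a x _ _; rewrite subrr normr0.
have NO : open N.
  exists [set N]; last by rewrite bigcup_set1.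
  move=> _ ->; apply: finI_from1.
  exists f, i, j, K, 0%N, e; split; first by split=> // y /fKV /Vj.
  by split => //; case: (r).
have NS : N `<=` [set f : diffVol vol r | f @` K `<=` V].
  move=> g [gj gd] _ [x Kx <-].
  have gjx : cdom j (g x) by apply: gj; exists x.
  have : (chart j @` V) (chart j (g x)).
    apply: (He (chart j (f x))); first by exists x.
    split=> // a b; rewrite ord1.
    have := gd [::] b x (leqnn _) Kx; rewrite /= /local_coord chartK ?Ki//; last exact: Ki.
    by rewrite -ball_normE /= distrC.
  by move=> [y Vy E]; rewrite -(chartK gjx) -E chartK//; exact: Vj.
by apply: filterS NS _; exact: (open_nbhs_nbhs (conj NO fN)).
Qed.

(** Images of small grid cells, cut down to the inner boxes of a finite cover. They act as a
    countable base made of compact sets, each in a chart domain, which is the shape required by the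
    subbase of the C^r topology. *)
Lemma countable_compact_cover : exists (J : countType) (ci : J -> chart_index M) (K : J -> set M),
  [/\ forall c, compact (K c), forall c, K c `<=` cdom (ci c)
    & forall (x : M) (O : set M), open O -> O x -> exists c, K c x /\ K c `<=` O].
Proof.
have [m [ci [lo [H [H0 bU cov]]]]] := chart_box_cover M.
pose core k := @box R d (fun a => lo k a + H k / 4) (H k / 2).
pose corner (n : nat) (a : {ffun 'I_d -> int}) (i : nat) : R :=
  oapp (fun i : 'I_d => (a i)%:~R / n.+1%:R) 0 (insub i).
pose cell n a := @box R d (corner n a) (n.+1%:R^-1).
have coreU k : core k `<=` cimg (ci k).
  by move=> u /(@box_inner_sub R d (lo k) (H k) (H0 k)) /bU.
have cK k n a : compact (core k `&` cell n a).
  apply: (@subclosed_compact _ _ (core k)) => //; last exact: compact_box.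
  by apply: closedI; apply: compact_closed; [exact: norm_hausdorff|exact: compact_box|exact: norm_hausdorff|exact: compact_box].
exists ('I_m * nat * {ffun 'I_d -> int})%type, (fun c => ci c.1.1),
  (fun c => cinv (ci c.1.1) @` (core c.1.1 `&` cell c.1.2 c.2)); split=> [[[k n] a]|[[k n] a]|x O oO Ox] /=.
- apply: continuous_compact; last exact: cK.
  apply: continuous_in_subspaceT => u /set_mem [/coreU iu _].
  by apply: (@cinv_continuous _ _ M (ci k)); apply/mem_set.
- by move=> _ [u [/coreU iu _] <-]; exact: (cimg_cinv iu).1.
have [k [u cu ux]] := cov x.
have : nbhs u (cinv (ci k) @^-1` O).
  apply: (@cinv_continuous _ _ M (ci k)); first exact/mem_set/coreU.
  by rewrite ux; exact: (open_nbhs_nbhs (conj oO Ox)).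
move=> /nbhs_ballP[e /= e0 eO].
have [n nP] := ltr_add_invr e0; rewrite add0r in nP.
have n0 : 0 < n.+1%:R :> R by rewrite ltr0n.
pose a := [ffun i : 'I_d => Num.floor (u ord0 i * n.+1%:R)].
have aP (i : 'I_d) : corner n a i <= u ord0 i <= corner n a i + n.+1%:R^-1.
  rewrite /corner valK /= ffunE; have /andP[f1 f2] := floor_itv (u ord0 i * n.+1%:R).
  rewrite ler_pdivrMr// f1 -[X in _ <= _ + X]mul1r -mulrDl ler_pdivlMr//.
  by rewrite intrD in f2; exact: ltW.
exists ((k, n), a); split=> [|_ [v [cv av] <-]] /=; first by exists u.
apply: eO; split=> // i j; rewrite (ord1 i) -ball_normE /= ltr_norml.
have := aP j; have := av j; move: nP; set t := _^-1; move: (corner n a j) (u ord0 j) (v ord0 j) => p q q'.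
by move=> ? /andP[? ?] /andP[? ?]; apply/andP; split; lra.
Qed.

Let ev (z : borelDiff vol r * borel M) : borel M := (z.1 : diffVol vol r) z.2.

(** The preimage of an open [O] is a countable union of rectangles, an open set of maps times a
    compact set of points; the second index confines the image to one chart domain. Countability
    comes from [M] alone, so no separability of the group of diffeomorphisms enters. *)
Lemma measurable_eval : measurable_fun setT ev.
Proof.
have [J [ci [K [cK Ki cov]]]] := countable_compact_cover.
apply: measurable_to_borel => O oO; rewrite setTI.
pose T (c c' : J) : set (diffVol vol r) := [set f | f @` K c `<=` O `&` cdom (ci c')].
have -> : ev @^-1` O = \bigcup_(p in [set: J * J]) ((T p.1 p.2 : set (borelDiff vol r)) `*` (K p.1 : set (borel M))).
  apply/seteqP; split=> [[f x] Ofx|[f x] [[c c'] _ /= [Tf Kx]]]; last first.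
    by have [] : (O `&` cdom (ci c')) (f x) by apply: Tf; exists x.
  have [c' [Kfx _]] := cov (f x) O oO Ofx.
  have oOc : open (O `&` cdom (ci c')) by apply: openI => //; exact: cdom_open.
  have [cf _] := diffVol_class f.
  have oP : open (f @^-1` (O `&` cdom (ci c'))) by move/continuousP: cf => cf; exact: cf.
  have [c [Kx KO]] := cov x _ oP (conj Ofx (Ki _ _ Kfx)).
  by exists (c, c') => //; split => // _ [y Ky <-]; exact: KO.
apply: measurable_bigcup_countType => -[c c'] _ /=.
have m1 : measurable (T c c' : set (borelDiff vol r)).
  apply: sub_sigma_algebra; apply: (@open_maps_compact_to (ci c) (ci c')) => //.
  by apply: openI => //; exact: cdom_open.
have m2 : measurable (K c : set (borel M)).
  by apply: closed_measurable_borel; apply: compact_closed => //; exact: carrier_hausdorff.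
exact: measurableX m1 m2.
Qed.

Lemma measurable_coord n : measurable_fun setT (fun w : words vol r => w n).
Proof.
move=> _ B mB; rewrite setTI; apply: sub_sigma_algebra.
by exists n, B.
Qed.

Lemma measurable_compose n :
  measurable_fun setT (fun z : words vol r * borel M => compose z.1 n z.2).
Proof.
elim: n => [|n IH]; first exact: measurable_snd.
have mw : measurable_fun setT (fun z : words vol r * borel M => z.1 n).
  exact: (measurableT_comp (measurable_coord n) measurable_fst).
exact: (measurableT_comp measurable_eval (measurable_fun_pair mw IH)).
Qed.

Definition lshift (n : nat) (w : words vol r) : words vol r := fun k => w (n + k)%N.

Lemma compose_add n k (w : words vol r) x : compose w (n + k) x = compose (lshift n w) k (compose w n x).
Proof. by elim: k => [|k IH]; rewrite ?addn0// addnS /= IH. Qed.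

Lemma measurable_lshift n : measurable_fun setT (lshift n).
Proof.
apply: (@measurability _ _ _ _ setT (lshift n) (@cylinders R d M vol r)) => //.
move=> _ [_ [k [B [mB ->]]] <-]; rewrite setTI.
have := measurable_coord (n + k) measurableT mB; by rewrite setTI.
Qed.

Lemma compose_vol (w : words vol r) n (E : set (borel M)) : measurable E -> vol (compose w n @^-1` E) = vol E.
Proof.
elim: n E => [|n IH] E mE //=.
have mw : measurable_fun setT ((w n : diffVol vol r) : borel M -> borel M).
  apply: measurable_to_borel => O oO; rewrite setTI; apply: open_measurable_borel.
  by have [/continuousP cf _] := diffVol_class (w n : diffVol vol r); exact: cf.
rewrite -[RHS](diffVol_vol (w n : diffVol vol r) mE) -IH//.
by have := mw measurableT _ mE; rewrite setTI.
Qed.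
End evaluation.

(** * Measure-preserving maps and two-point correlations *)

Section measure_preserving.
Context dX (X : measurableType dX) (R : realType) (m : {measure set X -> \bar R}).
Context (T : X -> X).
Hypotheses (mT : measurable_fun setT T) (hT : forall E, measurable E -> m (T @^-1` E) = m E).

Lemma ge0_integral_preserving (f : X -> \bar R) : measurable_fun setT f -> (forall x, 0 <= f x)%E ->
  (\int[m]_x f (T x) = \int[m]_x f x)%E.
Proof.
move=> mf f0.
have := @ge0_integral_pushforward _ _ _ _ _ _ mT m setT f measurableT mf (fun y _ => f0 y).
by rewrite preimage_setT /comp => <-; apply: eq_measure_integral => A mA _; exact: hT.
Qed.

Lemma integral_preserving (f : X -> \bar R) : measurable_fun setT f ->
  (\int[m]_x f (T x) = \int[m]_x f x)%E.
Proof.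
move=> mf; rewrite integralE [RHS]integralE; congr (_ - _)%E.
  rewrite -(ge0_integral_preserving (measurable_funepos mf)); last by move=> x; exact: funepos_ge0.
  by apply: eq_integral => x _; rewrite !funeposE.
rewrite -(ge0_integral_preserving (measurable_funeneg mf)); last by move=> x; exact: funeneg_ge0.
by apply: eq_integral => x _; rewrite !funenegE.
Qed.

Lemma coef_preserving (f g : X -> R) : measurable_fun setT f -> measurable_fun setT g ->
  coef m (f \o T) (g \o T) = coef m f g.
Proof.
move=> mf mg; rewrite /coef /Rintegral; congr fine.
apply: (@integral_preserving (fun x => (f x * g x)%:E)).
by apply/measurable_EFinP; exact: measurable_funM.
Qed.

Lemma L2_preserving (f : X -> R) : f \in Lfun m 2%:E -> f \o T \in Lfun m 2%:E.
Proof.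
move=> fL; have mf := L2_measurable fL; apply: L2P; first exact: measurableT_comp.
rewrite (@ge0_integral_preserving (fun x => (f x ^+ 2)%:E)); first exact: L2_sqr_lty.
  by apply/measurable_EFinP; exact: measurable_funX.
by move=> x; rewrite lee_fin sqr_ge0.
Qed.
End measure_preserving.

Section integral_product.
Context dX dY (X : measurableType dX) (Y : measurableType dY) (R : realType).
Context (m : {sigma_finite_measure set Y -> \bar R}).

Lemma measurable_integral_param (f : X * Y -> \bar R) : measurable_fun setT f ->
  measurable_fun setT (fun x => \int[m]_y f (x, y))%E.
Proof.
move=> mf.
have -> : (fun x => \int[m]_y f (x, y))%E =
    ((fun x => \int[m]_y (f^\+ (x, y))) \- (fun x => \int[m]_y (f^\- (x, y))))%E.
  apply/funext => x; rewrite integralE; congr (_ - _)%E.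
    by apply: eq_integral => y _; rewrite !funeposE.
  by apply: eq_integral => y _; rewrite !funenegE.
apply: emeasurable_funB.
  apply: (@measurable_fun_fubini_tonelli_F _ _ _ _ _ m (f^\+)%E) => //.
  exact: measurable_funepos.
apply: (@measurable_fun_fubini_tonelli_F _ _ _ _ _ m (f^\-)%E) => //.
exact: measurable_funeneg.
Qed.
End integral_product.

(** * Products of functions of one point *)

Section tensor.
Context dX (X : measurableType dX) (R : realType) (m : probability X R).
Let m2 := (m \x m)%E.

Lemma L2_one : (fun=> 1 : R) \in Lfun m 2%:E.
Proof.
apply: L2P => //; under eq_integral do rewrite expr1n.
by rewrite integral_cst// mul1e; apply: le_lt_trans (probability_le1 m measurableT) (ltry _).
Qed.

Lemma L2_integrable (f : X -> R) : f \in Lfun m 2%:E -> m.-integrable setT (EFin \o f).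
Proof.
move=> fL; have := L2M fL L2_one; apply: eq_integrable => // x _ /=; by rewrite mulr1.
Qed.

Lemma tensor_measurable (u v : X -> R) : measurable_fun setT u -> measurable_fun setT v ->
  measurable_fun setT (fun z : X * X => u z.1 * v z.2).
Proof.
move=> mu mv; apply: measurable_funM.
  exact: (measurableT_comp mu measurable_fst).
exact: (measurableT_comp mv measurable_snd).
Qed.

Lemma ge0_tensor_integral (u v : X -> R) : measurable_fun setT u -> measurable_fun setT v ->
  (forall x, 0 <= u x) -> (forall x, 0 <= v x) ->
  (\int[m2]_z (u z.1 * v z.2)%:E = (\int[m]_x (u x)%:E) * \int[m]_x (v x)%:E)%E.
Proof.
move=> mu mv u0 v0.
rewrite (@fubini_tonelli1 _ _ _ _ _ m m (fun z => (u z.1 * v z.2)%:E)); first last.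
- by move=> z; rewrite lee_fin mulr_ge0.
- by apply/measurable_EFinP; exact: tensor_measurable.
rewrite /fubini_F /=.
under eq_integral => x _.
  under eq_integral do rewrite EFinM.
  rewrite ge0_integralZl//; first last.
  - by rewrite lee_fin.
  - by move=> y _; rewrite lee_fin.
  - exact/measurable_EFinP.
  over.
rewrite /= ge0_integralZr//; first last.
- by apply: integral_ge0 => y _; rewrite lee_fin.
- by move=> y _; rewrite lee_fin.
exact/measurable_EFinP.
Qed.

Lemma tensor_integrable (u v : X -> R) : m.-integrable setT (EFin \o u) -> m.-integrable setT (EFin \o v) ->
  m2.-integrable setT (EFin \o (fun z => u z.1 * v z.2)).
Proof.
move=> iu iv; have /measurable_EFinP mu := measurable_int _ iu; have /measurable_EFinP mv := measurable_int _ iv.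
apply/integrableP; split; first by apply/measurable_EFinP; exact: tensor_measurable.
under eq_integral do rewrite /= normrM.
rewrite (@ge0_tensor_integral (fun x => `|u x|) (fun x => `|v x|))//.
- have /integrableP[_ /= uoo] := iu; have /integrableP[_ /= voo] := iv.
  rewrite lte_mul_pinfty//; first by apply: integral_ge0 => x _; rewrite lee_fin.
  by rewrite ge0_fin_numE//; apply: integral_ge0 => x _; rewrite lee_fin.
- exact: measurableT_comp.
- exact: measurableT_comp.
Qed.

Lemma tensor_Rintegral (u v : X -> R) : m.-integrable setT (EFin \o u) -> m.-integrable setT (EFin \o v) ->
  \int[m2]_z (u z.1 * v z.2) = (\int[m]_x u x) * (\int[m]_x v x).
Proof.
move=> iu iv; rewrite /Rintegral.
have := tensor_integrable iu iv => iuv.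
rewrite -(integral12_prod_meas1 iuv) /fubini_F /=.
have fu := integrable_fin_num measurableT iu; have fv := integrable_fin_num measurableT iv.
rewrite -fineM//; congr fine.
under eq_integral => x _.
  under eq_integral do rewrite EFinM.
  rewrite integralZl//; over.
by rewrite /= -(fineK fv) integralZr.
Qed.

Lemma tensor_L2 (u v : X -> R) : u \in Lfun m 2%:E -> v \in Lfun m 2%:E ->
  (fun z => u z.1 * v z.2) \in Lfun m2 2%:E.
Proof.
move=> uL vL; have mu := L2_measurable uL; have mv := L2_measurable vL.
apply: L2P; first exact: tensor_measurable.
under eq_integral do rewrite exprMn.
rewrite (@ge0_tensor_integral (fun x => u x ^+ 2) (fun x => v x ^+ 2)).
- rewrite -(coef_sqr uL) -(coef_sqr vL) -EFinM ltry//.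
- exact: measurable_funX.
- exact: measurable_funX.
- by move=> x; rewrite sqr_ge0.
- by move=> x; rewrite sqr_ge0.
Qed.

Lemma tensor_coef (u v f g : X -> R) : u \in Lfun m 2%:E -> v \in Lfun m 2%:E ->
   f \in Lfun m 2%:E -> g \in Lfun m 2%:E ->
  coef m2 (fun z => u z.1 * v z.2) (fun z => f z.1 * g z.2) = coef m u f * coef m v g.
Proof.
move=> uL vL fL gL; rewrite /coef -(tensor_Rintegral (L2M uL fL) (L2M vL gL)).
by congr Rintegral; apply/funext => z; ring.
Qed.
End tensor.

(** * Shift invariance of the product measure *)

Section shift_invariance.
Context (R : realType) (d : nat) (M : closedRiemannian R d).
Context (vol : probability (borel M) R) (r : option nat).
Context (mu : probability (borelDiff vol r) R) (P : probability (words vol r) R).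
Hypothesis hP : is_product_measure mu P.

Let G : set (set (words vol r)) := [set A | exists m (B : nat -> set (borelDiff vol r)),
  (forall i, measurable (B i)) /\ A = [set w | forall i, (i < m)%N -> B i (w i)]].

Lemma finite_cylinder_measurable : G `<=` measurable.
Proof.
move=> _ [m [B [mB ->]]].
rewrite (_ : [set w | _] = \bigcap_(i in [set i | (i < m)%N]) ((fun w : words vol r => w i) @^-1` B i))//.
apply: bigcap_measurableType => i _; rewrite -[X in measurable X]setTI.
by apply: (@measurable_coord _ _ _ vol r i) => //.
Qed.

(** Finite cylinders are stable under intersection and generate the sigma-algebra, so it suffices to
    compare the two measures on them, where the product formula prescribes both. *)
Lemma lshift_preserving n (E : set (words vol r)) : measurable E -> P (@lshift _ _ _ vol r n @^-1` E) = P E.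
Proof.
move=> mE.
pose sh := @lshift _ _ _ vol r n.
have msh : measurable_fun setT sh by exact: measurable_lshift.
have GS : measurable = <<s G >> :> set (set (words vol r)).
  apply/seteqP; split.
    apply: smallest_sub; first exact: smallest_sigma_algebra.
    move=> _ [k [B [mB ->]]]; apply: sub_sigma_algebra.
    exists k.+1, (fun i => if i == k then B else setT); split=> [i|]; first by case: eqP.
    apply/seteqP; split=> w /= Bw; last by have := Bw k (ltnSn k); rewrite eqxx.
    by move=> i _; case: eqP => [->|].
  apply: smallest_sub; first exact: sigma_algebra_measurable.
  exact: finite_cylinder_measurable.
have GI : setI_closed G.
  move=> _ _ [m1 [B1 [mB1 ->]]] [m2 [B2 [mB2 ->]]].
  exists (maxn m1 m2), (fun i => (if (i < m1)%N then B1 i else setT) `&` (if (i < m2)%N then B2 i else setT)).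
  split=> [i|]; first by apply: measurableI; case: ifP.
  apply/seteqP; split=> [w [/= w1 w2] i _|w /= H].
    by split; case: ifPn => // im; [exact: w1|exact: w2].
  by split=> i im; have := H i; rewrite leq_max im ?orbT => /(_ isT) []; rewrite ?im.
have GT : G setT.
  by exists 0%N, (fun=> setT); split => //; apply/seteqP; split.
have gT : \bigcup_(k in [set: nat]) [set: words vol r] = setT.
  by apply/seteqP; split=> // w _; exists 0%N.
have := @measure_unique _ R (words vol r) G (fun=> setT) GS GI (fun=> GT) gT
  (pushforward P sh) P.
move=> uniqm; refine (uniqm msh _ _ E mE); last by move=> k; exact: (le_lt_trans (probability_le1 P (measurableT : measurable (sh @^-1` setT))) (ltry _)).
move=> _ [m [B [mB ->]]]; rewrite /pushforward.
(* The first [n] letters are left free; their factors in the product are total masses, equal to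
   1. *)
pose B' i := if (i < n)%N then setT else B (i - n)%N.
have mB' i : measurable (B' i) by rewrite /B'; case: ifP.
transitivity (P [set w | forall i, (i < n + m)%N -> B' i (w i)]).
  congr (P _); apply/seteqP; split=> w /= H i im.
    rewrite /B'; case: ifPn => //; rewrite -leqNgt => ni.
    have := H (i - n)%N; rewrite /= /sh /lshift subnKC//; apply.
    by rewrite ltn_subLR.
  have := H (n + i)%N; rewrite ltn_add2l => /(_ im).
  by rewrite /B' ltnNge leq_addr /= addKn.
apply: etrans (hP (n + m) mB') _; apply: etrans _ (esym (hP m mB)).
rewrite big_split_ord /= big1 ?mul1e.
  by apply: eq_bigr => i _; rewrite /B' /= ltnNge leq_addr /= addKn.
by move=> i _; rewrite /B' /= ltn_ord probability_setT.
Qed.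

End shift_invariance.

Section spectral_tensor.
Context dX (X : measurableType dX) (R : realType) (m : probability X R).
Context (I : countType) (phi : I -> X -> R) (lam : I -> R).
Hypotheses (hb : orthonormal_basis m phi) (lam0 : forall i, 0 <= lam i).
Local Notation L2 := (Lfun m 2%:E).

Lemma esumZl_le (J : choiceType) (D : set J) (a : J -> \bar R) (c : R) : 0 <= c -> (forall i, 0 <= a i)%E ->
  (\esum_(i in D) (c%:E * a i) <= c%:E * \esum_(i in D) a i)%E.
Proof.
move=> c0 a0; apply: ge_ereal_sup => _ [F FD <-].
rewrite -ge0_mule_fsumr//; apply: lee_wpmul2l; first by rewrite lee_fin.
by apply: ereal_sup_ubound; exists F.
Qed.

Lemma parseval f : f \in L2 -> (\esum_(i in [set: I]) (coef m f (phi i) ^+ 2)%:E = (coef m f f)%:E)%E.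
Proof. by move=> fL; have [_ _ ->//] := hb; rewrite coef_sqr. Qed.

(** The coefficients of f(x) f(y) are products of coefficients of f, supported on eigenvalues at
    most 2 L, so the Sobolev weight factors out and Parseval in each variable remains. Mean zero of
    the product comes from mean zero of f. *)
Lemma tensor_sobolev (f : X -> R) (p L : R) : 0 <= p -> 0 <= L -> f \in L2 -> \int[m]_x f x = 0 ->
  (forall i, coef m f (phi i) != 0 -> lam i <= L) ->
  let A := fun z : X * X => f z.1 * f z.2 in
  sobolev0 (m \x m)%E (tensor_basis phi) (tensor_eigenvalue lam) p A /\
  sobolev_norm (m \x m)%E (tensor_basis phi) (tensor_eigenvalue lam) p A
    <= (1 + 2 * L) `^ (p / 2) * coef m f f.
Proof.
move=> p0 L0 fL f0 fsupp A.
have phiL i : phi i \in L2 by have [] := hb.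
have L1 : 0 <= 1 + 2 * L by rewrite addr_ge0// mulr_ge0.
have cE ij : coef (m \x m)%E A (tensor_basis phi ij) = coef m f (phi ij.1) * coef m f (phi ij.2).
  exact: tensor_coef.
have sqle : (sobolev_sqnorm (m \x m) (tensor_basis phi) (tensor_eigenvalue lam) p A <=
    ((1 + 2 * L) `^ p * coef m f f ^+ 2)%:E)%E.
  apply: (@le_trans _ _ (\esum_(ij in [set: I * I]) (((1 + 2 * L) `^ p)%:E *
      ((coef m f (phi ij.1) ^+ 2)%:E * (coef m f (phi ij.2) ^+ 2)%:E)))%E).
    apply: le_esum => -[i j] _; rewrite cE -!EFinM lee_fin /= exprMn mulrC.
    have [->|ci] := eqVneq (coef m f (phi i)) 0; first by rewrite expr0n/= !mul0r !mulr0.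
    have [->|cj] := eqVneq (coef m f (phi j)) 0; first by rewrite expr0n/= !mulr0.
    apply: ler_wpM2r; first by rewrite mulr_ge0// sqr_ge0.
    apply: ge0_ler_powR => //; rewrite ?nnegrE//.
      by rewrite addr_ge0// addr_ge0.
    by rewrite lerD2l /tensor_eigenvalue/= mulr2n mulrDl mul1r lerD// fsupp.
  apply: le_trans (esumZl_le _ _ _) _; [exact: powR_ge0|by move=> ij; rewrite -EFinM lee_fin mulr_ge0// sqr_ge0|].
  rewrite [leRHS]EFinM; apply: lee_wpmul2l; first by rewrite lee_fin powR_ge0.
  have -> : [set: I * I] = [set: I] `*`` (fun=> [set: I]) by apply/seteqP; split.
  rewrite -(@esum_esum _ _ _ setT (fun=> setT) (fun i j => ((coef m f (phi i) ^+ 2)%:E * (coef m f (phi j) ^+ 2)%:E)%E)); last first.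
    by move=> i j _ _; rewrite -EFinM lee_fin mulr_ge0// sqr_ge0.
  rewrite expr2 EFinM.
  apply: (@le_trans _ _ (\esum_(i in [set: I]) ((coef m f f)%:E * (coef m f (phi i) ^+ 2)%:E))%E).
    apply: le_esum => i _; apply: le_trans (esumZl_le _ _ _) _; rewrite ?sqr_ge0//.
      by move=> j; rewrite lee_fin sqr_ge0.
    by rewrite parseval// muleC.
  apply: le_trans (esumZl_le _ _ _) _; rewrite ?coef_ge0//.
    by move=> j; rewrite lee_fin sqr_ge0.
  by rewrite parseval.
split; first split.
- exact: tensor_L2.
- by rewrite (tensor_Rintegral (L2_integrable fL) (L2_integrable fL)) f0 mul0r.
- exact: le_lt_trans sqle (ltry _).
rewrite /sobolev_norm; set S := sobolev_sqnorm _ _ _ _ _ in sqle *.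
have S0 : (0 <= S)%E by apply: esum_ge0 => ij _; rewrite lee_fin mulr_ge0// ?sqr_ge0// powR_ge0.
have -> : (1 + 2 * L) `^ (p / 2) * coef m f f = Num.sqrt ((1 + 2 * L) `^ p * coef m f f ^+ 2).
  rewrite sqrtrM ?powR_ge0// sqrtr_sqr ger0_norm ?coef_ge0//; congr (_ * _).
  by rewrite powRrM -powR12_sqrt ?powR_ge0.
apply: ler_wsqrtr; rewrite -lee_fin fineK//.
by rewrite ge0_fin_numE//; exact: le_lt_trans sqle (ltry _).
Qed.
End spectral_tensor.

Section correlation.
Context (R : realType) (d : nat) (M : closedRiemannian R d).
Context (vol : probability (borel M) R) (r : option nat).
Context (P : probability (words vol r) R).
Local Notation L2 := (Lfun vol 2%:E).

Definition corr (f g : borel M -> R) (k : nat) (w : words vol r) : R := coef vol f (g \o compose w k).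

Lemma measurable_compose_word (w : words vol r) n : measurable_fun setT (compose w n).
Proof.
exact: (measurableT_comp (measurable_compose (vol := vol) (r := r) n) (pair1_measurable w)).
Qed.

Lemma L2_compose (w : words vol r) n f : f \in L2 -> f \o compose w n \in L2.
Proof.
apply: L2_preserving; [exact: measurable_compose_word|exact: compose_vol].
Qed.

Lemma coef_compose (w : words vol r) n f g : f \in L2 -> g \in L2 ->
  coef vol (f \o compose w n) (g \o compose w n) = coef vol f g.
Proof.
move=> fL gL; apply: coef_preserving; [exact: measurable_compose_word|exact: compose_vol|exact: L2_measurable fL|exact: L2_measurable gL].
Qed.

(** The first [N] maps preserve the volume and are removed by a change of variables; what is left
    involves only the later letters, so the law of the correlation does not depend on [N]. *)
Lemma corr_lshift (w : words vol r) N k f g : f \in L2 -> g \in L2 ->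
  \int[vol]_x (f (compose w N x) * g (compose w (N + k) x)) = corr f g k (lshift N w).
Proof.
move=> fL gL; rewrite /corr -(coef_compose w N fL (L2_compose (lshift N w) k gL)).
by congr Rintegral; apply/funext => x; rewrite /= compose_add.
Qed.

Lemma measurable_corr f g k : f \in L2 -> g \in L2 -> measurable_fun setT (corr f g k).
Proof.
move=> /L2_measurable mf /L2_measurable mg.
rewrite /corr /coef /Rintegral; apply: measurableT_comp => //.
apply: (@measurable_integral_param _ _ _ _ _ vol (fun z => (f z.2 * g (compose z.1 k z.2))%:E)).
apply/measurable_EFinP; apply: measurable_funM.
  exact: (measurableT_comp mf measurable_snd).
exact: (measurableT_comp mg (measurable_compose k)).
Qed.

Lemma corr_le f g k (w : words vol r) : f \in L2 -> g \in L2 ->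
  `|corr f g k w| <= Num.sqrt (coef vol f f) * Num.sqrt (coef vol g g).
Proof.
move=> fL gL; have gL' := L2_compose w k gL.
by have := coef_le_sqrt fL gL'; rewrite coef_compose.
Qed.

Lemma corr_sqr_expectation f g k : f \in L2 -> g \in L2 ->
  (\int[P]_w (corr f g k w ^+ 2)%:E = (\int[P]_w \int[(vol \x vol)%E]_z
     (f z.1 * f z.2 * (g (compose w k z.1) * g (compose w k z.2))))%:E)%E.
Proof.
move=> fL gL.
have E w : (\int[(vol \x vol)%E]_z (f z.1 * f z.2 * (g (compose w k z.1) * g (compose w k z.2)))
    = corr f g k w ^+ 2)%R.
  have ig := L2M fL (L2_compose w k gL).
  rewrite expr2 -(tensor_Rintegral ig ig); congr Rintegral; apply/funext => z /=; ring.
have -> : (\int[P]_w \int[(vol \x vol)%E]_z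
     (f z.1 * f z.2 * (g (compose w k z.1) * g (compose w k z.2))) = \int[P]_w (corr f g k w ^+ 2))%R.
  by congr Rintegral; apply/funext => w; exact: E.
(* The right-hand side goes through [fine], so finiteness must be shown; Cauchy-Schwarz bounds the
   correlation uniformly in the word. *)
rewrite /Rintegral fineK// ge0_fin_numE; last first.
  by apply: integral_ge0 => w _; rewrite lee_fin sqr_ge0.
apply: (@le_lt_trans _ _ (\int[P]_w (coef vol f f * coef vol g g)%:E)%E).
  apply: ge0_le_integral; [exact: measurableT|by move=> w _; rewrite lee_fin sqr_ge0| | |].
  - by apply/measurable_EFinP; apply: measurable_funX; exact: measurable_corr.
  - exact: measurable_cst.
  move=> w _; rewrite lee_fin -real_normK ?num_real//.
  rewrite -(sqr_sqrtr (coef_ge0 vol f)) -(sqr_sqrtr (coef_ge0 vol g)) -exprMn.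
  by rewrite ler_sqr ?nnegrE ?corr_le// mulr_ge0// sqrtr_ge0.
rewrite integral_cst// lte_mul_pinfty//; last exact: le_lt_trans (probability_le1 P measurableT) (ltry _).
by rewrite lee_fin mulr_ge0// coef_ge0.
Qed.
End correlation.

(** * Spectral truncation *)

Lemma sum_cauchy_schwarz (R : realType) (J : Type) (s : seq J) (u v : J -> R) :
  `|\sum_(i <- s) u i * v i| <= Num.sqrt (\sum_(i <- s) u i ^+ 2) * Num.sqrt (\sum_(i <- s) v i ^+ 2).
Proof.
elim: s => [|i s IH]; first by rewrite !big_nil normr0 mulr_ge0.
rewrite !big_cons.
set U := \sum_(j <- s) u j ^+ 2 in IH *; set V := \sum_(j <- s) v j ^+ 2 in IH *.
have U0 : 0 <= U by apply: sumr_ge0 => j _; exact: sqr_ge0.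
have V0 : 0 <= V by apply: sumr_ge0 => j _; exact: sqr_ge0.
apply: le_trans (ler_normD _ _) _; rewrite normrM.
apply: le_trans (lerD (lexx _) IH) _.
rewrite -[leRHS]sqrtrM ?addr_ge0 ?sqr_ge0//.
rewrite -[leLHS]ger0_norm; last by rewrite addr_ge0// mulr_ge0.
rewrite -sqrtr_sqr; apply: ler_wsqrtr.
have [p0 p2] : 0 <= Num.sqrt U /\ Num.sqrt U ^+ 2 = U by rewrite sqrtr_ge0 sqr_sqrtr.
have [q0 q2] : 0 <= Num.sqrt V /\ Num.sqrt V ^+ 2 = V by rewrite sqrtr_ge0 sqr_sqrtr.
rewrite -[in leRHS]p2 -[in leRHS]q2 -[u i ^+ 2]real_normK ?num_real// -[v i ^+ 2]real_normK ?num_real//.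
move: `|u i| `|v i| (Num.sqrt U) (Num.sqrt V) => a b p q.
rewrite -subr_ge0 (_ : _ - _ = (a * q - b * p) ^+ 2); last by ring.
exact: sqr_ge0.
Qed.

Section L2norm.
Context dX (X : measurableType dX) (R : realType) (m : {measure set X -> \bar R}).
Local Notation L2 := (Lfun m 2%:E).

Definition L2n (f : X -> R) : R := Num.sqrt (coef m f f).

Lemma L2nD f g : f \in L2 -> g \in L2 -> L2n (fun x => f x + g x) <= L2n f + L2n g.
Proof.
move=> fL gL; rewrite /L2n -[leRHS]ger0_norm ?addr_ge0// -[leRHS]sqrtr_sqr; apply: ler_wsqrtr.
have fgL := L2D fL gL.
rewrite coefDl// (coefC m f) (coefC m g) !coefDl// (coefC m g f).
have := coef_le_sqrt fL gL => /(le_trans (ler_norm _)).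
have := sqr_sqrtr (coef_ge0 m f); have := sqr_sqrtr (coef_ge0 m g).
move: (Num.sqrt (coef m f f)) (Num.sqrt (coef m g g)) => p q <- <- H.
have : coef m f g * 2 <= p * q * 2 by rewrite ler_wpM2r.
by rewrite sqrrD; lra.
Qed.

Lemma L2nZ c f : f \in L2 -> L2n (fun x => c * f x) = `|c| * L2n f.
Proof.
move=> fL; rewrite /L2n coefZl ?L2Z// (coefC m f) coefZl// mulrA -expr2 sqrtrM ?sqr_ge0//.
by rewrite sqrtr_sqr.
Qed.
End L2norm.

Section truncation.
Context dX (X : measurableType dX) (R : realType) (m : probability X R).
Context (I : countType) (phi : I -> X -> R) (lam : I -> R).
Hypotheses (hb : orthonormal_basis m phi) (lam0 : forall i, 0 <= lam i).
Local Notation L2 := (Lfun m 2%:E).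
Local Notation nrm := (@L2n _ _ R m).

Let phiL i : phi i \in L2. Proof. by have [] := hb. Qed.
Let phiO i j : coef m (phi i) (phi j) = (i == j)%:R. Proof. by have [] := hb. Qed.

Lemma L2n_one : nrm (fun=> 1) = 1.
Proof.
rewrite /L2n /coef mulr1 (_ : Rintegral _ _ _ = 1) ?sqrtr1// /Rintegral.
by rewrite integral_cst// mul1e [X in fine X](_ : _ = 1%E)//; exact: (@probability_setT _ _ _ m).
Qed.

Lemma coef_one f : coef m (fun=> 1) f = \int[m]_x f x.
Proof. by congr Rintegral; apply/funext => x; rewrite mul1r. Qed.

Lemma mean_le f : f \in L2 -> `|\int[m]_x f x| <= nrm f.
Proof.
move=> fL; rewrite -coef_one; apply: le_trans (coef_le_sqrt (L2_one m) fL) _.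
by rewrite -/(nrm _) L2n_one mul1r.
Qed.

(** Otherwise all coefficients of the constant 1 would vanish, against Parseval's identity. *)
Lemma exists_nonzero_mean : exists i, \int[m]_x phi i x != 0.
Proof.
apply: contrapT => H.
have := parseval hb (L2_one m); rewrite esum1; last first.
  move=> i _; rewrite coef_one [Rintegral _ _ _](_ : _ = 0) ?expr0n//.
  by apply: contrapT => /eqP Hi; apply: H; exists i.
have := L2n_one; rewrite /L2n => E1 [E0].
by move: E1; rewrite -E0 sqrtr0 => /esym/eqP; rewrite oner_eq0.
Qed.

(** The basis comes in no particular order. Lists of distinct indices below the level [L] have
    bounded length, and one of maximal length must contain every such index. *)
Lemma spectral_set (K : R) (q : nat) (L : R) : 0 <= L ->
  (forall N (e : 'I_N -> I), injective e -> (forall k, lam (e k) <= L) -> N%:R <= K * (1 + L) ^+ q) ->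
  exists s : seq I, [/\ uniq s, forall i, (i \in s) = (lam i <= L) & (size s)%:R <= K * (1 + L) ^+ q].
Proof.
move=> L0 cnt.
pose p (n : nat) : Prop := exists s : seq I, [/\ uniq s, all (fun i => lam i <= L) s & size s = n].
have pb n : p n -> n%:R <= K * (1 + L) ^+ q.
  move=> [s [us /allP sL <-]]; apply: (cnt _ (fun k : 'I_(size s) => tnth (in_tuple s) k)).
    by apply/injectiveP; rewrite /injectiveb /dinjectiveb map_tnth_enum.
  by move=> k; apply: sL; exact: mem_tnth.
have ex0 : exists n, `[< p n >] by exists 0%N; apply/asboolP; exists [::].
have [B hB] : exists B : nat, forall n, `[< p n >] -> (n <= B)%N.
  exists (Num.bound (K * (1 + L) ^+ q)) => n /asboolP/pb H; rewrite -(@ler_nat R).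
  exact: (le_trans H (ltW (archi_boundP (le_trans (ler0n R n) H)))).
case: (ex_maxnP ex0 hB) => n /asboolP[s [us /allP sL sn]] nmax.
exists s; split=> //; last by rewrite sn; apply: pb; exists s; split => //; apply/allP.
move=> i; apply/idP/idP => [/sL//|iL]; apply: contrapT => /negP is_.
have : `[< p n.+1 >].
  by apply/asboolP; exists (i :: s); split; rewrite /= ?is_ ?us ?iL ?sn//; apply/allP.
by move=> /nmax; rewrite ltnn.
Qed.

Context (i0 : I).
Hypothesis hi0 : \int[m]_x phi i0 x != 0.
Let mean i := \int[m]_x phi i x.
Let kappa := 1 + `|mean i0|^-1.

(** The mean is cancelled by a basis element rather than by the constant 1, so that only two
    spectral coefficients can be nonzero. As |mean i| <= 1, the norm of [psi i] is at most
    [kappa]. *)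
Definition psi i (x : X) := phi i x + - (mean i / mean i0) * phi i0 x.

Lemma psi_L2 i : psi i \in L2.
Proof. by apply: L2D => //; exact: L2Z. Qed.

Lemma phi_norm i : nrm (phi i) = 1.
Proof. by rewrite /L2n phiO eqxx sqrtr1. Qed.

Lemma integral_psi i : \int[m]_x psi i x = 0.
Proof.
rewrite -coef_one coefC coefDl ?L2Z ?L2_one// coefZl ?L2_one//.
by rewrite !(coefC m _ (fun=> 1)) !coef_one -!/(mean _) mulNr divfK ?subrr.
Qed.

Lemma mean_ratio_le (f : X -> R) : f \in L2 -> `|\int[m]_x f x / mean i0| <= `|mean i0|^-1 * nrm f.
Proof. by move=> fL; rewrite normrM normfV mulrC ler_wpM2l// mean_le. Qed.

Lemma psi_norm i : nrm (psi i) <= kappa.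
Proof.
apply: le_trans (L2nD (phiL i) (L2Z _ (phiL i0))) _; rewrite L2nZ// !phi_norm mulr1 normrN.
by rewrite lerD2l; apply: le_trans (mean_ratio_le (phiL i)) _; rewrite phi_norm mulr1.
Qed.

Lemma coef_psi_support i j : coef m (psi i) (phi j) != 0 -> j = i \/ j = i0.
Proof.
rewrite coefDl ?L2Z// coefZl// !phiO.
have [->|ij] := eqVneq i j; first by left.
have [->|i0j] := eqVneq i0 j; first by right.
by rewrite mulr0 addr0 eqxx.
Qed.

Lemma L2n_sqr f : nrm f ^+ 2 = coef m f f.
Proof. by rewrite sqr_sqrtr// coef_ge0. Qed.

Lemma sqnorm_ge0 s A : (0 <= sobolev_sqnorm m phi lam s A)%E.
Proof. by apply: esum_ge0 => i _; rewrite lee_fin mulr_ge0 ?sqr_ge0 ?powR_ge0. Qed.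

Lemma sobolev_sqnormE s A : sobolev0 m phi lam s A ->
  sobolev_sqnorm m phi lam s A = (sobolev_norm m phi lam s A ^+ 2)%:E.
Proof.
move=> [_ _ foo]; rewrite sqr_sqrtr ?fine_ge0 ?sqnorm_ge0// fineK//.
by rewrite ge0_fin_numE ?sqnorm_ge0.
Qed.

Lemma sobolev_norm_ge0 s A : 0 <= sobolev_norm m phi lam s A.
Proof. exact: sqrtr_ge0. Qed.

Lemma sobolev_L2n s A : 0 <= s -> sobolev0 m phi lam s A -> nrm A <= sobolev_norm m phi lam s A.
Proof.
move=> s0 hA; have [AL _ _] := hA.
rewrite -ler_sqr ?nnegrE ?sqrtr_ge0// L2n_sqr -lee_fin -(sobolev_sqnormE hA) -(parseval hb AL).
apply: le_esum => i _; rewrite lee_fin ler_peMr ?sqr_ge0//.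
rewrite -[leLHS](powRr0 (1 + lam i)).
by apply: (@ler_powR R (1 + lam i) _ 0 s) => //; rewrite lerDl.
Qed.

Section cutoff.
Context (L : R) (S : seq I) (L0 : 0 <= L) (uS : uniq S) (SL : forall i, (i \in S) = (lam i <= L)).

(** The coefficients are taken against [phi] but attached to [psi]: this is the spectral projection
    of [A], corrected along [phi i0] to have mean zero. *)
Definition trunc (A : X -> R) (x : X) := \sum_(i <- S) coef m A (phi i) * psi i x.

Lemma trunc_L2 A : trunc A \in L2.
Proof. by apply: L2_sum => i _; apply: L2Z; exact: psi_L2. Qed.

(** Let A' be the part of [A] above the cutoff. As [A] has mean zero, the low part has the opposite
    mean to A', so the correction along [phi i0] is governed by A' and the error is at most kappa
    |A'|. By Parseval, |A'|^2 is at most (1 + L)^(-s) times the squared Sobolev norm. *)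
Lemma truncation_error s A : 0 <= s -> sobolev0 m phi lam s A ->
  nrm (fun x => A x + -1 * trunc A x) <= kappa * (1 + L) `^ (- s / 2) * sobolev_norm m phi lam s A.
Proof.
move=> s0 hA; have [AL A0 _] := hA.
have L1 : 0 < 1 + L by rewrite ltr_pwDl.
pose a i := coef m A (phi i).
pose sp := fun x => \sum_(i <- S) a i * phi i x.
have spL : sp \in L2 by apply: L2_sum => i _; exact: L2Z.
pose A' := fun x => A x + -1 * sp x.
have A'L : A' \in L2 by apply: L2D => //; exact: L2Z.
have cA' i : coef m A' (phi i) = if i \in S then 0 else a i.
  rewrite coefDl ?L2Z// coefZl// coef_suml//; last by move=> j _; exact: L2Z.
  under eq_bigr => j _ do rewrite coefZl// phiO.
  case: ifPn => iS.
    rewrite (bigD1_seq i)//= eqxx mulr1 big1 ?addr0 ?mulN1r ?subrr//.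
    by move=> j ji; rewrite (negbTE ji) mulr0.
  rewrite big_seq big1 ?mulr0 ?addr0// => j jS.
  by case: eqVneq => [ji|]; [rewrite -ji jS in iS|rewrite mulr0].
have mA' : \int[m]_x A' x = - \sum_(i <- S) a i * mean i.
  rewrite -coef_one coefC coefDl ?L2Z ?L2_one// coefZl ?L2_one// coefC coef_one A0 add0r mulN1r.
  rewrite coef_suml ?L2_one//; last by move=> j _; exact: L2Z.
  by congr (- _); apply: eq_bigr => i _; rewrite coefZl ?L2_one// coefC coef_one.
have -> : (fun x => A x + -1 * trunc A x) = (fun x => A' x + - (\int[m]_x A' x / mean i0) * phi i0 x).
  apply/funext => x; rewrite mA' /A' -addrA; congr (_ + _).
  rewrite /trunc /psi /sp !mulN1r (mulNr _ (mean i0)^-1) opprK.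
  under eq_bigr => i _ do rewrite mulrDr.
  rewrite big_split/= opprD; congr (_ + _).
  rewrite mulr_suml mulr_suml -sumrN; apply: eq_bigr => i _; rewrite -/(a i); ring.
apply: le_trans (L2nD A'L (L2Z _ (phiL i0))) _; rewrite L2nZ// phi_norm mulr1 normrN.
apply: (@le_trans _ _ (kappa * nrm A')).
  by rewrite mulrDl mul1r lerD2l; exact: mean_ratio_le.
rewrite -mulrA; apply: ler_wpM2l; first by rewrite addr_ge0.
rewrite -ler_sqr ?nnegrE ?mulr_ge0 ?powR_ge0 ?sqrtr_ge0//.
rewrite L2n_sqr exprMn -(powR_mulrn _ (powR_ge0 _ _)) -powRrM divfK//.
rewrite -lee_fin EFinM -(sobolev_sqnormE hA) -(parseval hb A'L).
apply: le_trans (esumZl_le _ _ _); [|exact: powR_ge0|by move=> i; rewrite lee_fin mulr_ge0 ?sqr_ge0 ?powR_ge0].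
apply: le_esum => i _; rewrite cA' -EFinM lee_fin.
case: ifPn => [_|iS]; first by rewrite expr0n/=; apply: mulr_ge0; [exact: powR_ge0|apply: mulr_ge0; [exact: sqr_ge0|exact: powR_ge0]].
rewrite mulrCA ler_peMr ?sqr_ge0// powRN ler_pdivlMl ?powR_gt0// mulr1.
have iL : L < lam i by rewrite ltNge -SL.
apply: ge0_ler_powR; rewrite ?nnegrE ?lerD2l//; [exact: ltW|by rewrite addr_ge0|exact: ltW].
Qed.

Lemma bessel A : A \in L2 -> \sum_(i <- S) coef m A (phi i) ^+ 2 <= coef m A A.
Proof.
move=> AL; rewrite -lee_fin -(parseval hb AL) -sumEFin; apply: esum_ge.
exists [set` S]; first by split=> //; exact: finite_seq.
by rewrite fsbig_seq.
Qed.

(** [A] and [B] are split into truncation and remainder. The truncated pair is a double sum, handled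
    by one Cauchy-Schwarz over pairs and Bessel's inequality; the other two terms cost kappa (1 +
    kappa) and kappa times the small power, which add up to kappa (kappa + 2). *)
Lemma correlation_bound s A B (T : X -> X) : 0 <= s ->
  measurable_fun setT T -> (forall E, measurable E -> m (T @^-1` E) = m E) ->
  sobolev0 m phi lam s A -> sobolev0 m phi lam s B ->
  `|coef m A (B \o T)| <= sobolev_norm m phi lam s A * sobolev_norm m phi lam s B *
     (Num.sqrt (\sum_(i <- S) \sum_(j <- S) coef m (psi i) (psi j \o T) ^+ 2)
      + kappa * (kappa + 2) * (1 + L) `^ (- s / 2)).
Proof.
move=> s0 mT hT hA hB.
have [AL _ _] := hA; have [BL _ _] := hB.
set nA := sobolev_norm _ _ _ _ A; set nB := sobolev_norm _ _ _ _ B; set e := _ `^ _.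
have nA0 : 0 <= nA by exact: sobolev_norm_ge0.
have nB0 : 0 <= nB by exact: sobolev_norm_ge0.
have k0 : 0 <= kappa by rewrite addr_ge0.
have e0 : 0 <= e by exact: powR_ge0.
have e1 : e <= 1.
  rewrite /e mulNr powRN invf_le1 ?powR_gt0 ?ltr_pwDl//.
  rewrite -[leLHS](powRr0 (1 + L)); apply: (@ler_powR R (1 + L) _ 0 (s / 2)); first by rewrite lerDl.
  by rewrite divr_ge0.
have tAL := trunc_L2 A; have tBL := trunc_L2 B.
pose rA x := A x + -1 * trunc A x; pose rB x := B x + -1 * trunc B x.
have rAL : rA \in L2 by apply: L2D => //; exact: L2Z.
have rBL : rB \in L2 by apply: L2D => //; exact: L2Z.
have rAn : nrm rA <= kappa * e * nA by exact: truncation_error.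
have rBn : nrm rB <= kappa * e * nB by exact: truncation_error.
have An : nrm A <= nA by exact: sobolev_L2n.
have Bn : nrm B <= nB by exact: sobolev_L2n.
have L2T f : f \in L2 -> f \o T \in L2 by exact: L2_preserving.
have nT f : f \in L2 -> nrm (f \o T) = nrm f.
  by move=> fL; rewrite /L2n (coef_preserving mT hT (L2_measurable fL) (L2_measurable fL)).
have tAn : nrm (trunc A) <= (1 + kappa) * nA.
  have -> : trunc A = (fun x => A x + -1 * rA x) by apply/funext => x; rewrite /rA; ring.
  apply: le_trans (L2nD AL (L2Z _ rAL)) _; rewrite L2nZ// normrN1 mul1r mulrDl mul1r lerD//.
  apply: le_trans rAn _; rewrite ler_wpM2r// -[leRHS]mulr1 ler_wpM2l//.
have -> : coef m A (B \o T) = coef m (trunc A) (trunc B \o T) + coef m (trunc A) (rB \o T) + coef m rA (B \o T).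
  have EA : A = (fun x => trunc A x + rA x) by apply/funext => x; rewrite /rA; ring.
  have EB : B \o T = (fun x => (trunc B \o T) x + (rB \o T) x) by apply/funext => x; rewrite /rB /=; ring.
  rewrite {1}EA coefDl ?L2T//; congr (_ + _).
  by rewrite {1}EB coefC coefDl ?L2T// ![coef m _ (trunc A)]coefC.
apply: le_trans (ler_normD _ _) _; apply: le_trans (lerD (ler_normD _ _) (lexx _)) _.
have H1 : `|coef m (trunc A) (rB \o T)| <= (1 + kappa) * nA * (kappa * e * nB).
  apply: le_trans (coef_le_sqrt tAL (L2T _ rBL)) _; rewrite -!/(nrm _) nT//.
  by apply: ler_pM; rewrite ?sqrtr_ge0.
have H2 : `|coef m rA (B \o T)| <= kappa * e * nA * nB.
  apply: le_trans (coef_le_sqrt rAL (L2T _ BL)) _; rewrite -!/(nrm _) nT//.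
  by apply: ler_pM; rewrite ?sqrtr_ge0.
set Q := Num.sqrt _.
suff H0 : `|coef m (trunc A) (trunc B \o T)| <= nA * nB * Q.
  apply: le_trans (lerD (lerD H0 H1) H2) _.
  by rewrite le_eqVlt; apply/orP; left; apply/eqP; ring.
pose a i := coef m A (phi i); pose b i := coef m B (phi i).
have -> : coef m (trunc A) (trunc B \o T) =
    \sum_(p <- [seq (i, j) | i <- S, j <- S]) (a p.1 * b p.2) * coef m (psi p.1) (psi p.2 \o T).
  rewrite big_allpairs_dep coef_suml ?L2T//; last by move=> i _; apply: L2Z; exact: psi_L2.
  apply: eq_bigr => i _; rewrite coefZl ?L2T ?psi_L2// [coef m (psi i) _]coefC.
  rewrite (@coef_suml _ _ _ m I S xpredT (fun j x => b j * (psi j \o T) x) (psi i)) ?psi_L2//; last first.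
    by move=> j _; apply: L2Z; apply: L2T; exact: psi_L2.
  rewrite mulr_sumr; apply: eq_bigr => j _ /=.
  by rewrite coefZl ?L2T ?psi_L2// [coef m (psi j \o T) _]coefC mulrA.
apply: le_trans (sum_cauchy_schwarz _ _ _) _; rewrite !big_allpairs_dep /= -/Q.
apply: ler_wpM2r; first exact: sqrtr_ge0.
have Ea : Num.sqrt (\sum_(i <- S) a i ^+ 2) <= nA.
  by apply: le_trans An; apply: ler_wsqrtr; exact: bessel.
have Eb : Num.sqrt (\sum_(i <- S) b i ^+ 2) <= nB.
  by apply: le_trans Bn; apply: ler_wsqrtr; exact: bessel.
apply: le_trans (ler_pM (sqrtr_ge0 _) (sqrtr_ge0 _) Ea Eb).
rewrite -sqrtrM; last by apply: sumr_ge0 => i _; exact: sqr_ge0.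
rewrite mulr_suml; apply: ler_wsqrtr; rewrite le_eqVlt; apply/orP; left; apply/eqP.
apply: eq_bigr => i _; rewrite mulr_sumr; apply: eq_bigr => j _; exact: exprMn.
Qed.
End cutoff.
End truncation.

(** * The random constant *)

Section nneseries_bounds.
Context (R : realType).

Lemma nneseries_le_bound (u : nat -> R) (c : R) : (forall n, 0 <= u n) ->
  (forall n, \sum_(0 <= i < n) u i <= c) -> (\sum_(0 <= i <oo) (u i)%:E <= c%:E)%E.
Proof.
move=> u0 uc; apply: lime_le; first by apply: is_cvg_nneseries => n _ _; rewrite lee_fin.
by near=> n; rewrite sumEFin lee_fin.
Unshelve. all: by end_near. Qed.

Lemma nneseries_ge_term (u : nat -> \bar R) n : (forall n, 0 <= u n)%E ->
  (u n <= \sum_(0 <= i <oo) u i)%E.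
Proof.
move=> u0; apply: (@le_trans _ _ (\sum_(0 <= i < n.+1) u i)%E).
  by rewrite big_nat_recr//= leeDr// sume_ge0.
exact: nneseries_lim_ge.
Qed.

Lemma geometric_partial_sum_le (q : R) n : 0 <= q -> q < 1 -> \sum_(0 <= i < n) q ^+ i <= (1 - q)^-1.
Proof.
move=> q0 q1; have q1' : 0 < 1 - q by rewrite subr_gt0.
rewrite big_mkord -[leRHS]mul1r ler_pdivlMr// mulrC.
have -> : (1 - q) * \sum_(i < n) q ^+ i = 1 - q ^+ n by rewrite -[RHS]opprB subrX1 -mulNr opprB.
by rewrite gerBl exprn_ge0.
Qed.

Lemma telescoping_partial_sum (n : nat) :
  \sum_(0 <= i < n) (i.+1%:R * i.+2%:R)^-1 = 1 - n.+1%:R^-1 :> R.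
Proof.
elim: n => [|n IH]; first by rewrite big_nil invr1 subrr.
rewrite big_nat_recr//= IH -[in n.+2%:R]addn1 natrD.
have : n.+1%:R != 0 :> R by rewrite pnatr_eq0.
have : n.+1%:R + 1 != 0 :> R by rewrite natr1 pnatr_eq0.
by move: (n.+1%:R) => x x1 x0; field; rewrite x0 x1.
Qed.
End nneseries_bounds.

Lemma measurable_superlevel dW (W : measurableType dW) (R : realType) (f : W -> R) (x : R) :
  measurable_fun setT f -> measurable [set w | x < f w].
Proof.
move=> mf; rewrite (_ : [set w | _] = setT `&` f @^-1` `]x, +oo[%classic); first by apply: mf.
by apply/seteqP; split=> w; rewrite /= in_itv/= andbT => // -[].
Qed.

Section random_constant.
Context dW (W : measurableType dW) (R : realType) (P : probability W R).
Context (sh : nat -> W -> W) (X : nat -> W -> R) (K a : R).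
Hypotheses (msh : forall n, measurable_fun setT (sh n)).
Hypothesis (hsh : forall n E, measurable E -> P (sh n @^-1` E) = P E).
Hypotheses (mX : forall k, measurable_fun setT (X k)) (X0 : forall k w, 0 <= X k w).
Hypotheses (a0 : 0 < a) (K0 : 0 <= K).
Hypothesis (EX : forall k, (\int[P]_w (X k w)%:E <= (K * expR (- (a * k%:R)))%:E)%E).

Let q := expR (- (a / 2)).
(** Half of the rate [a] is spent on the weight; the expectations of the terms are then bounded by a
    geometric series of ratio [q]. *)
Let Y w := (\sum_(0 <= k <oo) (expR (a / 2 * k%:R) * X k w)%:E)%E.
(* A telescoping series of sum 1. *)
Let c (n : nat) : R := (n.+1%:R * n.+2%:R)^-1.
(** The index [n] stands for the starting time N = n + 1, of weight 1/(N (N + 1)). Every shifted [Y]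
    has the same expectation, so that of [Z] obeys the bound for [Y]. *)
Let Z w := (\sum_(0 <= n <oo) ((c n)%:E * Y (sh n.+1 w)))%E.

Let c0 n : 0 <= c n. Proof. by rewrite invr_ge0 mulr_ge0. Qed.
Let yt0 k w : (0 <= (expR (a / 2 * k%:R) * X k w)%:E)%E.
Proof. by rewrite lee_fin mulr_ge0// expR_ge0. Qed.
Let Y0 w : (0 <= Y w)%E. Proof. exact: nneseries_ge0. Qed.
Let zt0 n w : (0 <= (c n)%:E * Y (sh n.+1 w))%E. Proof. by rewrite mule_ge0// lee_fin. Qed.
Let Z0 w : (0 <= Z w)%E. Proof. exact: nneseries_ge0. Qed.

Let myt k : measurable_fun setT (fun w => (expR (a / 2 * k%:R) * X k w)%:E).
Proof. by apply/measurable_EFinP; apply: measurable_funM. Qed.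

Let mY : measurable_fun setT Y.
Proof. by apply: ge0_emeasurable_sum => // k w _ _; exact: yt0. Qed.

Let mzt n : measurable_fun setT (fun w => (c n)%:E * Y (sh n.+1 w))%E.
Proof. by apply: measurable_funeM; exact: (measurableT_comp mY (msh n.+1)). Qed.

Let mZ : measurable_fun setT Z.
Proof. by apply: ge0_emeasurable_sum => // n w _ _; exact: zt0. Qed.

Let q0 : 0 <= q. Proof. exact: expR_ge0. Qed.
Let q1 : q < 1. Proof. by rewrite expR_lt1 oppr_lt0 divr_gt0. Qed.

Let EY : (\int[P]_w Y w <= (K * (1 - q)^-1)%:E)%E.
Proof.
rewrite integral_nneseries//.
apply: (@le_trans _ _ (\sum_(0 <= k <oo) (K%:E * (q ^+ k)%:E))%E).
  apply: lee_nneseries => [k _ _|k _]; first by apply: integral_ge0 => w _; exact: yt0.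
  under eq_integral do rewrite EFinM.
  rewrite ge0_integralZl//; [|exact/measurable_EFinP|by move=> w _; rewrite lee_fin].
  apply: le_trans (lee_wpmul2l _ (EX k)) _; first by rewrite lee_fin expR_ge0.
  rewrite -!EFinM lee_fin mulrCA ler_wpM2l// -expRD /q -expRM_natl ler_expR.
  by rewrite le_eqVlt; apply/orP; left; apply/eqP; field.
rewrite nneseriesZl; last by move=> k _; rewrite lee_fin exprn_ge0.
rewrite EFinM; apply: lee_wpmul2l; first by rewrite lee_fin.
apply: nneseries_le_bound => n; first exact: exprn_ge0.
exact: geometric_partial_sum_le.
Qed.

Let EZ : (\int[P]_w Z w <= (K * (1 - q)^-1)%:E)%E.
Proof.
have B0 : 0 <= K * (1 - q)^-1 by rewrite mulr_ge0// invr_ge0 subr_ge0 ltW.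
rewrite integral_nneseries//.
apply: (@le_trans _ _ (\sum_(0 <= n <oo) ((K * (1 - q)^-1)%:E * (c n)%:E))%E).
  apply: lee_nneseries => [n _ _|n _]; first by apply: integral_ge0 => w _; exact: zt0.
  rewrite ge0_integralZl//; first last.
  - by rewrite lee_fin.
  - exact: (measurableT_comp mY (msh n.+1)).
  rewrite (ge0_integral_preserving (msh n.+1) (hsh n.+1) mY Y0) muleC.
  by apply: lee_wpmul2r; [rewrite lee_fin|exact: EY].
rewrite nneseriesZl; last by move=> n _; rewrite lee_fin.
rewrite -[leRHS]mule1; apply: lee_wpmul2l; first by rewrite lee_fin.
apply: nneseries_le_bound => // n.
by rewrite telescoping_partial_sum gerBl invr_ge0.
Qed.

(** Each term of the series is at most its sum [Z], hence X_k after the shift by N is at most N (N +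
    1) e^(-a k / 2) Z. Taking roots gives the rate a / 4, and the single null set where [Z] is
    infinite serves all [N] and [k]. *)
Lemma random_constant : exists C0 : W -> R, [/\ measurable_fun setT C0, forall w, 0 <= C0 w,
   {ae P, forall w, forall N k, (1 <= N)%N -> Num.sqrt (X k (sh N w)) <= C0 w * N%:R * expR (- (a / 4 * k%:R))}
  & exists2 K2 : R, 0 <= K2 & forall D : R, 0 < D -> (P [set w | (D < C0 w)%R] <= (K2 / D ^+ 2)%:E)%E].
Proof.
have B0 : 0 <= K * (1 - q)^-1 by rewrite mulr_ge0// invr_ge0 subr_ge0 ltW.
(* The factor 2 is from N (N + 1) <= 2 N^2. Where [Z] is infinite, [fine] returns 0 and nothing is
   claimed. *)
pose C0 w := Num.sqrt (2 * fine (Z w)).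
have mC : measurable_fun setT C0.
  have m2Z : measurable_fun setT (fun w => 2 * fine (Z w)).
    by apply: measurable_funM => //; exact: measurableT_comp.
  exact: (measurableT_comp (continuous_measurable_fun (@sqrt_continuous R)) m2Z).
exists C0; split => //.
- by move=> w; exact: sqrtr_ge0.
- have iZ : P.-integrable setT Z.
    apply/integrableP; split=> //.
    under eq_integral do rewrite gee0_abs//.
    exact: le_lt_trans EZ (ltry _).
  have := integrable_ae measurableT iZ.
  apply: filterS => w /(_ I) Zfin [//|n] k _.
  have H : X k (sh n.+1 w) <= n.+1%:R * n.+2%:R * expR (- (a / 2 * k%:R)) * fine (Z w).
    have : ((c n * (expR (a / 2 * k%:R) * X k (sh n.+1 w)))%:E <= Z w)%E.
      apply: le_trans (nneseries_ge_term n (zt0^~ w)).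
      rewrite EFinM; apply: lee_wpmul2l; first by rewrite lee_fin.
      exact: (nneseries_ge_term k (yt0^~ _)).
    rewrite -(fineK Zfin) lee_fin /c ler_pdivrMl; last by rewrite mulr_gt0.
    rewrite -ler_pdivlMl ?expR_gt0// -expRN => /le_trans; apply.
    by rewrite le_eqVlt; apply/orP; left; apply/eqP; ring.
  have z0 : 0 <= fine (Z w) by exact: fine_ge0.
  rewrite -[leRHS]ger0_norm; last by rewrite !mulr_ge0 ?sqrtr_ge0 ?expR_ge0.
  rewrite -sqrtr_sqr; apply: ler_wsqrtr; apply: le_trans H _.
  rewrite !exprMn sqr_sqrtr; last by rewrite mulr_ge0.
  rewrite -[expR _ ^+ 2]expRM_natl.
  have -> : 2%:R * - (a / 4 * k%:R) = - (a / 2 * k%:R) by field.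
  have E0 : 0 <= expR (- (a / 2 * k%:R)) by exact: expR_ge0.
  rewrite (_ : 2 * fine (Z w) * n.+1%:R ^+ 2 * expR _ = n.+1%:R * (2 * n.+1%:R) * expR (- (a / 2 * k%:R)) * fine (Z w)); last by ring.
  rewrite ler_wpM2r// ler_wpM2r// ler_wpM2l// -natrM ler_nat; lia.
exists (2 * (K * (1 - q)^-1)); first by rewrite mulr_ge0.
(* D < C0 means D^2 / 2 < fine Z, so Markov's inequality is applied to [Z] at the level D^2 / 2. *)
move=> D D0; have D2 : 0 < D ^+ 2 / 2 by rewrite divr_gt0// exprn_gt0.
have mS : measurable (setT `&` [set w | ((D ^+ 2 / 2)%:E <= `|Z w|)%E]).
  apply: emeasurable_fun_c_infty => //; exact: measurableT_comp.
have := le_integral_abse P measurableT mZ D2.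
rewrite (_ : (\int[P]_(x in setT) `|Z x|)%E = (\int[P]_w Z w)%E); last first.
  by apply: eq_integral => w _; rewrite gee0_abs.
move=> /le_trans /(_ EZ) H.
apply: (@le_trans _ _ (P (setT `&` [set w | ((D ^+ 2 / 2)%:E <= `|Z w|)%E]))).
  apply: le_measure; rewrite ?inE//; first exact: measurable_superlevel.
  move=> w /= Dw; split=> //=; rewrite gee0_abs//.
  have : D ^+ 2 < 2 * fine (Z w).
    rewrite -[ltRHS]sqr_sqrtr ?mulr_ge0 ?fine_ge0//.
    by rewrite ltr_sqr ?nnegrE ?sqrtr_ge0 ?ltW.
  move=> DZ; have : D ^+ 2 / 2 <= fine (Z w) by move: DZ; set u := D ^+ 2 => *; lra.
  case: (Z w) (Z0 w) => [z| |] //= _; by rewrite ?lee_fin// leey.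
rewrite -(@lee_pmul2l _ (D ^+ 2 / 2)%:E)// -EFinM.
apply: le_trans H _; rewrite lee_fin le_eqVlt; apply/orP; left; apply/eqP.
by field; rewrite subr_eq0 !gt_eqF.
Qed.
End random_constant.

(** * The quenched estimate *)

Section expectation.
Context (R : realType) (d : nat) (M : closedRiemannian R d).
Context (vol : probability (borel M) R) (hvol : is_normalized_volume vol).
Context (I : countType) (phi : I -> borel M -> R) (lam : I -> R).
Hypothesis hphi : laplace_eigenbasis vol phi lam.

Lemma laplace_eigenvalue_ge0 i : 0 <= lam i.
Proof.
have [hb smooth eig] := hphi; have [phiL phiO _] := hb.
apply: (eigenvalue_ge0 (smooth i) (eig i)); apply: contrapT => H.
have : coef vol (phi i) (phi i) = 0.
  rewrite -(coef0l vol (phi i)); congr coef; apply/funext => x.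
  by apply: contrapT => /eqP px; apply: H; exists x.
by rewrite phiO eqxx => /eqP; rewrite oner_eq0.
Qed.

Lemma spectral_count : exists2 K : R, 0 <= K & forall L, 0 <= L ->
  forall N (e : 'I_N -> I), injective e -> (forall k, lam (e k) <= L) -> N%:R <= K * (1 + L) ^+ (2 * d).
Proof.
have [hb smooth eig] := hphi; have [phiL phiO _] := hb.
have [K [K0 HK]] := eigen_count hvol; exists K => // L L0 N e einj eL.
apply: (HK N (fun k => phi (e k)) (fun k => lam (e k))) => //.
  by split=> [k|k|k|k l]; [exact: smooth|exact: eig|exact: phiL|rewrite phiO (inj_eq einj)].
by move=> k; rewrite ger0_norm// laplace_eigenvalue_ge0.
Qed.

Context (r : option nat) (P : probability (words vol r) R).
Context (p C alpha : R) (p0 : 0 <= p) (C0 : 0 <= C).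
Hypothesis hmix :
  let vol2 := (vol \x vol)%E in
  let H := sobolev0 vol2 (tensor_basis phi) (tensor_eigenvalue lam) p in
  let norm := sobolev_norm vol2 (tensor_basis phi) (tensor_eigenvalue lam) p in
  forall (A B : borel M * borel M -> R) (N : nat), H A -> H B ->
      `|\int[P]_w \int[vol2]_z
           (A z * B (compose w N z.1, compose w N z.2))|
      <= C * norm A * norm B * expR (- alpha * N%:R).

Lemma corr_sqr_mixing (f g : borel M -> R) (L kappa : R) k : 0 <= L -> 
  f \in Lfun vol 2%:E -> g \in Lfun vol 2%:E ->
  \int[vol]_x f x = 0 -> \int[vol]_x g x = 0 ->
  (forall i, coef vol f (phi i) != 0 -> lam i <= L) ->
  (forall i, coef vol g (phi i) != 0 -> lam i <= L) ->
  coef vol f f <= kappa -> coef vol g g <= kappa ->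
  (\int[P]_w (corr f g k w ^+ 2)%:E <=
    (C * kappa ^+ 2 * (1 + 2 * L) `^ p * expR (- alpha * k%:R))%:E)%E.
Proof.
move=> L0 fL gL f0 g0 fs gs fk gk.
have [hb _ _] := hphi.
have [hA nA] := tensor_sobolev hb laplace_eigenvalue_ge0 p0 L0 fL f0 fs.
have [hB nB] := tensor_sobolev hb laplace_eigenvalue_ge0 p0 L0 gL g0 gs.
rewrite corr_sqr_expectation// lee_fin; apply: le_trans (ler_norm _) _.
apply: le_trans (hmix k hA hB) _.
apply: ler_wpM2r; first exact: expR_ge0.
rewrite -!mulrA; apply: ler_wpM2l => //.
have L1 : 0 < 1 + 2 * L by rewrite ltr_pwDl// mulr_ge0.
have -> : kappa * (kappa * (1 + 2 * L) `^ p) = ((1 + 2 * L) `^ (p / 2) * kappa) * ((1 + 2 * L) `^ (p / 2) * kappa).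
  rewrite [in LHS](splitr p) powRD; last by apply/implyP => _; rewrite lt0r_neq0.
  by ring.
have aux x y : x <= (1 + 2 * L) `^ (p / 2) * y -> y <= kappa -> x <= (1 + 2 * L) `^ (p / 2) * kappa.
  by move=> xy yk; apply: le_trans xy _; rewrite ler_wpM2l// powR_ge0.
by apply: ler_pM; rewrite ?sqrtr_ge0//; [exact: aux nA fk|exact: aux nB gk].
Qed.

Context (i0 : I).
Hypothesis hi0 : \int[vol]_x phi i0 x != 0.
Let kappa := 1 + `|\int[vol]_x phi i0 x|^-1.
Hypothesis alpha0 : 0 < alpha.

Definition corr_sum (S : seq I) (k : nat) (w : words vol r) : R :=
  \sum_(i <- S) \sum_(j <- S) corr (psi vol phi i0 i) (psi vol phi i0 j) k w ^+ 2.

Lemma corr_sum_ge0 S k w : 0 <= corr_sum S k w.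
Proof. by apply: sumr_ge0 => i _; apply: sumr_ge0 => j _; exact: sqr_ge0. Qed.

Lemma measurable_corr_sum S k : measurable_fun setT (corr_sum S k).
Proof.
have [hb _ _] := hphi.
apply: measurable_sum => i; apply: measurable_sum => j; exact: (measurable_funX 2 (measurable_corr k (psi_L2 hb i0 i) (psi_L2 hb i0 j))).
Qed.

(** [psi i] also has a component along [phi i0], so its spectrum is bounded by L + lam i0 rather
    than L. Both squared norms are at most kappa^2 and enter the mixing bound squared through the
    tensor norms, whence kappa^4 for each of the pairs. *)
Lemma corr_sum_expectation S k L : 0 <= L -> (forall i, i \in S -> lam i <= L) ->
  (\int[P]_w (corr_sum S k w)%:E <=
   ((size S)%:R ^+ 2 * (C * kappa ^+ 4 * (1 + 2 * (L + lam i0)) `^ p * expR (- alpha * k%:R)))%:E)%E.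
Proof.
move=> L0 SL; have [hb _ _] := hphi.
set B := C * _ * _ * _.
have mc i j : measurable_fun setT (fun w : words vol r => (corr (psi vol phi i0 i) (psi vol phi i0 j) k w ^+ 2)%:E).
  apply/measurable_EFinP; exact: (measurable_funX 2 (measurable_corr k (psi_L2 hb i0 i) (psi_L2 hb i0 j))).
have c0 i j (w : words vol r) : (0 <= (corr (psi vol phi i0 i) (psi vol phi i0 j) k w ^+ 2)%:E)%E by rewrite lee_fin sqr_ge0.
under eq_integral do rewrite /corr_sum -sumEFin.
rewrite ge0_integral_sum//; first last.
- by move=> i w _; rewrite lee_fin; apply: sumr_ge0 => j _; exact: sqr_ge0.
- move=> i; apply/measurable_EFinP; apply: measurable_sum => j.
  exact: (measurable_funX 2 (measurable_corr k (psi_L2 hb i0 i) (psi_L2 hb i0 j))).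
have L1 : 0 <= L + lam i0 by rewrite addr_ge0// laplace_eigenvalue_ge0.
have l0 := laplace_eigenvalue_ge0 i0.
have psup i : i \in S -> forall j, coef vol (psi vol phi i0 i) (phi j) != 0 -> lam j <= L + lam i0.
  move=> /SL iL j /(coef_psi_support hb) [->|->].
    by rewrite -[lam i]addr0 lerD.
  by rewrite lerDr.
have pn i : coef vol (psi vol phi i0 i) (psi vol phi i0 i) <= kappa ^+ 2.
  by rewrite -L2n_sqr ler_sqr ?nnegrE ?sqrtr_ge0 ?addr_ge0//; exact: (psi_norm hb).
have -> : ((size S)%:R ^+ 2 * B)%:E = (\sum_(i <- S) \sum_(j <- S) B%:E)%E.
  under eq_bigr do rewrite sumEFin.
  rewrite sumEFin; congr EFin.
  by rewrite !big_const_seq !count_predT !iter_addr !addr0 -mulrnA -[RHS]mulr_natl natrM expr2.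
rewrite big_seq [leRHS]big_seq; apply: lee_sum => i iS.
under eq_integral do rewrite -sumEFin.
rewrite ge0_integral_sum//.
rewrite big_seq [leRHS]big_seq; apply: lee_sum => j jS.
rewrite /B -[4%N]/(2 * 2)%N exprM.
apply: corr_sqr_mixing => //; try exact: (psi_L2 hb); try exact: (integral_psi hb); try exact: psup; exact: pn.
Qed.
End expectation.

(** [x] is the frequency cutoff and [n] the number of eigenvalues below it; the pairs contribute the
    power 4 d and the Sobolev norms the power p. *)
Lemma growth_bound (R : realType) (K C kappa p l0 : R) (d : nat) :
  0 <= K -> 0 <= C -> 0 <= p -> 0 <= l0 ->
  exists2 G : R, 0 <= G & forall x n : R, 1 <= x -> 0 <= n -> n <= K * (1 + x) ^+ (2 * d) ->
    n ^+ 2 * (C * kappa ^+ 4 * (1 + 2 * (x + l0)) `^ p) <= G * x `^ (4 * d%:R + p).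
Proof.
move=> K0 C0 p0 l0'.
(* As x >= 1, both 1 + x and 1 + 2 (x + l0) are at most (3 + 2 l0) x. *)
pose g : R := 3 + 2 * l0.
have g0 : 0 < g by rewrite ltr_pwDl// mulr_ge0.
exists (K ^+ 2 * (C * kappa ^+ 4) * g `^ (4 * d%:R + p)).
  by rewrite mulr_ge0 ?powR_ge0// mulr_ge0 ?sqr_ge0// mulr_ge0// -[4%N]/(2 * 2)%N exprM sqr_ge0.
move=> x n x1 n0 nK.
have x0 : 0 < x by apply: lt_le_trans x1.
have gx : 0 < g * x by rewrite mulr_gt0.
have k4 : 0 <= kappa ^+ 4 by rewrite -[4%N]/(2 * 2)%N exprM sqr_ge0.
have lx : l0 <= l0 * x by rewrite ler_peMr.
have h1 : 1 + x <= g * x by rewrite /g mulrDl; nra.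
have h2 : 1 + 2 * (x + l0) <= g * x by rewrite /g mulrDl; nra.
have n2 : n ^+ 2 <= K ^+ 2 * (g * x) `^ (4 * d%:R).
  have nK' : n <= K * (g * x) ^+ (2 * d).
    apply: le_trans nK _; apply: ler_wpM2l => //; apply: lerXn2r; rewrite ?nnegrE// ?ltW//.
    by rewrite addr_gt0.
  have -> : (g * x) `^ (4 * d%:R) = ((g * x) ^+ (2 * d)) ^+ 2.
    rewrite -exprM -powR_mulrn ?ltW//; congr (_ `^ _).
    by rewrite !natrM; ring.
  by rewrite -exprMn ler_sqr ?nnegrE// (le_trans n0).
have p2 : (1 + 2 * (x + l0)) `^ p <= (g * x) `^ p.
  apply: ge0_ler_powR => //; rewrite nnegrE; last exact: ltW.
  by rewrite addr_ge0// mulr_ge0// addr_ge0// ltW.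
apply: (@le_trans _ _ (K ^+ 2 * (g * x) `^ (4 * d%:R) * (C * kappa ^+ 4 * (g * x) `^ p))).
  apply: ler_pM => //; first exact: sqr_ge0.
    by rewrite mulr_ge0 ?powR_ge0// mulr_ge0.
  by apply: ler_wpM2l => //; rewrite mulr_ge0.
have gE : g `^ (4 * d%:R + p) * x `^ (4 * d%:R + p) = (g * x) `^ (4 * d%:R) * (g * x) `^ p.
  rewrite -powRM; [|exact: ltW|exact: ltW].
  by rewrite powRD//; apply/implyP => _; rewrite lt0r_neq0.
by rewrite -[leRHS]mulrA gE le_eqVlt; apply/orP; left; apply/eqP; ring.
Qed.

Theorem theorem1p6 (R : realType) (d : nat) (M : closedRiemannian R d)
    (vol : probability (borel M) R) (hvol : is_normalized_volume vol)
    (I : countType) (phi : I -> borel M -> R) (lam : I -> R)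
    (hphi : laplace_eigenbasis vol phi lam)
    (r : option nat) (hr : le_reg 1 r)
    (mu : probability (borelDiff vol r) R)
    (P : probability (words vol r) R) (hP : is_product_measure mu P)
    (hmix : exists2 p : R, 0 <= p & two_point_mixing P phi lam p) :
  forall s : R, 0 < s ->
  exists2 beta : R, 0 < beta &
  exists C : words vol r -> R,
  [/\ measurable_fun [set: words vol r] C,
      {ae P, forall w, forall (A B : borel M -> R) (N k : nat),
         sobolev0 vol phi lam s A -> sobolev0 vol phi lam s B -> (1 <= N)%N ->
         `|\int[vol]_x (A (compose w N x) * B (compose w (N + k) x))|
         <= C w * N%:R * sobolev_norm vol phi lam s A
            * sobolev_norm vol phi lam s B * expR (- beta * k%:R)}
    & exists C' : R, forall D : R, 0 < D ->
        (P [set w | (D < C w)%R] <= (C' / D ^+ 2)%:E)%E].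
Proof.
move=> s s0.
have [p p0 [C [alpha [C0 alpha0 mix]]]] := hmix.
have [hb _ _] := hphi.
have lam0 := laplace_eigenvalue_ge0 hphi.
have [K K0 count] := spectral_count hvol hphi.
have [i0 hi0] := exists_nonzero_mean hb.
pose kappa := 1 + `|\int[vol]_x phi i0 x|^-1.
have [G G0 HG] := growth_bound kappa d K0 C0 p0 (lam0 i0).
(* Makes eps (4 d + p) at most alpha / 2, so the polynomial losses at the cutoff e^(eps k) use up at
   most half of the mixing rate; the + 1 keeps the denominator positive when d = 0 and p = 0. *)
pose eps := alpha / (2 * (4 * d%:R + p + 1)).
have den0 : 0 < 4 * d%:R + p + 1 by rewrite ltr_wpDl// addr_ge0// mulr_ge0.
have eps0 : 0 < eps by rewrite divr_gt0// mulr_gt0.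
pose Lam (k : nat) := expR (eps * k%:R).
have Lam1 k : 1 <= Lam k by rewrite -expR0 ler_expR mulr_ge0// ltW.
have LamP k x : Lam k `^ x = expR (eps * k%:R * x) by rewrite expRM.
have Lam0 k : 0 <= Lam k by rewrite (le_trans _ (Lam1 k)).
have /choice[S HS] : forall k, exists S : seq I, [/\ uniq S, forall i, (i \in S) = (lam i <= Lam k)
    & (size S)%:R <= K * (1 + Lam k) ^+ (2 * d)].
  by move=> k; apply: spectral_set => //; exact: count.
pose X k := corr_sum (vol := vol) (r := r) phi i0 (S k) k.
have ah : 0 < alpha / 2 by rewrite divr_gt0.
have EX k : (\int[P]_w (X k w)%:E <= (G * expR (- (alpha / 2 * k%:R)))%:E)%E.
  have [uS SL nS] := HS k.
  have SL' i : i \in S k -> lam i <= Lam k by rewrite SL.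
  apply: le_trans (corr_sum_expectation hphi p0 C0 mix hi0 k (Lam0 k) SL') _; rewrite lee_fin -/kappa.
  rewrite mulrA; apply: (@le_trans _ _ (G * Lam k `^ (4 * d%:R + p) * expR (- alpha * k%:R))).
    by apply: ler_wpM2r; [exact: expR_ge0|exact: HG].
  rewrite -mulrA; apply: ler_wpM2l => //; rewrite LamP -expRD ler_expR.
  have H : eps * (4 * d%:R + p) <= alpha / 2.
    have -> : eps * (4 * d%:R + p) = alpha / 2 * ((4 * d%:R + p) / (4 * d%:R + p + 1)).
      by rewrite /eps; field; rewrite gt_eqF.
    by apply: ler_piMr; [exact: ltW ah|rewrite ler_pdivrMr// mul1r lerDl].
  have := ler_wpM2r (ler0n R k) H; set e := _ * k%:R; set f := _ * k%:R => Hk.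
  have -> : eps * k%:R * (4 * d%:R + p) = e by rewrite /e mulrAC.
  have -> : - alpha * k%:R = - (f + f) by rewrite /f; field.
  by lra.
have [C1 [mC1 C10 Cae [K2 K20 tail]]] := random_constant (@measurable_lshift _ _ _ vol r)
  (lshift_preserving hP) (fun k => measurable_corr_sum hphi i0 (S k) k) (fun k => corr_sum_ge0 phi i0 (S k) k) ah G0 EX.
pose c1 := kappa * (kappa + 2).
have kap0 : 0 <= kappa by rewrite addr_ge0.
have c10 : 0 <= c1 by rewrite mulr_ge0// addr_ge0.
(* [random_constant] is applied with the rate alpha / 2 and returns a quarter of it; the other term
   is the decay of the frequencies above the cutoff. *)
pose beta := Num.min (alpha / 8) (eps * s / 2).
exists beta; first by rewrite lt_min !divr_gt0// mulr_gt0.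
have mC : measurable_fun setT (fun w => C1 w + c1) by exact: measurable_funD.
exists (fun w => C1 w + c1); split.
- exact: mC.
(* [A] and [B] are introduced after the word has been fixed outside the null set, which therefore
   does not depend on them. *)
- apply: filterS Cae => w Hw A B N k hA hB N1.
  have [AL _ _] := hA; have [BL _ _] := hB.
  rewrite corr_lshift//.
  have [uS SL nS] := HS k.
  have := correlation_bound hb lam0 i0 (Lam0 k) uS SL (ltW s0)
    (measurable_compose_word (lshift N w) k) (compose_vol (lshift N w) k) hA hB.
  rewrite -/kappa -/c1; set nA := sobolev_norm _ _ _ _ A; set nB := sobolev_norm _ _ _ _ B.
  move=> /le_trans; apply.
  have nA0 : 0 <= nA by exact: sqrtr_ge0.
  have nB0 : 0 <= nB by exact: sqrtr_ge0.
  set E := expR (- beta * k%:R).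
  have E0 : 0 <= E by exact: expR_ge0.
  have N1' : 1 <= N%:R :> R by rewrite ler1n.
  have b1 : Num.sqrt (\sum_(i <- S k) \sum_(j <- S k) coef vol (psi vol phi i0 i) (psi vol phi i0 j \o compose (lshift N w) k) ^+ 2)
      <= C1 w * N%:R * E.
    apply: le_trans (Hw N k N1) _; apply: ler_wpM2l; first by rewrite mulr_ge0.
    rewrite ler_expR mulNr lerN2 ler_wpM2r//.
    have -> : alpha / 2 / 4 = alpha / 8 by field.
    by rewrite ge_min lexx.
  have b2 : (1 + Lam k) `^ (- s / 2) <= E.
    apply: (@le_trans _ _ (Lam k `^ (- s / 2))).
      rewrite mulNr !powRN lef_pV2 ?posrE ?powR_gt0 ?ltr_pwDl ?expR_gt0//.
      apply: ge0_ler_powR; rewrite ?nnegrE; [by rewrite divr_ge0// ltW|exact: Lam0|by rewrite addr_ge0|by rewrite lerDr].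
    rewrite LamP ler_expR.
    have Hb : beta <= eps * s / 2 by rewrite ge_min lexx orbT.
    have -> : eps * k%:R * (- s / 2) = - (eps * s / 2 * k%:R) by field.
    by rewrite mulNr lerN2 ler_wpM2r.
  (* The truncation error is deterministic; N >= 1 lets it be absorbed into the term that is linear
     in N. *)
  have Q : c1 * (1 + Lam k) `^ (- s / 2) <= c1 * (N%:R * E).
    by apply: ler_wpM2l => //; apply: le_trans b2 _; rewrite ler_peMl.
  apply: le_trans (ler_wpM2l _ (lerD b1 Q)) _; first by rewrite mulr_ge0.
  by rewrite le_eqVlt; apply/orP; left; apply/eqP; ring.
(* If D <= 2 c1, the term 4 c1^2 makes the bound at least 1. Otherwise C1 + c1 > D forces C1 > D /
   2, and the tail of C1 at D / 2 gives 4 K2 / D^2. *)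
exists (4 * K2 + 4 * c1 ^+ 2) => D D0.
have D2 : 0 < D ^+ 2 by rewrite exprn_gt0.
have [Dc|cD] := leP D (2 * c1).
  apply: (@le_trans _ _ 1%E).
    by apply: probability_le1; exact: measurable_superlevel.
  rewrite lee_fin ler_pdivlMr// mul1r.
  apply: (@le_trans _ _ ((2 * c1) ^+ 2)); first by apply: lerXn2r; rewrite ?nnegrE ?(ltW D0)// mulr_ge0.
  by rewrite exprMn -natrX lerDr mulr_ge0.
have D20 : 0 < D / 2 by rewrite divr_gt0.
apply: le_trans (le_trans _ (tail _ D20)) _.
  apply: le_measure; rewrite ?inE.
  - exact: measurable_superlevel.
  - exact: measurable_superlevel.
  - by move=> w /= Dw; lra.
have -> : K2 / (D / 2) ^+ 2 = 4 * K2 / D ^+ 2 by field; rewrite gt_eqF.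
by rewrite lee_fin ler_wpM2r ?invr_ge0 ?sqr_ge0// lerDl mulr_ge0// sqr_ge0.
Qed.
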